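(* Let $\mathrm{SigTh}$ be the Signalling theory, $\mathrm{SpecRel}_0$ the frame-oriented theory of special relativity, and $\mathrm{tr}$ the translation from the language of $\mathrm{SpecRel}_0$ to the language of $\mathrm{SigTh}$, all as specified in the context. Then $\mathrm{tr}$ is an interpretation of $\mathrm{SpecRel}_0$ into $\mathrm{SigTh}$, that is, the following are true: (1) $\mathrm{SigTh}\models$ ''$=_{Q}$ and $=_{B}$ are equivalence relations'', where $=_Q$, $=_B$ are the (defined) equality relations of the new sorts $Q$ and $B$; (2) $\mathrm{SigTh}\models$ ''the formulas defining $+,\star,\mathrm{Ph},\mathrm{Obs},\mathrm{W}$ are invariant under $=_{Q},=_{B}$''; (3) $\mathrm{SigTh}\models\mathrm{tr}(\psi)$ for all $\psi\in\mathrm{SpecRel}_0$.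
   Context: **Euclidean field**: an ordered field in which every positive element has a square root. For such a field $F$, write points of $F^4$ as $(t,x,y,z)$. A line in $F^4$ with direction $d\neq 0$ has slope less than $1$ if $d_x^2+d_y^2+d_z^2<d_t^2$, and slope $1$ if $d_x^2+d_y^2+d_z^2=d_t^2$. **$\mathrm{SpecRel}_0$.** Two-sorted first-order language: sorts $B$ (bodies) and $Q$ (quantities); unary relations $\mathrm{Obs}$ (observers), $\mathrm{Ph}$ (photons) of sort $B$; binary functions $+,\star$ on $Q$ (treated as ternary relations when translating); a six-place relation $\mathrm{W}(o,b,t,x,y,z)$, with $o,b$ of sort $B$ and $t,x,y,z$ of sort $Q$ (''body $b$ is present at time $t$ at place $(x,y,z)$, according to observer $o$''). The world-line of $b$ in the reference frame of $o$ is $\{p\in Q^4:\mathrm{W}(o,b,p)\}$; the event at $p$ according to $o$ is the set of bodies present at $p$ according to $o$. Axioms: - AxPh: the world-lines of photons are exactly the straight lines of slope $1$, in each observer's reference frame. - AxEv: all observers coordinatize the same set of events. - AxSelf: each observer stays put at the origin of its own reference frame, i.e. $\mathrm{W}(o,o,t,x,y,z)\leftrightarrow x=y=z=0$ for each observer $o$. - AxFd: $(Q,+,\star)$ is a Euclidean field. $\mathrm{SpecRel}_0=\{\mathrm{AxPh},\mathrm{AxEv},\mathrm{AxSelf},\mathrm{AxFd}\}$. **$\mathrm{SigTh}$.** Two-sorted language: sorts $\mathrm{Par}$ (particles, experimenters) and $\mathrm{Sig}$ (signals), and binary relations $a\,\mathrm{T}\,\sigma$ (''$a$ transmits $\sigma$'')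 and $a\,\mathrm{R}\,\sigma$ (''$a$ receives $\sigma$'') between particles and signals. For a Euclidean field $F$, the standard model $\mathfrak M(F)$ has $\mathrm{Par}$ = all straight lines in $F^4$ of slope less than $1$; $\mathrm{Sig}$ = all (future-)directed finite segments of straight lines of slope $1$, including the segments of length zero; $a\,\mathrm{T}\,\sigma$ iff the beginning point of $\sigma$ lies on $a$, and $a\,\mathrm{R}\,\sigma$ iff the endpoint of $\sigma$ lies on $a$. $\mathrm{SigTh}$ is the finite axiom system (due to J. Ax) whose models are, up to isomorphism, exactly the standard models $\mathfrak M(F)$, $F$ a Euclidean field; so $\mathrm{SigTh}\models\psi$ iff $\psi$ is true in all $\mathfrak M(F)$. **Translations defining new sorts.** To define a new sort $S$ over a theory one gives: a matching of each variable $v$ of sort $S$ with a tuple $\bar v$ of old variables; a formula $S(\bar v)$ (domain); a formula defining $v=w$ in terms of $\bar v,\bar w$; and for every relation symbol a defining formula in terms of matched variables. The translation $\mathrm{tr}$ replaces atomic formulas by their defining formulas, commutes with connectives, and $\mathrm{tr}(\exists v\,\psi)=\exists\bar v\,(S(\bar v)\wedge\mathrm{tr}(\psi))$. **Auxiliary formulas in the language of $\mathrm{SigTh}$.** Roman letters $a,b,c,d,p,q,\dots$ range over $\mathrm{Par}$; Greek letters and $o,u$ range over $\mathrm{Sig}$; commas mean conjunction; variants of $\varepsilon$ denote events. - $\mathrm{Ev}(\varepsilon)$ (''$\varepsilon$ is an event''): $\forall a\,(a\mathrm{T}\varepsilon\to a\mathrm{R}\varepsilon)$. In standard models these are the segments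 of length zero. - $\mathrm{Beg}(\sigma,\varepsilon)$ (''$\sigma,\varepsilon$ are sent out at the same event''): $\forall b\,(b\mathrm{T}\sigma\to b\mathrm{T}\varepsilon)$; $\mathrm{End}(\sigma,\varepsilon)$ similarly, for receiving: $\forall b\,(b\mathrm{R}\sigma\to b\mathrm{R}\varepsilon)$; $(\varepsilon,\sigma,\gamma)$: $\mathrm{Beg}(\sigma,\varepsilon),\mathrm{End}(\sigma,\gamma)$ (''$\varepsilon,\gamma$ are the events of sending and receiving $\sigma$''). - $a'\|a$ (''$a'$ is motionless w.r.t. $a$''; in standard models: the lines $a,a'$ are equal or parallel): $a'=a$, or $a,a'$ do not meet (no signal is transmitted by both) and there are two other particles $c,d$ which meet $a$, $a'$ and each other in 5 distinct events. $\mathrm{Space}_a=\{b:b\|a\}$ (the locations, or places, of $a$); $\mathrm{Time}_a=\{\varepsilon:\mathrm{Ev}(\varepsilon),a\mathrm{T}\varepsilon\}$ (the world-line of $a$). - $\varepsilon\equiv_a\varepsilon'$ (simultaneity): there are $a'\|a$, events $\varepsilon_1,\varepsilon_2$ transmitted by $a'$, and signals $\sigma_1,\dots,\sigma_4$ with $(\varepsilon_1,\sigma_1,\varepsilon),(\varepsilon_1,\sigma_2,\varepsilon'),(\varepsilon,\sigma_3,\varepsilon_2),(\varepsilon',\sigma_4,\varepsilon_2)$. - $\varepsilon\prec\varepsilon'$ (''$\varepsilon$ is earlier than $\varepsilon'$''): there are $\varepsilon'',\sigma_1,\sigma_2$ with $(\varepsilon,\sigma_1,\varepsilon''),(\varepsilon'',\sigma_2,\varepsilon')$.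 - $\mathrm{Edt}_a(\varepsilon_1,\varepsilon_2,\varepsilon_3,\varepsilon_4)$ (time-equidistance, for events in $\mathrm{Time}_a$): if $\varepsilon_1\prec\varepsilon_3$, there are $a'\|a$, events $\varepsilon,\varepsilon'$ transmitted by $a'$, and signals $\sigma_1,\dots,\sigma_4$ with $(\varepsilon_1,\sigma_1,\varepsilon),(\varepsilon,\sigma_3,\varepsilon_3),(\varepsilon_2,\sigma_2,\varepsilon'),(\varepsilon',\sigma_4,\varepsilon_4)$; if $\varepsilon_3\prec\varepsilon_1$, then $\mathrm{Edt}_a(\varepsilon_3,\varepsilon_4,\varepsilon_1,\varepsilon_2)$ in the former sense. - $\mathrm{Col}(a_1,a_2,a_3)$ (collinearity of locations): there are signals $\sigma_1,\sigma_2,\sigma_3$ and events $\varepsilon_1,\varepsilon_2,\varepsilon_3$ with $(\varepsilon_i,\sigma_1,\varepsilon_j),(\varepsilon_j,\sigma_2,\varepsilon_k),(\varepsilon_i,\sigma_3,\varepsilon_k)$ and $a_1\mathrm{T}\varepsilon_1,a_2\mathrm{T}\varepsilon_2,a_3\mathrm{T}\varepsilon_3$, for some permutation $i,j,k$ of $1,2,3$. $\mathrm{pa}(b_1,b_2,b_3,b_4)$: the spatial lines defined by $b_1,b_2$ and by $b_3,b_4$ are parallel (expressed using $\mathrm{Col}$). - $\mathrm{Fp}(a,o,u)$: $\mathrm{Ev}(o),\mathrm{Ev}(u),o\neq u,o\prec u,a\mathrm{T}o,a\mathrm{T}u$. - The field $F(a,o,u)=\langle\mathrm{Time}_a,+,\star\rangle$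 (for $\mathrm{Fp}(a,o,u)$), with zero $o$ and unit $u$: $\tau=\tau_1+\tau_2$, written $+(\tau,\tau_1,\tau_2,a,o)$, iff $\mathrm{Edt}_a(o,\tau_1,\tau_2,\tau)$. When $\tau_1$ is later than $u$ and $\tau_2$ is later than $o$: $\tau=\tau_1\star\tau_2$, written $\star(\tau,\tau_1,\tau_2,a,o,u)$, iff there are $b_1\|a$, $b_2\|a$, events $u',\tau_2'$, signals $\sigma_1,\sigma_2$ and particles $p,q$ with $\mathrm{Col}(a,b_1,b_2)$, $o\equiv_a u'$, $o\equiv_a\tau_2'$, $b_1\mathrm{T}u'$, $b_2\mathrm{T}\tau_2'$, $(u',\sigma_1,u)$, $(\tau_2',\sigma_2,\tau_2)$, $p\mathrm{T}u'$, $p\mathrm{T}\tau_1$, $q\mathrm{T}\tau_2'$, $q\mathrm{T}\tau$, $p\|q$. The other cases of $\star$ are defined similarly (Hilbert's coordinatization), so that in $\mathfrak M(F)$ the structure $F(a,o,u)$ is isomorphic to $F$. - Distance of locations (with respect to $a,o$): $\delta(a,b)=\varepsilon$ iff there are $\varepsilon',\sigma$ with $\mathrm{Ev}(\varepsilon'),\varepsilon'\equiv_a o,b\mathrm{T}\varepsilon',(\varepsilon',\sigma,\varepsilon),\varepsilon\in\mathrm{Time}_a$; and $\delta(b_1,b_2)=\varepsilon$ iff $\varepsilon=\delta(a,b),\mathrm{pa}(b_1,b_2,a,b),\mathrm{pa}(b_1,a,b_2,b)$ for some location $b$ (i.e. the pair $b_1,b_2$ is parallel-translated so that $b_1$ gets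 to $a$). - $\mathrm{Ort}(a,b,a,c)$ (orthogonality of the lines through $a,b$ and through $a,c$): $a\ne b$, $a\neq c$, and there is $b'\neq b$ with $\mathrm{Col}(b',a,b)$, $\delta(a,b')=\delta(a,b)$, $\delta(c,b')=\delta(c,b)$. - $\mathrm{Op}(a,o,u,a_x,a_y,a_z)$: $\mathrm{Fp}(a,o,u)$, $a\|a_x$, $a\|a_y$, $a\|a_z$, $\mathrm{Ort}(a,a_x,a,a_y)$, $\mathrm{Ort}(a,a_x,a,a_z)$, $\mathrm{Ort}(a,a_y,a,a_z)$. - Coordinates: $\mathrm{cor}(\varepsilon,\tau,\gamma_x,\gamma_y,\gamma_z,a,o,u,a_x,a_y,a_z)$ iff $\varepsilon\equiv_a\tau$ (with $\tau\in\mathrm{Time}_a$) and there are $b,p_x,p_y,p_z\in\mathrm{Space}_a$ with $b\mathrm{T}\varepsilon$, $\mathrm{pa}(b,p_z,a,a_z)$, $\mathrm{pa}(p_z,p_x,a,a_y)$, $\mathrm{pa}(p_z,p_y,a,a_x)$, $\mathrm{Col}(a,p_x,a_x)$, $\mathrm{Col}(a,p_y,a_y)$, $\delta(p_z,p_x)=\gamma_x$, $\delta(p_z,p_y)=\gamma_y$, $\delta(b,p_z)=\gamma_z$. This is also written $\mathrm{cor}(\varepsilon,a,o,u,a_x,a_y,a_z)=(\tau,\gamma_x,\gamma_y,\gamma_z)$. - Relativistic distance $\mu_{a,o}$ (with $o$ an event on $a$'s world-line) of events that are time-like separated, i.e. such that some particle participates in (transmits) both; its values are in $\mathrm{Time}_a$.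 For $o\prec\varepsilon$: $\mu_{a,o}(o,\varepsilon)=\xi$ iff there is an event $\varepsilon'$ simultaneous with $o$ both according to $a$ and according to the unique particle participating in $o,\varepsilon$, and there are signals from $\varepsilon'$ to $\varepsilon$ and from $\varepsilon'$ to $\xi$. For $\varepsilon_1\prec\varepsilon_2$: $\mu_{a,o}(\varepsilon_1,\varepsilon_2)=\mu_{a,o}(o,\varepsilon)$, where $(o,\varepsilon)$ is the parallel translation of $(\varepsilon_1,\varepsilon_2)$ (obtained via an event $\varepsilon''$ connected to both $o$ and $\varepsilon_1$ by light-signals). For $\varepsilon_2\prec\varepsilon_1$: $\mu_{a,o}(\varepsilon_1,\varepsilon_2)=-\mu_{a,o}(\varepsilon_2,\varepsilon_1)$. In standard models, for $\varepsilon_1\prec\varepsilon_2$ this is the event $\xi$ on $a$ after $o$ such that the Minkowski distance of $o,\xi$ equals that of $\varepsilon_1,\varepsilon_2$. - $\mathrm{Edr}(\varepsilon_1,\varepsilon_2,\varepsilon_3,\varepsilon_4)$ (relativistic equidistance): $\mu_{a,o}(\varepsilon_1,\varepsilon_2)=\mu_{a,o}(\varepsilon_3,\varepsilon_4)$, for any $a\in\mathrm{Par}$ and event $o$ on $a$'s world-line (the relation does not depend on $a,o$). - $\varphi_{\mathrm{iso}}(\xi,\xi',a,o,u,a',o',u')$, for $\mathrm{Fp}(a,o,u)$, $\mathrm{Fp}(a',o',u')$, $\xi\in\mathrm{Time}_a$, $\xi'\in\mathrm{Time}_{a'}$: $\xi'=\xi''/u''$ (division in $F(a',o',u')$), where $\xi'',u''$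 are events on $a'$'s world-line with $\mathrm{Edr}(\xi,o,\xi'',o')$ and $\mathrm{Edr}(u,o,u'',o')$. It defines an isomorphism $F(a,o,u)\to F(a',o',u')$. The unique $\xi$ with this property is written $\xi=\varphi_{\mathrm{iso}}(\xi',a,o,u,a',o',u')$. - $\lambda(\varepsilon_1,\varepsilon_2,\varepsilon_3)$ (''on one light-like line''): for all $i,j\in\{1,2,3\}$ there is a signal $\sigma$ with $(\varepsilon_i,\sigma,\varepsilon_j)$ or $(\varepsilon_j,\sigma,\varepsilon_i)$. $\mathrm{wl}(\varepsilon,\sigma)$ (''$\varepsilon$ is on the world-line of $\sigma$''): there are $\varepsilon_1,\varepsilon_2$ with $\lambda(\varepsilon,\varepsilon_1,\varepsilon_2),\mathrm{Beg}(\sigma,\varepsilon_1),\mathrm{End}(\sigma,\varepsilon_2)$. **The translation $\mathrm{tr}$.** - Sort $Q$: $q\mapsto\langle q_\xi,q_a,q_o,q_u\rangle$ ($q_a$ of sort $\mathrm{Par}$, the others of sort $\mathrm{Sig}$). $Q(q)$: $q_a\mathrm{T}q_\xi,\ \mathrm{Ev}(q_\xi),\ \mathrm{Fp}(q_a,q_o,q_u)$. $q=_Qq'$: $\varphi_{\mathrm{iso}}(q_\xi,q'_\xi,q_a,q_o,q_u,q'_a,q'_o,q'_u)$. - $\mathrm{rep}(q,a,o,u):=\varphi_{\mathrm{iso}}(q_\xi,a,o,u,q_a,q_o,q_u)$. - $+(q,q_1,q_2)$ (i.e. $q=q_1+q_2$): $+(q_\xi,\mathrm{rep}(q_1,q_a,q_o,q_u),\mathrm{rep}(q_2,q_a,q_o,q_u),q_a,q_o)$;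 $\star$ on $Q$ is defined analogously. - Sort $B$: $b\mapsto\langle b_\sigma,b_a,b_o,b_u,b_x,b_y,b_z\rangle$ ($b_\sigma,b_o,b_u$ of sort $\mathrm{Sig}$, the others of sort $\mathrm{Par}$). $\mathrm{Ph}(b)$: $\neg\mathrm{Ev}(b_\sigma)$. $\mathrm{Obs}(b)$: $\mathrm{Ev}(b_\sigma),\mathrm{Op}(b_a,b_o,b_u,b_x,b_y,b_z)$. $B(b)$: $\mathrm{Ph}(b)\vee\mathrm{Obs}(b)$. - $b=_Bb'$: either $\neg\mathrm{Ev}(b_\sigma),\neg\mathrm{Ev}(b'_\sigma)$ and $\forall\varepsilon\,(\mathrm{wl}(\varepsilon,b_\sigma)\leftrightarrow\mathrm{wl}(\varepsilon,b'_\sigma))$; or $\mathrm{Ev}(b_\sigma),\mathrm{Ev}(b'_\sigma)$ and $\forall\varepsilon\;\mathrm{cor}(\varepsilon,b_a,b_o,b_u,b_x,b_y,b_z)=\mathrm{cor}(\varepsilon,b'_a,b'_o,b'_u,b'_x,b'_y,b'_z)$. - $\mathrm{W}(m,b,t,x,y,z)$: there is an event $\varepsilon$ with $\mathrm{cor}(\varepsilon,m(t),m(x),m(y),m(z),m_a,m_o,m_u,m_x,m_y,m_z)$, where $m(q):=\mathrm{rep}(q,m_a,m_o,m_u)$, such that $\neg\mathrm{Ev}(b_\sigma)\to\mathrm{wl}(\varepsilon,b_\sigma)$, and $\mathrm{Ev}(b_\sigma)\to b_a\mathrm{T}\varepsilon$; and $\mathrm{Ev}(m_\sigma)$.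
   Formalization: Formulas of tr are corrected: coordinates in cor are δ with a sign; δ(b₁,b₂) uses true parallel translation also when b₁,b₂,a are collinear or b₁=b₂; a ⋆-product of positives must be later than o; =_B compares coordinates by =_Q, not as events. *)

(* Defs.v *)
From mathcomp Require Import all_boot all_order all_algebra.
From mathcomp Require Import boolp classical_sets.

Set Implicit Arguments.
Unset Strict Implicit.
Unset Printing Implicit Defensive.
Import Order.TTheory GRing.Theory Num.Theory.
Local Open Scope classical_set_scope.
Local Open Scope ring_scope.

(** Two-sorted first-order formulas in parametric higher-order abstract syntax: [X] and [Y] are the
    types of variables of the two sorts, [A] is the type of atomic formulas.
    A sentence is a formula given uniformly in the types of variables, so
    bound variables never clash and substitution is application. *)

Inductive fml (A X Y : Type) : Type :=
| Atom of A
| Not of fml A X Y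
| And of fml A X Y & fml A X Y
| Or of fml A X Y & fml A X Y
| Imp of fml A X Y & fml A X Y
| All1 of (X -> fml A X Y)
| All2 of (Y -> fml A X Y)
| Ex1 of (X -> fml A X Y)
| Ex2 of (Y -> fml A X Y).
Arguments Atom {A X Y}.

Fixpoint holds {A X Y : Type} (I : A -> Prop) (phi : fml A X Y) : Prop :=
  match phi with
  | Atom p => I p
  | Not f => ~ holds I f
  | And f g => holds I f /\ holds I g
  | Or f g => holds I f \/ holds I g
  | Imp f g => holds I f -> holds I g
  | All1 f => forall x, holds I (f x)
  | All2 f => forall y, holds I (f y)
  | Ex1 f => exists x, holds I (f x)
  | Ex2 f => exists y, holds I (f y)
  end.

Declare Scope fo_scope.
Delimit Scope fo_scope with FO.
Bind Scope fo_scope with fml.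

Notation "¬ p" := (Not p) (at level 75, right associativity) : fo_scope.
Notation "p ∧ q" := (And p q) (at level 80, right associativity) : fo_scope.
Notation "p ∨ q" := (Or p q) (at level 85, right associativity) : fo_scope.
Notation "p ⇒ q" := (Imp p q) (at level 90, right associativity) : fo_scope.
Notation "p ⇔ q" := (And (Imp p q) (Imp q p))
  (at level 95, no associativity) : fo_scope.
Notation "'∀P' a .. b , p" := (All1 (fun a => .. (All1 (fun b => p)) ..))
  (at level 200, a binder, b binder, right associativity) : fo_scope.
Notation "'∃P' a .. b , p" := (Ex1 (fun a => .. (Ex1 (fun b => p)) ..))
  (at level 200, a binder, b binder, right associativity) : fo_scope.
Notation "'∀S' a .. b , p" := (All2 (fun a => .. (All2 (fun b => p)) ..))
  (at level 200, a binder, b binder, right associativity) : fo_scope.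
Notation "'∃S' a .. b , p" := (Ex2 (fun a => .. (Ex2 (fun b => p)) ..))
  (at level 200, a binder, b binder, right associativity) : fo_scope.
(* The two sorts are Par and Sig for SigTh, B and Q for SpecRel0. *)
Notation "'∀B' a .. b , p" := (All1 (fun a => .. (All1 (fun b => p)) ..))
  (at level 200, a binder, b binder, right associativity, only parsing)
  : fo_scope.
Notation "'∃B' a .. b , p" := (Ex1 (fun a => .. (Ex1 (fun b => p)) ..))
  (at level 200, a binder, b binder, right associativity, only parsing)
  : fo_scope.
Notation "'∀Q' a .. b , p" := (All2 (fun a => .. (All2 (fun b => p)) ..))
  (at level 200, a binder, b binder, right associativity, only parsing)
  : fo_scope.
Notation "'∃Q' a .. b , p" := (Ex2 (fun a => .. (Ex2 (fun b => p)) ..))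
  (at level 200, a binder, b binder, right associativity, only parsing)
  : fo_scope.

Inductive sr_atom (B Q : Type) : Type :=
| Obs of B
| Ph of B
| Plus of Q & Q & Q                (* [Plus q q1 q2] : q = q1 + q2 *)
| Times of Q & Q & Q               (* [Times q q1 q2] : q = q1 * q2 *)
| WorldView of B & B & Q & Q & Q & Q
| EqB of B & B
| EqQ of Q & Q.

Definition sr_fml (B Q : Type) := fml (sr_atom B Q) B Q.
Definition sr_sentence := forall B Q : Type, sr_fml B Q.

Section SpecRel0.
Local Open Scope fo_scope.

Definition isObs {B Q : Type} (b : B) : sr_fml B Q := Atom (Obs Q b).
Definition isPh {B Q : Type} (b : B) : sr_fml B Q := Atom (Ph Q b).
Definition isSum {B Q : Type} (q q1 q2 : Q) : sr_fml B Q :=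
  Atom (Plus B q q1 q2).
Definition isProd {B Q : Type} (q q1 q2 : Q) : sr_fml B Q :=
  Atom (Times B q q1 q2).
Definition W {B Q : Type} (o b : B) (t x y z : Q) : sr_fml B Q :=
  Atom (WorldView o b t x y z).
Definition eqB {B Q : Type} (b b' : B) : sr_fml B Q := Atom (EqB Q b b').
Definition eqQ {B Q : Type} (q q' : Q) : sr_fml B Q := Atom (EqQ B q q').

Definition isZero {B Q : Type} (z : Q) : sr_fml B Q := ∀Q x, isSum x x z.
Definition isOne {B Q : Type} (e : Q) : sr_fml B Q := ∀Q x, isProd x x e.

(* The language has no order symbol; in a Euclidean field the nonnegative
   elements are exactly the squares, so this formula defines its only order. *)
Definition leQ {B Q : Type} (x y : Q) : sr_fml B Q :=
  ∃Q r s, isProd s r r ∧ isSum y x s.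

(* Since + and * occur as ternary relations, the first four conjuncts say that
   they are total functions. *)
Definition AxFd : sr_sentence := fun B Q =>
  (∀Q x y, ∃Q s, isSum s x y)
  ∧ (∀Q x y s s', isSum s x y ⇒ isSum s' x y ⇒ eqQ s s')
  ∧ (∀Q x y, ∃Q p, isProd p x y)
  ∧ (∀Q x y p p', isProd p x y ⇒ isProd p' x y ⇒ eqQ p p')
  ∧ (∀Q x y s, isSum s x y ⇒ isSum s y x)
  ∧ (∀Q x y z xy yz s,
       isSum xy x y ⇒ isSum yz y z ⇒ isSum s xy z ⇒ isSum s x yz)
  ∧ (∃Q o, isZero o)
  ∧ (∀Q o x, isZero o ⇒ ∃Q y, isSum o x y)
  ∧ (∀Q x y p, isProd p x y ⇒ isProd p y x)
  ∧ (∀Q x y z xy yz p,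
       isProd xy x y ⇒ isProd yz y z ⇒ isProd p xy z ⇒ isProd p x yz)
  ∧ (∃Q e, isOne e)
  ∧ (∀Q e x, isOne e ⇒ ¬ isZero x ⇒ ∃Q y, isProd e x y)
  ∧ (∀Q x y z s p xy xz,
       isSum s y z ⇒ isProd p x s ⇒ isProd xy x y ⇒ isProd xz x z ⇒
       isSum p xy xz)
  ∧ (∀Q o e, isZero o ⇒ isOne e ⇒ ¬ eqQ o e)
  ∧ (∀Q x, leQ x x)
  ∧ (∀Q x y, leQ x y ⇒ leQ y x ⇒ eqQ x y)
  ∧ (∀Q x y z, leQ x y ⇒ leQ y z ⇒ leQ x z)
  ∧ (∀Q x y, leQ x y ∨ leQ y x)
  ∧ (∀Q x y z xz yz, leQ x y ⇒ isSum xz x z ⇒ isSum yz y z ⇒ leQ xz yz)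
  ∧ (∀Q o x y p,
       isZero o ⇒ leQ o x ⇒ leQ o y ⇒ isProd p x y ⇒ leQ o p)
  ∧ (∀Q o x, isZero o ⇒ leQ o x ⇒ ¬ eqQ o x ⇒ ∃Q y, isProd x y y).

(* [affine p q k d] : p = q + k * d *)
Definition affine {B Q : Type} (p q k d : Q) : sr_fml B Q :=
  ∃Q m, isProd m k d ∧ isSum p q m.

Definition onLine {B Q : Type} (t x y z qt qx qy qz dt dx dy dz : Q) :
    sr_fml B Q :=
  ∃Q k, affine t qt k dt ∧ affine x qx k dx
        ∧ affine y qy k dy ∧ affine z qz k dz.

Definition slope1Dir {B Q : Type} (dt dx dy dz : Q) : sr_fml B Q :=
  ¬ (isZero dt ∧ isZero dx ∧ isZero dy ∧ isZero dz)
  ∧ (∃Q t2 x2 y2 z2 s, isProd t2 dt dt ∧ isProd x2 dx dx ∧ isProd y2 dy dy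
       ∧ isProd z2 dz dz ∧ isSum s x2 y2 ∧ isSum t2 s z2).

Definition isWorldLine {B Q : Type} (o b : B) (qt qx qy qz dt dx dy dz : Q) :
    sr_fml B Q :=
  ∀Q t x y z, W o b t x y z ⇔ onLine t x y z qt qx qy qz dt dx dy dz.

Definition AxPh : sr_sentence := fun B Q =>
  ∀B o, isObs o ⇒
    (∀B b, isPh b ⇒ ∃Q qt qx qy qz dt dx dy dz,
        slope1Dir dt dx dy dz ∧ isWorldLine o b qt qx qy qz dt dx dy dz)
    ∧ (∀Q qt qx qy qz dt dx dy dz, slope1Dir dt dx dy dz ⇒
        ∃B b, isPh b ∧ isWorldLine o b qt qx qy qz dt dx dy dz).

Definition AxEv : sr_sentence := fun B Q =>
  ∀B o o', isObs o ⇒ isObs o' ⇒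
    ∀Q t x y z, ∃Q t' x' y' z',
      ∀B b, W o b t x y z ⇔ W o' b t' x' y' z'.

Definition AxSelf : sr_sentence := fun B Q =>
  ∀B o, isObs o ⇒
    ∀Q t x y z, W o o t x y z ⇔ (isZero x ∧ isZero y ∧ isZero z).

End SpecRel0.

Definition SpecRel0 (psi : sr_sentence) : Prop :=
  [\/ psi = AxPh, psi = AxEv, psi = AxSelf | psi = AxFd].

Inductive sig_atom (P S : Type) : Type :=
| Transmits of P & S
| Receives of P & S
| EqPar of P & P
| EqSig of S & S.

Definition sig_fml (P S : Type) := fml (sig_atom P S) P S.
Definition sig_sentence := forall P S : Type, sig_fml P S.

Record sig_structure := SigStructure {
  Par : Type;
  Sig : Type;
  transmits : Par -> Sig -> Prop;
  receives : Par -> Sig -> Prop }.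

Definition sig_interp (M : sig_structure) (p : sig_atom (Par M) (Sig M)) :
    Prop :=
  match p with
  | Transmits a s => transmits a s
  | Receives a s => receives a s
  | EqPar a b => a = b
  | EqSig s s' => s = s'
  end.

Definition satisfies (M : sig_structure) (phi : sig_sentence) : Prop :=
  holds (@sig_interp M) (phi (Par M) (Sig M)).

Definition euclidean (F : realFieldType) : Prop :=
  forall x : F, 0 < x -> exists y : F, y ^+ 2 = x.

(* A point (t,x,y,z) is a row vector; coordinate 0 is time. *)
Definition sqspace (F : realFieldType) (d : 'rV[F]_4) : F :=
  d 0 1 ^+ 2 + d 0 2 ^+ 2 + d 0 3 ^+ 2.

Definition line (F : realFieldType) (p d : 'rV[F]_4) : set 'rV[F]_4 :=
  [set p + k *: d | k in [set: F]].

Definition particle (F : realFieldType) : Type :=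
  {l : set 'rV[F]_4 | exists p d : 'rV[F]_4,
     [/\ d != 0, sqspace d < d 0 0 ^+ 2 & l = line p d]}.

(* A directed segment is the pair of its beginning point and its endpoint. *)
Definition signal (F : realFieldType) : Type :=
  {s : 'rV[F]_4 * 'rV[F]_4 |
     (s.1 == s.2) ||
     ((s.1 0 0 < s.2 0 0) && (sqspace (s.2 - s.1) == (s.2 - s.1) 0 0 ^+ 2))}.

Definition stdModel (F : realFieldType) : sig_structure :=
  @SigStructure (particle F) (signal F)
    (fun a s => sval a (sval s).1) (fun a s => sval a (sval s).2).

(* The models of SigTh are, up to isomorphism, the standard models over
   Euclidean fields. *)
Definition SigTh_entails (phi : sig_sentence) : Prop :=
  forall F : realFieldType, euclidean F -> satisfies (stdModel F) phi.

Section Auxiliary.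
Local Open Scope fo_scope.

Definition T {P S : Type} (a : P) (s : S) : sig_fml P S :=
  Atom (Transmits a s).
Definition R {P S : Type} (a : P) (s : S) : sig_fml P S :=
  Atom (Receives a s).
Definition eqp {P S : Type} (a b : P) : sig_fml P S := Atom (EqPar S a b).
Definition eqs {P S : Type} (s s' : S) : sig_fml P S := Atom (EqSig P s s').

Definition Ev {P S : Type} (e : S) : sig_fml P S := ∀P a, T a e ⇒ R a e.

Definition exEv {P S : Type} (f : S -> sig_fml P S) : sig_fml P S :=
  ∃S e, Ev e ∧ f e.
Definition allEv {P S : Type} (f : S -> sig_fml P S) : sig_fml P S :=
  ∀S e, Ev e ⇒ f e.
Notation "'∃E' a .. b , p" := (exEv (fun a => .. (exEv (fun b => p)) ..))
  (at level 200, a binder, b binder, right associativity) : fo_scope.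
Notation "'∀E' a .. b , p" := (allEv (fun a => .. (allEv (fun b => p)) ..))
  (at level 200, a binder, b binder, right associativity) : fo_scope.

Definition Beg {P S : Type} (s e : S) : sig_fml P S := ∀P b, T b s ⇒ T b e.
Definition End {P S : Type} (s e : S) : sig_fml P S := ∀P b, R b s ⇒ R b e.

(* [sent e s g] is the formula written (e, s, g). *)
Definition sent {P S : Type} (e s g : S) : sig_fml P S := Beg s e ∧ End s g.

(* [motionless a' a] : a' || a *)
Definition motionless {P S : Type} (a' a : P) : sig_fml P S :=
  eqp a' a ∨
  ((¬ ∃S s, T a s ∧ T a' s) ∧
   ∃P c d, ¬ eqp c d ∧ ¬ eqp c a ∧ ¬ eqp c a' ∧ ¬ eqp d a ∧ ¬ eqp d a' ∧
   ∃E e1 e2 e3 e4 e5,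
     T c e1 ∧ T a e1 ∧ T c e2 ∧ T a' e2 ∧ T d e3 ∧ T a e3 ∧ T d e4 ∧ T a' e4
     ∧ T c e5 ∧ T d e5
     ∧ ¬ eqs e1 e2 ∧ ¬ eqs e1 e3 ∧ ¬ eqs e1 e4 ∧ ¬ eqs e1 e5
     ∧ ¬ eqs e2 e3 ∧ ¬ eqs e2 e4 ∧ ¬ eqs e2 e5
     ∧ ¬ eqs e3 e4 ∧ ¬ eqs e3 e5 ∧ ¬ eqs e4 e5).

Definition Time {P S : Type} (a : P) (e : S) : sig_fml P S := Ev e ∧ T a e.

Definition sim {P S : Type} (a : P) (e e' : S) : sig_fml P S :=
  ∃P a', motionless a' a ∧
  ∃E e1 e2, T a' e1 ∧ T a' e2 ∧
  ∃S s1 s2 s3 s4, sent e1 s1 e ∧ sent e1 s2 e' ∧ sent e s3 e2 ∧ sent e' s4 e2.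

(* Signals may have length zero, so [prec] is reflexive on events. *)
Definition prec {P S : Type} (e e' : S) : sig_fml P S :=
  ∃E e'', ∃S s1 s2, sent e s1 e'' ∧ sent e'' s2 e'.

Definition later {P S : Type} (e e' : S) : sig_fml P S :=
  prec e' e ∧ ¬ eqs e e'.

Definition Edt_forward {P S : Type} (a : P) (e1 e2 e3 e4 : S) : sig_fml P S :=
  ∃P a', motionless a' a ∧
  ∃E e e', T a' e ∧ T a' e' ∧
  ∃S s1 s2 s3 s4, sent e1 s1 e ∧ sent e s3 e3 ∧ sent e2 s2 e' ∧ sent e' s4 e4.

Definition Edt {P S : Type} (a : P) (e1 e2 e3 e4 : S) : sig_fml P S :=
  (prec e1 e3 ∧ Edt_forward a e1 e2 e3 e4)
  ∨ (prec e3 e1 ∧ Edt_forward a e3 e4 e1 e2).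

(* The location a2 is weakly between a1 and a3. *)
Definition between {P S : Type} (a1 a2 a3 : P) : sig_fml P S :=
  ∃E e1 e2 e3, T a1 e1 ∧ T a2 e2 ∧ T a3 e3 ∧
  ∃S s1 s2 s3, sent e1 s1 e2 ∧ sent e2 s2 e3 ∧ sent e1 s3 e3.

Definition Col {P S : Type} (a1 a2 a3 : P) : sig_fml P S :=
  between a1 a2 a3 ∨ between a1 a3 a2 ∨ between a2 a1 a3
  ∨ between a2 a3 a1 ∨ between a3 a1 a2 ∨ between a3 a2 a1.

(* Parallelism of spatial lines: equal lines, or lines without a common
   location that are coplanar because one of the two pairs of lines joining
   their points meets.  A degenerate pair is parallel to everything: this is
   needed in [cor], where [pa b p_z a a_z] must allow b = p_z. *)
Definition pa {P S : Type} (b1 b2 b3 b4 : P) : sig_fml P S :=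
  eqp b1 b2 ∨ eqp b3 b4
  ∨ (Col b1 b2 b3 ∧ Col b1 b2 b4)
  ∨ ((¬ ∃P c, motionless c b1 ∧ Col b1 b2 c ∧ Col b3 b4 c)
     ∧ ∃P c, motionless c b1 ∧
         ((Col b1 b4 c ∧ Col b2 b3 c) ∨ (Col b1 b3 c ∧ Col b2 b4 c))).

Definition Fp {P S : Type} (a : P) (o u : S) : sig_fml P S :=
  Ev o ∧ Ev u ∧ ¬ eqs o u ∧ prec o u ∧ T a o ∧ T a u.

(* [add t t1 t2 a o] : t = t1 + t2 *)
Definition add {P S : Type} (t t1 t2 : S) (a : P) (o : S) : sig_fml P S :=
  Time a t ∧ Time a t1 ∧ Time a t2 ∧ Edt a o t1 t2 t.

(* [opp t t1 a o] : t = - t1 *)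
Definition opp {P S : Type} (t t1 : S) (a : P) (o : S) : sig_fml P S :=
  add o t t1 a o.

(* t = t1 * t2 for t1 later than u and t2 later than o.  The result must be
   later than o: this puts b1 and b2 on the same side of a; for b1 and b2 on
   opposite sides the construction yields - (t1 * t2). *)
Definition mul_core {P S : Type} (t t1 t2 : S) (a : P) (o u : S) :
    sig_fml P S :=
  later t1 u ∧ later t2 o ∧ later t o ∧
  ∃P b1 b2, motionless b1 a ∧ motionless b2 a ∧
  ∃E u' t2', ∃S s1 s2, ∃P p q,
    Col a b1 b2 ∧ sim a o u' ∧ sim a o t2' ∧ T b1 u' ∧ T b2 t2'
    ∧ sent u' s1 u ∧ sent t2' s2 t2
    ∧ T p u' ∧ T p t1 ∧ T q t2' ∧ T q t ∧ motionless p q.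

(* Both factors later than o.  For t1 before u the particle p of [mul_core]
   would not be slower than light, so the inverse i of t1 is used. *)
Definition mul_pos {P S : Type} (t t1 t2 : S) (a : P) (o u : S) :
    sig_fml P S :=
  mul_core t t1 t2 a o u
  ∨ (eqs t1 u ∧ later t2 o ∧ eqs t t2)
  ∨ (later t1 o ∧ later u t1 ∧ later t2 o ∧
     ∃S i, Time a i ∧ mul_core u i t1 a o u ∧ mul_core t2 i t a o u).

(* [mul t t1 t2 a o u] : t = t1 * t2 *)
Definition mul {P S : Type} (t t1 t2 : S) (a : P) (o u : S) : sig_fml P S :=
  Time a t ∧ Time a t1 ∧ Time a t2 ∧
  (((eqs t1 o ∨ eqs t2 o) ∧ eqs t o)
   ∨ (later t1 o ∧ later t2 o ∧ mul_pos t t1 t2 a o u)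
   ∨ (later o t1 ∧ later t2 o ∧
      ∃S n n1, opp n t a o ∧ opp n1 t1 a o ∧ mul_pos n n1 t2 a o u)
   ∨ (later t1 o ∧ later o t2 ∧
      ∃S n n2, opp n t a o ∧ opp n2 t2 a o ∧ mul_pos n t1 n2 a o u)
   ∨ (later o t1 ∧ later o t2 ∧
      ∃S n1 n2, opp n1 t1 a o ∧ opp n2 t2 a o ∧ mul_pos t n1 n2 a o u)).

(* [dist0 a o b e] : delta(a,b) = e *)
Definition dist0 {P S : Type} (a : P) (o : S) (b : P) (e : S) : sig_fml P S :=
  Time a e ∧ ∃E e', sim a e' o ∧ T b e' ∧ ∃S s, sent e' s e.

(* b1 b2 c2 c1 is a nondegenerate parallelogram. *)
Definition parallelogram {P S : Type} (b1 b2 c1 c2 : P) : sig_fml P S :=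
  ¬ Col b1 b2 c1 ∧ pa b1 b2 c1 c2 ∧ pa b1 c1 b2 c2.

(* The pair b1, b2 is parallel-translated to a, b.  If b1, b2, a are collinear
   then a parallelogram on them does not determine b, and the translation goes
   through a pair c, d off their line. *)
Definition translated {P S : Type} (b1 b2 a b : P) : sig_fml P S :=
  (eqp b1 b2 ∧ eqp a b)
  ∨ parallelogram b1 b2 a b
  ∨ (¬ eqp b1 b2 ∧ Col b1 b2 a ∧
     ∃P c d, motionless c a ∧ motionless d a
       ∧ parallelogram b1 b2 c d ∧ parallelogram c d a b).

(* [dist a o b1 b2 e] : delta(b1,b2) = e with respect to a, o *)
Definition dist {P S : Type} (a : P) (o : S) (b1 b2 : P) (e : S) :
    sig_fml P S :=
  ∃P b, motionless b a ∧ translated b1 b2 a b ∧ dist0 a o b e.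

(* Coordinates may be negative whereas [dist] never is.  For b, b' joined by a
   line parallel to the axis of a, c : the distance of b and b' if b lies on
   the c-side of b', and its opposite if b lies on the other side. *)
Definition coordinate {P S : Type} (a : P) (o : S) (c b b' : P) (g : S) :
    sig_fml P S :=
  ∃S e, dist a o b b' e ∧
  ∃P v, motionless v a ∧ translated b' b a v ∧
    ((¬ between v a c ∧ eqs g e) ∨ (between v a c ∧ opp g e a o)).

Definition Ort {P S : Type} (o : S) (a b c : P) : sig_fml P S :=
  ¬ eqp a b ∧ ¬ eqp a c ∧
  ∃P b', motionless b' a ∧ ¬ eqp b' b ∧ Col b' a b
    ∧ (∃S e, dist a o a b' e ∧ dist a o a b e)
    ∧ (∃S e, dist a o c b' e ∧ dist a o c b e).

Definition Op {P S : Type} (a : P) (o u : S) (ax ay az : P) : sig_fml P S :=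
  Fp a o u ∧ motionless a ax ∧ motionless a ay ∧ motionless a az
  ∧ Ort o a ax ay ∧ Ort o a ax az ∧ Ort o a ay az.

(* In the notation cor(e,a,o,u,ax,ay,az), u only serves to make the values
   quantities of F(a,o,u); the formula itself does not depend on u. *)
Definition cor {P S : Type} (e t gx gy gz : S) (a : P) (o : S)
    (ax ay az : P) : sig_fml P S :=
  Time a t ∧ sim a e t ∧
  ∃P b px py pz,
    motionless b a ∧ motionless px a ∧ motionless py a ∧ motionless pz a
    ∧ T b e ∧ pa b pz a az ∧ pa pz px a ay ∧ pa pz py a ax
    ∧ Col a px ax ∧ Col a py ay
    ∧ coordinate a o ay pz px gx ∧ coordinate a o ax pz py gy
    ∧ coordinate a o az b pz gz.

(* mu_{a,o}(o,e) = x for o before e.  For e = o every particle through o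
   qualifies as c and the value is o. *)
Definition mu0 {P S : Type} (a : P) (o e x : S) : sig_fml P S :=
  prec o e ∧ Time a x ∧
  ∃P c, T c o ∧ T c e ∧
  ∃E e', sim a e' o ∧ sim c e' o ∧ ∃S s s', sent e' s e ∧ sent e' s' x.

(* The pair (e1,e2), of events on one particle c, is translated to (f1,f2)
   along a light-signal joining e1 and f1. *)
Definition null_translated {P S : Type} (e1 e2 f1 f2 : S) : sig_fml P S :=
  ∃P c c', motionless c' c ∧ T c e1 ∧ T c e2 ∧ T c' f1 ∧ T c' f2 ∧
  ∃S s s', (sent e1 s f1 ∧ sent e2 s' f2) ∨ (sent f1 s e1 ∧ sent f2 s' e2).

(* mu_{a,o}(e1,e2) = x for e1 before e2 *)
Definition mu_pos {P S : Type} (a : P) (o e1 e2 x : S) : sig_fml P S :=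
  prec e1 e2 ∧
  ∃E e e'' f, null_translated e1 e2 e'' f ∧ null_translated e'' f o e
    ∧ mu0 a o e x.

Definition mu {P S : Type} (a : P) (o e1 e2 x : S) : sig_fml P S :=
  mu_pos a o e1 e2 x ∨ (∃S y, mu_pos a o e2 e1 y ∧ opp x y a o).

Definition Edr {P S : Type} (e1 e2 e3 e4 : S) : sig_fml P S :=
  ∀P a, ∀E o, T a o ⇒ ∃S x, mu a o e1 e2 x ∧ mu a o e3 e4 x.

Definition phi_iso {P S : Type} (x x' : S) (a : P) (o u : S) (a' : P)
    (o' u' : S) : sig_fml P S :=
  Fp a o u ∧ Fp a' o' u' ∧ Time a x ∧ Time a' x' ∧
  ∃S x'' u'', Time a' x'' ∧ Time a' u''
    ∧ Edr x o x'' o' ∧ Edr u o u'' o' ∧ mul x'' x' u'' a' o' u'.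

Definition light {P S : Type} (e e' : S) : sig_fml P S :=
  ∃S s, sent e s e' ∨ sent e' s e.

Definition lambda {P S : Type} (e1 e2 e3 : S) : sig_fml P S :=
  light e1 e2 ∧ light e1 e3 ∧ light e2 e3.

Definition wl {P S : Type} (e s : S) : sig_fml P S :=
  ∃E e1 e2, lambda e e1 e2 ∧ Beg s e1 ∧ End s e2.

End Auxiliary.

Notation "'∃E' a .. b , p" := (exEv (fun a => .. (exEv (fun b => p)) ..))
  (at level 200, a binder, b binder, right associativity) : fo_scope.
Notation "'∀E' a .. b , p" := (allEv (fun a => .. (allEv (fun b => p)) ..))
  (at level 200, a binder, b binder, right associativity) : fo_scope.

Record qtuple (P S : Type) := QTuple { q_xi : S; q_a : P; q_o : S; q_u : S }.

Record btuple (P S : Type) := BTuple {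
  b_sigma : S; b_a : P; b_o : S; b_u : S; b_x : P; b_y : P; b_z : P }.

Section Translation.
Local Open Scope fo_scope.

Definition Qdom {P S : Type} (q : qtuple P S) : sig_fml P S :=
  T (q_a q) (q_xi q) ∧ Ev (q_xi q) ∧ Fp (q_a q) (q_o q) (q_u q).

Definition tr_eqQ {P S : Type} (q q' : qtuple P S) : sig_fml P S :=
  phi_iso (q_xi q) (q_xi q') (q_a q) (q_o q) (q_u q) (q_a q') (q_o q') (q_u q').

(* [rep q a o u x] : x = rep(q,a,o,u) *)
Definition rep {P S : Type} (q : qtuple P S) (a : P) (o u x : S) :
    sig_fml P S :=
  phi_iso x (q_xi q) a o u (q_a q) (q_o q) (q_u q).

Definition tr_plus {P S : Type} (q q1 q2 : qtuple P S) : sig_fml P S :=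
  ∃S x1 x2, rep q1 (q_a q) (q_o q) (q_u q) x1
    ∧ rep q2 (q_a q) (q_o q) (q_u q) x2
    ∧ add (q_xi q) x1 x2 (q_a q) (q_o q).

Definition tr_times {P S : Type} (q q1 q2 : qtuple P S) : sig_fml P S :=
  ∃S x1 x2, rep q1 (q_a q) (q_o q) (q_u q) x1
    ∧ rep q2 (q_a q) (q_o q) (q_u q) x2
    ∧ mul (q_xi q) x1 x2 (q_a q) (q_o q) (q_u q).

Definition tr_Ph {P S : Type} (b : btuple P S) : sig_fml P S :=
  ¬ Ev (b_sigma b).

Definition tr_Obs {P S : Type} (b : btuple P S) : sig_fml P S :=
  Ev (b_sigma b) ∧ Op (b_a b) (b_o b) (b_u b) (b_x b) (b_y b) (b_z b).

Definition Bdom {P S : Type} (b : btuple P S) : sig_fml P S :=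
  tr_Ph b ∨ tr_Obs b.

(* The coordinates of e for b are the given elements of F(b_a,b_o,b_u). *)
Definition bcor {P S : Type} (e t x y z : S) (b : btuple P S) : sig_fml P S :=
  cor e t x y z (b_a b) (b_o b) (b_x b) (b_y b) (b_z b).

(* Equality of the coordinates of e for b and for b' is equality of
   quantities: the coordinates x in F(b_a,b_o,b_u) and x' in F(b'_a,b'_o,b'_u)
   are compared by =_Q.  Comparing them as events would ignore b_u. *)
Definition same_quantity {P S : Type} (b b' : btuple P S) (x x' : S) :
    sig_fml P S :=
  tr_eqQ (QTuple x (b_a b) (b_o b) (b_u b))
         (QTuple x' (b_a b') (b_o b') (b_u b')).

Definition tr_eqB {P S : Type} (b b' : btuple P S) : sig_fml P S :=
  (¬ Ev (b_sigma b) ∧ ¬ Ev (b_sigma b')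
   ∧ ∀E e, wl e (b_sigma b) ⇔ wl e (b_sigma b'))
  ∨ (Ev (b_sigma b) ∧ Ev (b_sigma b')
     ∧ ∀E e, ∃S t x y z t' x' y' z',
         bcor e t x y z b ∧ bcor e t' x' y' z' b'
         ∧ same_quantity b b' t t' ∧ same_quantity b b' x x'
         ∧ same_quantity b b' y y' ∧ same_quantity b b' z z').

Definition tr_W {P S : Type} (m b : btuple P S) (t x y z : qtuple P S) :
    sig_fml P S :=
  (∃E e,
     (∃S mt mx my mz,
        rep t (b_a m) (b_o m) (b_u m) mt ∧ rep x (b_a m) (b_o m) (b_u m) mx
        ∧ rep y (b_a m) (b_o m) (b_u m) my ∧ rep z (b_a m) (b_o m) (b_u m) mz
        ∧ bcor e mt mx my mz m)
     ∧ (¬ Ev (b_sigma b) ⇒ wl e (b_sigma b))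
     ∧ (Ev (b_sigma b) ⇒ T (b_a b) e))
  ∧ Ev (b_sigma m).

Definition allQ {P S : Type} (f : qtuple P S -> sig_fml P S) : sig_fml P S :=
  ∀S x, ∀P a, ∀S o u, Qdom (QTuple x a o u) ⇒ f (QTuple x a o u).
Definition exQ {P S : Type} (f : qtuple P S -> sig_fml P S) : sig_fml P S :=
  ∃S x, ∃P a, ∃S o u, Qdom (QTuple x a o u) ∧ f (QTuple x a o u).
Definition allB {P S : Type} (f : btuple P S -> sig_fml P S) : sig_fml P S :=
  ∀S s, ∀P a, ∀S o u, ∀P x y z,
    Bdom (BTuple s a o u x y z) ⇒ f (BTuple s a o u x y z).
Definition exB {P S : Type} (f : btuple P S -> sig_fml P S) : sig_fml P S :=
  ∃S s, ∃P a, ∃S o u, ∃P x y z,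
    Bdom (BTuple s a o u x y z) ∧ f (BTuple s a o u x y z).

Definition tr_atom {P S : Type} (p : sr_atom (btuple P S) (qtuple P S)) :
    sig_fml P S :=
  match p with
  | Obs b => tr_Obs b
  | Ph b => tr_Ph b
  | Plus q q1 q2 => tr_plus q q1 q2
  | Times q q1 q2 => tr_times q q1 q2
  | WorldView o b t x y z => tr_W o b t x y z
  | EqB b b' => tr_eqB b b'
  | EqQ q q' => tr_eqQ q q'
  end.

Fixpoint tr_fml {P S : Type} (phi : sr_fml (btuple P S) (qtuple P S)) :
    sig_fml P S :=
  match phi with
  | Atom p => tr_atom p
  | Not f => Not (tr_fml f)
  | And f g => And (tr_fml f) (tr_fml g)
  | Or f g => Or (tr_fml f) (tr_fml g)
  | Imp f g => Imp (tr_fml f) (tr_fml g)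
  | All1 f => allB (fun b => tr_fml (f b))
  | All2 f => allQ (fun q => tr_fml (f q))
  | Ex1 f => exB (fun b => tr_fml (f b))
  | Ex2 f => exQ (fun q => tr_fml (f q))
  end.

Definition tr (psi : sr_sentence) : sig_sentence :=
  fun P S => tr_fml (psi (btuple P S) (qtuple P S)).

Definition eqQ_equivalence : sig_sentence := fun P S =>
  allQ (fun q : qtuple P S => tr_eqQ q q)
  ∧ allQ (fun q => allQ (fun q' => tr_eqQ q q' ⇒ tr_eqQ q' q))
  ∧ allQ (fun q => allQ (fun q' => allQ (fun q'' =>
      tr_eqQ q q' ⇒ tr_eqQ q' q'' ⇒ tr_eqQ q q''))).

Definition eqB_equivalence : sig_sentence := fun P S =>
  allB (fun b : btuple P S => tr_eqB b b)
  ∧ allB (fun b => allB (fun b' => tr_eqB b b' ⇒ tr_eqB b' b))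
  ∧ allB (fun b => allB (fun b' => allB (fun b'' =>
      tr_eqB b b' ⇒ tr_eqB b' b'' ⇒ tr_eqB b b''))).

Definition allQ2 {P S : Type} (f : qtuple P S -> qtuple P S -> sig_fml P S) :
    sig_fml P S :=
  allQ (fun q => allQ (fun q' => tr_eqQ q q' ⇒ f q q')).
Definition allB2 {P S : Type} (f : btuple P S -> btuple P S -> sig_fml P S) :
    sig_fml P S :=
  allB (fun b => allB (fun b' => tr_eqB b b' ⇒ f b b')).

Definition plus_invariant : sig_sentence := fun P S =>
  allQ2 (fun q q' : qtuple P S => allQ2 (fun q1 q1' => allQ2 (fun q2 q2' =>
    tr_plus q q1 q2 ⇔ tr_plus q' q1' q2'))).

Definition times_invariant : sig_sentence := fun P S =>
  allQ2 (fun q q' : qtuple P S => allQ2 (fun q1 q1' => allQ2 (fun q2 q2' =>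
    tr_times q q1 q2 ⇔ tr_times q' q1' q2'))).

Definition Ph_invariant : sig_sentence := fun P S =>
  allB2 (fun b b' : btuple P S => tr_Ph b ⇔ tr_Ph b').

Definition Obs_invariant : sig_sentence := fun P S =>
  allB2 (fun b b' : btuple P S => tr_Obs b ⇔ tr_Obs b').

Definition W_invariant : sig_sentence := fun P S =>
  allB2 (fun m m' : btuple P S => allB2 (fun b b' =>
    allQ2 (fun t t' => allQ2 (fun x x' => allQ2 (fun y y' => allQ2 (fun z z' =>
      tr_W m b t x y z ⇔ tr_W m' b' t' x' y' z')))))).

End Translation.

(* Main.v *)
Require Import Defs.
From mathcomp Require Import all_boot all_order all_algebra ring lra.
From mathcomp Require Import boolp classical_sets.

Set Implicit Arguments.
Unset Strict Implicit.
Unset Printing Implicit Defensive.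
Import Order.TTheory GRing.Theory Num.Theory.
Local Open Scope classical_set_scope.
Local Open Scope ring_scope.

(** The translation is an interpretation because it describes, in terms of
    particles and signals, a model of SpecRel0 that can be built directly from
    the field F: quantities are the elements of F, photons are the light-like
    lines of F^4, and observers are the affine frames of F^4 whose linear part
    multiplies the Minkowski form by a positive factor.

    Two ideas carry the proof.  The first is to compute every auxiliary formula
    in the standard model over F as a statement about points of F^4.  A particle
    with a zero event o and a unit event o + w splits F^4 orthogonally for the
    Minkowski form: each point is o + x w + s for a unique number x and a unique
    vector s orthogonal to w, its time and its place.  On the complement of w the
    form is negative definite (orth_neg), so a light-signal leads from (x, s) to
    (y, t) exactly when x <= y and (y - x)^2 |w|^2 is the squared length of
    t - s (linkP).  With this, simultaneity, betweenness, parallelism, distance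
    and the operations of F(a,o,u) become the Euclidean ones (simP, Col_pl,
    pa_pl, dist_pl, add_tm, mul_tm), a frame of particles becomes an affine frame
    with the corresponding coordinates (corP), and the relativistic distance
    becomes the square root of the Minkowski form (muP), which makes phi_iso the
    comparison of times along two different particles (phi_isoP).  Square roots
    of positive elements are used to find light-signals and places at a given
    distance (sphere_ex, null_sum).

    The second idea is that each tuple for a quantity or a body has a value in
    the model built from F (qrel, brel), that every value occurs, and that each
    translated atomic formula says of tuples what the atomic formula says of
    their values.  For the two equalities this means equality of values, so they
    are equivalence relations under which all other formulas are invariant.  By
    induction on formulas, the translation of a sentence holds in the standard
    model if and only if the sentence holds in the model built from F (tr_fmlP),
    and there the four axioms are elementary: AxFd is the theory of F, the others
    hold because a frame maps F^4 bijectively onto itself and preserves straight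
    lines and the light cone. *)

(** * The Minkowski form *)

Ltac vring := apply/rowP => ?; rewrite !mxE; ring.
Ltac vfield := apply/rowP => ?; rewrite !mxE; field.

Section Minkowski.
Variable F : realFieldType.
Local Notation V := 'rV[F]_4.
Implicit Types (u v w s d : V) (k x y : F).

Definition mink u v : F :=
  u 0 0 * v 0 0 - (u 0 1 * v 0 1 + u 0 2 * v 0 2 + u 0 3 * v 0 3).
Local Notation "'[ u , v ]" := (mink u v).

Lemma minkC u v : '[u, v] = '[v, u].
Proof. rewrite /mink; ring. Qed.
Lemma minkDl u v w : '[u + v, w] = '[u, w] + '[v, w].
Proof. rewrite /mink !mxE; ring. Qed.
Lemma minkDr u v w : '[w, u + v] = '[w, u] + '[w, v].
Proof. by rewrite !(minkC w) minkDl. Qed.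
Lemma minkZl k u v : '[k *: u, v] = k * '[u, v].
Proof. rewrite /mink !mxE; ring. Qed.
Lemma minkZr k u v : '[u, k *: v] = k * '[u, v].
Proof. by rewrite !(minkC u) minkZl. Qed.
Lemma minkNl u v : '[- u, v] = - '[u, v].
Proof. by rewrite -scaleN1r minkZl mulN1r. Qed.
Lemma minkNr u v : '[u, - v] = - '[u, v].
Proof. by rewrite !(minkC u) minkNl. Qed.
Lemma mink0l u : '[0, u] = 0.
Proof. by rewrite -(scale0r 0) minkZl mul0r. Qed.
Lemma mink0r u : '[u, 0] = 0.
Proof. by rewrite minkC mink0l. Qed.
Definition minkE :=
  (minkDl, minkDr, minkNl, minkNr, minkZl, minkZr, mink0l, mink0r).

Lemma minkBB u v : '[u - v, u - v] = '[v - u, v - u].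
Proof. by rewrite -opprB minkNl minkNr opprK. Qed.

(** Time-like and future-directed: of the two orientations of a particle, the one
    that agrees with the direction of signals. *)
Definition fut w := (0 < '[w, w]) && (0 < w 0 0).

Lemma fut_gt0 w : fut w -> 0 < '[w, w]. Proof. by case/andP. Qed.

Lemma row4P u v :
  u 0 0 = v 0 0 -> u 0 1 = v 0 1 -> u 0 2 = v 0 2 -> u 0 3 = v 0 3 -> u = v.
Proof.
move=> h0 h1 h2 h3; apply/rowP => i.
have : [|| i == 0, i == 1, i == 2 | i == 3] by case: i => -[|[|[|[|]]]].
by case/or4P=> /eqP ->.
Qed.

Lemma sum3sq_eq0 (a b c : F) :
  a ^+ 2 + b ^+ 2 + c ^+ 2 <= 0 -> [/\ a = 0, b = 0 & c = 0].
Proof.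
move=> h; have := sqr_ge0 a; have := sqr_ge0 b; have := sqr_ge0 c.
by move=> hc hb ha; split; apply/eqP; rewrite -sqrf_eq0; apply/eqP; lra.
Qed.

Lemma cauchy3 (a b c p q r : F) :
  (a * p + b * q + c * r) ^+ 2 <=
  (a ^+ 2 + b ^+ 2 + c ^+ 2) * (p ^+ 2 + q ^+ 2 + r ^+ 2).
Proof.
rewrite -subr_ge0.
have -> : (a ^+ 2 + b ^+ 2 + c ^+ 2) * (p ^+ 2 + q ^+ 2 + r ^+ 2) -
  (a * p + b * q + c * r) ^+ 2 =
  (a * q - b * p) ^+ 2 + (a * r - c * p) ^+ 2 + (b * r - c * q) ^+ 2 by ring.
by rewrite !addr_ge0 // sqr_ge0.
Qed.

Lemma null_time0 v : 0 <= '[v, v] -> v 0 0 = 0 -> v = 0.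
Proof.
rewrite /mink => h h0; rewrite h0 in h.
have [] := @sum3sq_eq0 (v 0 1) (v 0 2) (v 0 3); first by lra.
by move=> h1 h2 h3; apply: row4P; rewrite !mxE.
Qed.

(** The complement of a time-like vector is space-like: orthogonality makes the
    product of the time components equal to that of the spatial parts,
    and the Cauchy-Schwarz inequality for these contradicts '[s, s] >= 0. *)
Lemma orth_neg d s : 0 < '[d, d] -> '[s, d] = 0 -> s != 0 -> '[s, s] < 0.
Proof.
move=> hd hs; apply: contra_neqT; rewrite -leNgt => hss.
set S := s 0 1 ^+ 2 + s 0 2 ^+ 2 + s 0 3 ^+ 2.
set D := d 0 1 ^+ 2 + d 0 2 ^+ 2 + d 0 3 ^+ 2.
have hD : D < d 0 0 ^+ 2 by rewrite /D; move: hd; rewrite /mink; lra.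
have hS : S <= s 0 0 ^+ 2 by rewrite /S; move: hss; rewrite /mink; lra.
have D0 : 0 <= D by rewrite /D !addr_ge0 // sqr_ge0.
have S0 : 0 <= S by rewrite /S !addr_ge0 // sqr_ge0.
have := cauchy3 (s 0 1) (s 0 2) (s 0 3) (d 0 1) (d 0 2) (d 0 3).
have -> : s 0 1 * d 0 1 + s 0 2 * d 0 2 + s 0 3 * d 0 3 = s 0 0 * d 0 0.
  by move: hs; rewrite /mink => /eqP; rewrite subr_eq0 => /eqP.
rewrite -/S -/D exprMn => hC.
apply: null_time0 => //; apply/eqP; rewrite -sqrf_eq0; apply/eqP.
have d0 : 0 < d 0 0 ^+ 2 by lra.
apply/eqP; rewrite eq_le sqr_ge0 andbT leNgt; apply/negP => hs0.
have : s 0 0 ^+ 2 * D < s 0 0 ^+ 2 * d 0 0 ^+ 2 by rewrite ltr_pM2l.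
have : S * D <= s 0 0 ^+ 2 * D by rewrite ler_wpM2r.
lra.
Qed.

Lemma orth_npos d s : 0 < '[d, d] -> '[s, d] = 0 -> '[s, s] <= 0.
Proof.
move=> hd hs; have [->|s0] := eqVneq s 0; first by rewrite mink0l.
exact/ltW/(orth_neg hd hs).
Qed.

Lemma orth_eq0 d s : 0 < '[d, d] -> '[s, d] = 0 -> '[s, s] = 0 -> s = 0.
Proof.
move=> hd hs hss; apply/eqP; apply: contraTT isT => s0.
by have := orth_neg hd hs s0; rewrite hss ltxx.
Qed.

Lemma fut_mink_gt0 w v : fut w -> 0 <= '[v, v] -> 0 < v 0 0 -> 0 < '[v, w].
Proof.
case/andP=> hw w0 hv v0.
set S := v 0 1 ^+ 2 + v 0 2 ^+ 2 + v 0 3 ^+ 2.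
set D := w 0 1 ^+ 2 + w 0 2 ^+ 2 + w 0 3 ^+ 2.
have hD : D < w 0 0 ^+ 2 by rewrite /D; move: hw; rewrite /mink; lra.
have hS : S <= v 0 0 ^+ 2 by rewrite /S; move: hv; rewrite /mink; lra.
have D0 : 0 <= D by rewrite /D !addr_ge0 // sqr_ge0.
have S0 : 0 <= S by rewrite /S !addr_ge0 // sqr_ge0.
have := cauchy3 (v 0 1) (v 0 2) (v 0 3) (w 0 1) (w 0 2) (w 0 3).
rewrite -/S -/D => hC; rewrite /mink subr_gt0.
set c := _ + _ in hC *.
rewrite ltNge; apply/negP => hc.
have : (v 0 0 * w 0 0) ^+ 2 <= c ^+ 2.
  by rewrite ler_sqr ?nnegrE // ?(le_trans _ hc) // mulr_ge0 // ltW.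
rewrite exprMn.
have : v 0 0 ^+ 2 * D < v 0 0 ^+ 2 * w 0 0 ^+ 2 by rewrite ltr_pM2l // exprn_gt0.
have : S * D <= v 0 0 ^+ 2 * D by rewrite ler_wpM2r.
lra.
Qed.

(** Time orientation can be read off from the product with any future-directed
    w, which in the rest frame of w is the coordinate along w. *)
Lemma causal_future w v : fut w -> 0 <= '[v, v] ->
  (0 <= v 0 0) = (0 <= '[v, w]).
Proof.
move=> hw hv; apply/idP/idP => h.
  move: h; rewrite le_eqVlt => /orP[/eqP h|h]; last exact/ltW/fut_mink_gt0.
  by rewrite (null_time0 hv) // mink0l.
rewrite leNgt; apply/negP => h0.
have : 0 < '[- v, w].
  by apply: fut_mink_gt0; rewrite ?fut_gt0 // ?minkNl ?minkNr ?mxE ?opprK; lra.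
rewrite minkE; lra.
Qed.

Lemma decompose w v : 0 < '[w, w] ->
  exists x s, '[s, w] = 0 /\ v = x *: w + s.
Proof.
move=> hw; exists ('[v, w] / '[w, w]), (v - ('[v, w] / '[w, w]) *: w).
split; last by vring.
by rewrite !minkE mulfVK ?subrr // gt_eqF.
Qed.

Lemma fut_comb w s x : fut w -> '[s, w] = 0 -> 0 < x ->
  - '[s, s] < x ^+ 2 * '[w, w] -> fut (x *: w + s).
Proof.
move=> fw hs x0 h; have W := fut_gt0 fw.
have h2 : 0 < '[x *: w + s, x *: w + s].
  by rewrite !minkE hs (minkC w) hs; move: h; lra.
rewrite /fut h2 /= lt_neqAle (causal_future fw (ltW h2)).
rewrite minkDl minkZl hs addr0 (ltW (mulr_gt0 x0 W)) andbT.
apply/eqP => h0; have := h2.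
by rewrite (null_time0 (ltW h2) (esym h0)) mink0l ltxx.
Qed.

(** The displacements of signals, including those of length zero. *)
Definition nullfut v := 0 <= v 0 0 /\ '[v, v] = 0.

Lemma nullfut0 : nullfut 0.
Proof. by rewrite /nullfut !mxE mink0l. Qed.

Hypothesis sqrtF : euclidean F.

Lemma sqrt_ex k : 0 <= k -> exists2 r, 0 <= r & r ^+ 2 = k.
Proof.
rewrite le_eqVlt => /orP[/eqP <-|/sqrtF[r hr]]; first by exists 0; rewrite ?expr0n.
by exists `|r|; rewrite ?normr_ge0 // -hr real_normK // num_real.
Qed.

Definition metric_mx : 'M[F]_4 :=
  \matrix_(i, j) ((-1) ^+ (i != 0) *+ (i == j)).

Lemma metric_mxP u v : (u *m metric_mx *m v^T) 0 0 = '[u, v].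
Proof.
rewrite mxE !big_ord_recl big_ord0 !mxE !big_ord_recl !big_ord0 !mxE /=.
rewrite /mink.
have -> : lift ord0 ord0 = 1 :> 'I_4 by apply: val_inj.
have -> : lift ord0 (lift ord0 ord0) = 2 :> 'I_4 by apply: val_inj.
have -> : lift ord0 (lift ord0 (lift ord0 ord0)) = 3 :> 'I_4 by apply: val_inj.
rewrite /= ?mulr0n ?mulr1n ?expr0 ?expr1; ring.
Qed.

Lemma metric_mx_sqr : metric_mx *m metric_mx = 1%:M.
Proof.
apply/matrixP => i j; rewrite !mxE (bigD1 i) //= big1 ?addr0.
  rewrite !mxE eqxx [i == j]eq_sym; case: (j == i); rewrite ?mulr0n ?mulr0 //.
  by rewrite !mulr1n -expr2 sqrr_sign.
by move=> k hk; rewrite !mxE [i == k]eq_sym (negbTE hk) mulr0n mul0r.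
Qed.

(** Two linear conditions on a vector of dimension four. *)
Lemma orth2_ex u v : exists2 s, s != 0 & '[s, u] = 0 /\ '[s, v] = 0.
Proof.
pose A := metric_mx *m row_mx u^T v^T.
have /rowV0Pn[s hs s0] : kermx A != 0.
  rewrite -mxrank_eq0 mxrank_ker subn_eq0 -ltnNge.
  by apply: leq_ltn_trans (rank_leq_col _) _.
exists s => //; move/sub_kermxP: hs; rewrite /A mulmxA mul_mx_row.
move/eqP; rewrite -[0]hsubmxK => /eqP/eq_row_mx[h1 h2].
by rewrite -!metric_mxP h1 h2 !mxE.
Qed.

(** Every vector orthogonal to w is space-like, so it can be rescaled to any
    spatial length by taking a square root. *)
Lemma orth_sq_ex w c k : 0 < '[w, w] -> 0 <= k ->
  exists s, [/\ '[s, w] = 0, '[s, c] = 0 & '[s, s] = - k].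
Proof.
move=> hw hk; have [s s0 [hsw hsc]] := orth2_ex w c.
have hs := orth_neg hw hsw s0.
have [r r0 hr] : exists2 r, 0 <= r & r ^+ 2 = k / - '[s, s].
  by apply: sqrt_ex; rewrite divr_ge0 // oppr_ge0 ltW.
exists (r *: s); rewrite !minkE hsw hsc !mulr0; split => //.
rewrite mulrA -expr2 hr; field; lra.
Qed.

(** If the spatial part of v has length r and direction e, then v is the sum of
    (t + r)/2 times (1, e) and (t - r)/2 times (1, -e), where t is the time
    component.  Both factors are nonnegative when v is causal and
    future-directed, because then r <= t. *)
Lemma null_sum v : exists n1 n2, [/\ '[n1, n1] = 0, '[n2, n2] = 0, v = n1 + n2 &
  0 <= v 0 0 -> 0 <= '[v, v] -> 0 <= n1 0 0 /\ 0 <= n2 0 0].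
Proof.
set S := v 0 1 ^+ 2 + v 0 2 ^+ 2 + v 0 3 ^+ 2.
have S0 : 0 <= S by rewrite /S !addr_ge0 // sqr_ge0.
have [r r0 hr] := sqrt_ex S0.
(* The direction (a, b, c) is arbitrary when the spatial part of v vanishes. *)
have [a [b [c [h1 ha hb hc]]]] : exists a b c, [/\ a ^+ 2 + b ^+ 2 + c ^+ 2 = 1,
    v 0 1 = r * a, v 0 2 = r * b & v 0 3 = r * c].
  have [rz|rn] := eqVneq r 0.
    have [] := @sum3sq_eq0 (v 0 1) (v 0 2) (v 0 3).
      by rewrite -/S -hr rz expr0n.
    by move=> -> -> ->; exists 1, 0, 0; split; rewrite ?rz; ring.
  exists (v 0 1 / r), (v 0 2 / r), (v 0 3 / r); split; try field => //.
  rewrite !exprMn -!mulrDl -/S -hr -exprMn divff ?expr1n //.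
pose n (e : F) (g : F) : V := \row_i [:: e; g * a; g * b; g * c]`_i.
have hn e g : '[n e g, n e g] = e ^+ 2 - g ^+ 2.
  rewrite /mink !mxE /= -[g ^+ 2]mulr1 -h1; ring.
exists (n ((v 0 0 + r) / 2) ((v 0 0 + r) / 2)).
exists (n ((v 0 0 - r) / 2) (- (v 0 0 - r) / 2)).
split; rewrite ?hn; try by field.
  by apply: row4P; rewrite !mxE /= ?ha ?hb ?hc; field.
move=> v0 hv; rewrite !mxE /=.
have : r <= v 0 0.
  rewrite -ler_sqr ?nnegrE // hr /S; move: hv; rewrite /mink; lra.
lra.
Qed.

End Minkowski.

(** * Events, signals and particles as points, segments and lines *)

Section Points.
Variable F : realFieldType.
Local Notation V := 'rV[F]_4.
Local Notation M := (stdModel F).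
Local Notation "⟦ phi ⟧" := (holds (@sig_interp M) phi).
Local Notation "'[ u , v ]" := (mink u v).
Implicit Types (p q r d w v : V) (a b c : Par M) (s e : Sig M) (k x y : F).

Definition on a p : Prop := sval a p.

Definition pts s : V * V := sval s.

Fact ev_subproof p : (p == p) ||
  ((p 0 0 < p 0 0) && (sqspace (p - p) == (p - p) 0 0 ^+ 2)).
Proof. by rewrite eqxx. Qed.

Definition ev p : Sig M :=
  exist (fun s : V * V => (s.1 == s.2) ||
     ((s.1 0 0 < s.2 0 0) && (sqspace (s.2 - s.1) == (s.2 - s.1) 0 0 ^+ 2)))
    (p, p) (ev_subproof p).

Lemma ev_inj : injective ev.
Proof. by move=> p q /(congr1 sval)[]. Qed.

Lemma sqspaceE v : (sqspace v == v 0 0 ^+ 2) = ('[v, v] == 0).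
Proof. by rewrite eq_sym -subr_eq0 /sqspace /mink !expr2. Qed.

Lemma signal_nullfut s : nullfut ((pts s).2 - (pts s).1).
Proof.
rewrite /pts; case: s => -[p q] /= /orP[/eqP ->|].
  by rewrite subrr; exact: nullfut0.
by rewrite sqspaceE => /andP[h /eqP hs]; split => //; rewrite !mxE; lra.
Qed.

Lemma signal_ex p q : nullfut (q - p) -> exists s, pts s = (p, q).
Proof.
move=> [h0 h].
suff H : (p == q) || ((p 0 0 < q 0 0) && (sqspace (q - p) == (q - p) 0 0 ^+ 2)).
  by exists (exist _ (p, q) H).
have [//|npq] /= := eqVneq p q; rewrite sqspaceE h eqxx andbT.
have := h0; rewrite le_eqVlt !mxE subr_gt0 => /orP[/eqP h1|//].
case/eqP: npq; apply/esym/subr0_eq/null_time0; first by rewrite h.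
by rewrite !mxE.
Qed.

Lemma sig_inj s s' : pts s = pts s' -> s = s'.
Proof.
rewrite /pts; case: s s' => [x hx] [y hy] /= exy; rewrite exy in hx *.
by rewrite (Prop_irrelevance hx hy).
Qed.

Definition axis : V := \row_i [:: 1; 0; 0; 0]`_i.

Lemma fut_axis : fut axis.
Proof. by rewrite /fut /mink !mxE /= ltr01 andbT; lra. Qed.

(** A second direction: together with the time axis it separates points. *)
Definition axis' : V := \row_i [:: 2; 1; 0; 0]`_i.

Lemma fut_axis' : fut axis'.
Proof. by rewrite /fut /mink !mxE /= ltr0n andbT; lra. Qed.

Lemma fut_neq0 w : fut w -> w != 0.
Proof. by move/fut_gt0; apply: contraTneq => ->; rewrite mink0l ltxx. Qed.

Lemma fut_slope w : fut w -> sqspace w < w 0 0 ^+ 2.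
Proof. by move/fut_gt0; rewrite -[_ < _ ^+ 2]subr_gt0 /sqspace /mink !expr2. Qed.

Fact part_subproof p d (d' := if fut d then d else axis) :
  exists q e : V, [/\ e != 0, sqspace e < e 0 0 ^+ 2 & line p d' = line q e].
Proof.
exists p, d'; have h : fut d'.
  by rewrite /d'; case: ifP => // _; exact: fut_axis.
by split; rewrite ?fut_neq0 ?fut_slope.
Qed.

(** A direction that is not future-directed and time-like is replaced by the time
    axis.  This makes part a total function, so that it can occur in equations
    without a proof about d. *)
Definition part p d : Par M :=
  exist (fun l : set V => exists q e : V,
     [/\ e != 0, sqspace e < e 0 0 ^+ 2 & l = line q e])
    (line p (if fut d then d else axis)) (part_subproof p d).

Lemma on_part p d q : fut d -> on (part p d) q <-> exists k, q = p + k *: d.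
Proof.
rewrite /on /= => ->; split; first by case=> k _ <-; exists k.
by case=> k ->; exists k.
Qed.

Lemma par_inj a b : sval a = sval b -> a = b.
Proof.
case: a b => [x hx] [y hy] /= exy; rewrite exy in hx *.
by rewrite (Prop_irrelevance hx hy).
Qed.

Lemma partP a : exists p d, fut d /\ a = part p d.
Proof.
have [p [d [d0 hd la]]] := svalP a.
have {}hd : 0 < '[d, d] by move: hd; rewrite -subr_gt0 /sqspace /mink !expr2.
have [h0|h0] := ltP 0 (d 0 0).
  have fd : fut d by rewrite /fut hd h0.
  by exists p, d; split => //; apply: par_inj; rewrite /= fd.
have fd : fut (- d).
  rewrite /fut !minkE opprK hd mxE oppr_gt0 lt_neqAle h0 andbT /=.
  apply: contraNneq d0 => h; rewrite (null_time0 _ h) //; exact: ltW.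
exists p, (- d); split => //; apply: par_inj; rewrite /= fd la.
rewrite eqEsubset; split=> _ [k _ <-]; exists (- k) => //.
  by rewrite scalerN scaleNr opprK.
by rewrite scalerN scaleNr.
Qed.

Lemma on_base p d : fut d -> on (part p d) p.
Proof. by move=> fd; apply/on_part => //; exists 0; vring. Qed.

Lemma part_shift p d q : fut d -> on (part p d) q -> part p d = part q d.
Proof.
move=> fd /on_part -/(_ fd)[k ->]; apply: par_inj; rewrite /= fd eqEsubset.
split=> _ [l _ <-]; [exists (l - k)|exists (l + k)] => //; vring.
Qed.

Lemma on_shift p d k : fut d -> on (part p d) (p + k *: d).
Proof. by move=> fd; apply/on_part => //; exists k. Qed.

Lemma on_line a p q k : on a p -> on a q -> on a (p + k *: (q - p)).
Proof.
have [p0 [d [fd ->]]] := partP a.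
move=> /on_part-/(_ fd)[x ->] /on_part-/(_ fd)[y ->].
by apply/on_part => //; exists (x + k * (y - x)); vring.
Qed.

Lemma on_dir p d q r : fut d -> on (part p d) q -> on (part p d) r ->
  exists k, r - q = k *: d.
Proof.
move=> fd /on_part-/(_ fd)[x ->] /on_part-/(_ fd)[y ->].
by exists (y - x); vring.
Qed.

Lemma line_on a p q r : p != q -> on a p -> on a q -> on a r ->
  exists k, r = p + k *: (q - p).
Proof.
have [p0 [d [fd ->]]] := partP a => npq hp hq hr.
have [k hk] := on_dir fd hp hq; have [l hl] := on_dir fd hp hr.
have k0 : k != 0.
  by apply: contraNneq npq => k0; rewrite eq_sym -subr_eq0 hk k0 scale0r.
by exists (l / k); rewrite hk scalerA divfK // -hl addrC subrK.
Qed.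

Lemma par_eq2 a b p q : p != q -> on a p -> on a q -> on b p -> on b q -> a = b.
Proof.
move=> npq ap aq bp bq; apply: par_inj; rewrite eqEsubset; split => r hr.
  by have [k ->] := line_on npq ap aq hr; apply: on_line.
by have [k ->] := line_on npq bp bq hr; apply: on_line.
Qed.

(** Particles through p with different directions meet only at p. *)
Lemma pts_sep p q : (forall b, on b p -> on b q) -> p = q.
Proof.
move=> h; have /on_part-/(_ fut_axis)[k hk] := h _ (on_base p fut_axis).
have /on_part-/(_ fut_axis')[l hl] := h _ (on_base p fut_axis').
have l0 : l = 0.
  by have := congr1 (fun v : V => v 0 1) hl; rewrite hk !mxE /=; lra.
by rewrite hl l0; vring.
Qed.

Lemma TP a p : ⟦T a (ev p)⟧ = on a p. Proof. by []. Qed.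
Lemma eqsP p q : ⟦eqs (ev p) (ev q)⟧ <-> p = q.
Proof. by split=> [/ev_inj|->]. Qed.

Lemma BegP s p : ⟦Beg s (ev p)⟧ <-> (pts s).1 = p.
Proof.
split=> [h|<- b //].
by apply: pts_sep => b hb; exact: (h b hb).
Qed.

Lemma EndP s p : ⟦End s (ev p)⟧ <-> (pts s).2 = p.
Proof.
split=> [h|<- b //].
by apply: pts_sep => b hb; exact: (h b hb).
Qed.

Lemma sentP p s q : ⟦sent (ev p) s (ev q)⟧ <-> pts s = (p, q).
Proof.
split=> [[/BegP h1 /EndP h2]|h]; first by rewrite (surjective_pairing (pts s)) h1 h2.
by split; [apply/BegP|apply/EndP]; rewrite h.
Qed.

Lemma sent_null p s q : ⟦sent (ev p) s (ev q)⟧ -> nullfut (q - p).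
Proof. by move/sentP=> h; have := signal_nullfut s; rewrite h. Qed.

Lemma sent_ex p q : nullfut (q - p) -> exists s, ⟦sent (ev p) s (ev q)⟧.
Proof. by move/signal_ex=> [s hs]; exists s; apply/sentP. Qed.

Lemma EvP e : ⟦Ev e⟧ <-> exists p, e = ev p.
Proof.
split=> [h|[p ->] b //]; exists (pts e).1; apply: sig_inj.
rewrite (surjective_pairing (pts e)) /=; congr pair.
by apply/esym/pts_sep => b hb; exact: (h b hb).
Qed.

Lemma Ev_pts e : ⟦Ev e⟧ <-> (pts e).1 = (pts e).2.
Proof.
split=> [/EvP[p ->] //|h]; apply/EvP; exists (pts e).1; apply: sig_inj.
by rewrite (surjective_pairing (pts e)) /= -h.
Qed.

Lemma Ev_ev p : ⟦Ev (ev p)⟧.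
Proof. by apply/EvP; exists p. Qed.

(** The events e1, e3 of a = part p w and e2, e4 of b lie in the plane that c and d
    span at their common event e5.  If e2 and e4 divide the segments from e5 to e1
    and e3 in the same ratio, then a and b are parallel; otherwise the two
    coplanar lines meet. *)
Lemma motionless_parallel p w b : fut w ->
  ⟦motionless b (part p w)⟧ -> exists q, b = part q w.
Proof.
move=> fw.
have [q [d [fd ->]]] := partP b.
case=> [eq|]; first by exists p; exact: eq.
move=> [nomeet [c [c' [_ [_ [_ [_ [_]]]]]]]].
move=> [_ [/EvP[e1 ->] [_ [/EvP[e2 ->] [_ [/EvP[e3 ->] [_ [/EvP[e4 ->]]]]]]]]].
move=> [_ [/EvP[e5 ->]]].
move=> [ce1 [ae1 [ce2 [be2 [de3 [ae3 [de4 [be4 [ce5 [de5]]]]]]]]]].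
move=> [_ [n13 [_ [n15 [_ [n24 [_ [_ [n35 _]]]]]]]]].
have /eqP {}n13 : e1 <> e3 by move/eqsP.
have /eqP {}n15 : e1 <> e5 by move/eqsP.
have /eqP {}n35 : e3 <> e5 by move/eqsP.
have /eqP {}n24 : e2 <> e4 by move/eqsP.
rewrite eq_sym in n15; rewrite eq_sym in n35.
have [x hx] : exists x, e2 = e5 + x *: (e1 - e5) := line_on n15 ce5 ce1 ce2.
have [y hy] : exists y, e4 = e5 + y *: (e3 - e5) := line_on n35 de5 de3 de4.
have [exy|nxy] := eqVneq x y.
  have [k hk] : exists k, e3 - e1 = k *: w := on_dir fw ae1 ae3.
  have [l hl] : exists l, e4 - e2 = l *: d := on_dir fd be2 be4.
  have l0 : l != 0.
    by apply: contraNneq n24 => l0; rewrite eq_sym -subr_eq0 hl l0 scale0r.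
  have hd : d = (l^-1 * y * k) *: w.
    rewrite -scalerA -hk -scalerA -[LHS]scale1r -(mulVf l0) -scalerA -hl.
    by congr (_ *: _); rewrite hx hy exy; vring.
  have k0 : 0 < l^-1 * y * k.
    have := fw; have := fd; rewrite {1}hd /fut mxE.
    by move=> /andP[_ h1] /andP[_ h2]; rewrite -(pmulr_lgt0 _ h2).
  exists q; apply: par_inj; rewrite /= fd fw {1}hd.
  rewrite eqEsubset; split=> _ [j _ <-].
    by exists (j * (l^-1 * y * k)) => //; rewrite scalerA.
  exists (j / (l^-1 * y * k)) => //; rewrite scalerA divfK //; exact: lt0r_neq0.
(* z solves e1 + z y (e3 - e1) = e2 + z (e4 - e2). *)
case: nomeet; pose z := (x - 1) / (x - y).
have hxy : x - y != 0 by rewrite subr_eq0.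
exists (ev (e1 + (z * y) *: (e3 - e1))); split; first exact: (on_line _ ae1 ae3).
have -> : e1 + (z * y) *: (e3 - e1) = e2 + z *: (e4 - e2).
  by rewrite hx hy /z; vfield.
exact: (on_line _ be2 be4).
Qed.

(** Let v be the part of q - p orthogonal to w.  The lines with directions v + K w
    and v + (K + 1) w through p and p + w meet both particles, and each other at
    p - (v + K w); they are slower than light when K is large.  The five events
    are distinct because v and w are independent. *)
Lemma parallel_motionless p q w : fut w ->
  ⟦motionless (part q w) (part p w)⟧.
Proof.
move=> fw.
have [[k hk]|nk] := pselect (exists k, q - p = k *: w).
  left; apply/esym/part_shift => //; apply/on_part => //.
  by exists k; rewrite -hk addrC subrK.
have W := fut_gt0 fw.
have [x [v [hv hd]]] := decompose (q - p) W.
have v0 : v != 0.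
  by apply/eqP => v0; apply: nk; exists x; rewrite hd v0 addr0.
have hvv := orth_neg W hv v0.
(* K > 1 and K '[w, w] > - '[v, v], so v + L w is a direction of a particle
   for L >= K. *)
pose K : F := 1 - '[v, v] / '[w, w].
have K1 : 1 < K by rewrite /K ltrDl oppr_gt0 pmulr_llt0 ?invr_gt0.
have ft (L : F) : K <= L -> fut (v + L *: w).
  move=> hL; rewrite addrC; apply: fut_comb => //; first by lra.
  have hLW : K * '[w, w] <= L * '[w, w] by rewrite ler_pM2r.
  have : L * '[w, w] <= L * (L * '[w, w]).
    by rewrite ler_peMl // ?mulr_ge0 ?(ltW W) //; lra.
  move: hLW; rewrite /K mulrBl mul1r divfK; [lra|exact: lt0r_neq0].
have ind (y z : F) : (y != 0) || (z != 0) -> y *: v + z *: w != 0.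
  apply: contraTneq => h; rewrite negb_or !negbK.
  have /eqP := congr1 (fun u : V => '[u, w]) h; rewrite !minkE hv mulr0 add0r.
  rewrite mulf_eq0 (gt_eqF W) orbF => hz; rewrite hz andbT.
  by move/eqP: h; rewrite (eqP hz) scale0r addr0 scaler_eq0 (negbTE v0) orbF.
have KK : K <= K + 1 by lra.
have fK := ft K (lexx K); have fK1 := ft (K + 1) KK.
pose e1 := p; pose e2 := p + (v + K *: w); pose e3 := p + w.
pose e4 := p + (v + (K + 2) *: w); pose e5 := p - (v + K *: w).
pose c := part p (v + K *: w); pose d := part (p + w) (v + (K + 1) *: w).
have ce1 : on c e1 by exact: on_base.
have ce2 : on c e2 by apply/on_part => //; exists 1; vring.
have ce5 : on c e5 by apply/on_part => //; exists (-1); vring.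
have de3 : on d e3 by exact: on_base.
have de4 : on d e4 by apply/on_part => //; exists 1; vring.
have de5 : on d e5 by apply/on_part => //; exists (-1); vring.
have ae1 : on (part p w) e1 by exact: on_base.
have ae3 : on (part p w) e3 by apply/on_part => //; exists 1; vring.
have be (L : F) : on (part q w) (p + (v + L *: w)).
  apply/on_part => //; exists (L - x); rewrite -[q](subrK p) hd; vring.
have be2 : on (part q w) e2 by exact: be.
have be4 : on (part q w) e4 by exact: be.
have neq (y z : F) (f g : V) :
    f - g = y *: v + z *: w -> (y != 0) || (z != 0) -> f != g.
  by move=> h /ind; rewrite -h subr_eq0.
have n12 : e1 != e2.
  by apply: (@neq (-1) (-K)); [rewrite /e1 /e2; vring | rewrite oppr_eq0 oner_eq0].
have n13 : e1 != e3.
  by apply: (@neq 0 (-1)); [rewrite /e1 /e3; vring | rewrite oppr_eq0 oner_eq0 orbT].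
have n14 : e1 != e4.
  by apply: (@neq (-1) (-K-2)); [rewrite /e1 /e4; vring | rewrite oppr_eq0 oner_eq0].
have n15 : e1 != e5.
  by apply: (@neq 1 K); [rewrite /e1 /e5; vring | rewrite oner_eq0].
have n23 : e2 != e3.
  by apply: (@neq 1 (K-1)); [rewrite /e2 /e3; vring | rewrite oner_eq0].
have n24 : e2 != e4.
  by apply: (@neq 0 (-2)); [rewrite /e2 /e4; vring | rewrite oppr_eq0 pnatr_eq0 orbT].
have n25 : e2 != e5.
  by apply: (@neq 2 (2*K)); [rewrite /e2 /e5; vring | rewrite pnatr_eq0].
have n34 : e3 != e4.
  by apply: (@neq (-1) (-K-1)); [rewrite /e3 /e4; vring | rewrite oppr_eq0 oner_eq0].
have n35 : e3 != e5.
  by apply: (@neq 1 (1+K)); [rewrite /e3 /e5; vring | rewrite oner_eq0].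
have n45 : e4 != e5.
  by apply: (@neq 2 (2*K+2)); [rewrite /e4 /e5; vring | rewrite pnatr_eq0].
have nab : part q w <> part p w.
  move=> h; apply: nk; apply: (on_dir fw (on_base p fw)).
  by rewrite -h; exact: on_base.
have disj (f : V) : on (part p w) f -> on (part q w) f -> False.
  by move=> h1 h2; apply: nab; rewrite (part_shift fw h1) (part_shift fw h2).
right; split; first by move=> [s [h1 h2]]; exact: (disj _ h1 h2).
have nca : c <> part p w.
  by move=> h; apply: (disj e2) => //; rewrite -h.
have ncb : c <> part q w.
  by move=> h; apply: (disj e1) => //; rewrite -h.
have nda : d <> part p w.
  by move=> h; apply: (disj e4) => //; rewrite -h.
have ndb : d <> part q w.
  by move=> h; apply: (disj e3) => //; rewrite -h.
have ncd : c <> d.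
  by move=> h; apply: nca; apply: (par_eq2 n13) => //; rewrite h.
have nE (f g : V) : f != g -> ~ ⟦eqs (ev f) (ev g)⟧ by move=> /eqP h /eqsP.
exists c, d; do 5![split=> //].
exists (ev e1); split; first exact: Ev_ev.
exists (ev e2); split; first exact: Ev_ev.
exists (ev e3); split; first exact: Ev_ev.
exists (ev e4); split; first exact: Ev_ev.
exists (ev e5); split; first exact: Ev_ev.
do 10![split=> //]; do !(split; first exact: nE); exact: nE.
Qed.

Lemma motionlessP p w b : fut w ->
  ⟦motionless b (part p w)⟧ <-> exists q, b = part q w.
Proof.
move=> fw; split=> [/(motionless_parallel fw)//|[q ->]].
exact: parallel_motionless.
Qed.

End Points.

(** * Time in the rest frame of a particle *)

Section RestFrame.
Variable F : realFieldType.
Hypothesis sqrtF : euclidean F.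
Local Notation V := 'rV[F]_4.
Local Notation M := (stdModel F).
Local Notation "⟦ phi ⟧" := (holds (@sig_interp M) phi).
Local Notation "'[ u , v ]" := (mink u v).
Implicit Types (p q r d v s t : V) (b c : Par M) (e g : Sig M) (k x y z : F).

Lemma sqr_inj x y : 0 <= x -> 0 <= y -> x ^+ 2 = y ^+ 2 -> x = y.
Proof. by move=> x0 y0 /eqP; rewrite eqrXn2 // => /eqP. Qed.

(** The sum of two future-directed light-like vectors is causal by the
    Cauchy-Schwarz inequality, and every causal future-directed vector is such a
    sum. *)
Lemma precP p q :
  ⟦prec (ev p) (ev q)⟧ <-> 0 <= (q - p) 0 0 /\ 0 <= '[q - p, q - p].
Proof.
split.
  move=> [_ [/EvP[r ->] [s1 [s2 [/sent_null h1 /sent_null h2]]]]].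
  have -> : q - p = (r - p) + (q - r) by vring.
  move: (r - p) (q - r) h1 h2 => m n [m0 mm] [n0 nn].
  have -> : '[m + n, m + n] = 2 * '[m, n].
    by rewrite !minkE mm nn (minkC n); ring.
  rewrite mxE; split; first exact: addr_ge0.
  rewrite mulr_ge0 //.
  have := n0; rewrite le_eqVlt => /orP[/eqP h|hn].
    by rewrite (@null_time0 _ n) ?minkE ?nn.
  have := m0; rewrite le_eqVlt => /orP[/eqP h|hm].
    by rewrite (@null_time0 _ m) ?minkE ?mm.
  have S := cauchy3 (m 0 1) (m 0 2) (m 0 3) (n 0 1) (n 0 2) (n 0 3).
  have hM : m 0 1 ^+ 2 + m 0 2 ^+ 2 + m 0 3 ^+ 2 = m 0 0 ^+ 2.
    by move: mm; rewrite /mink !expr2 => /subr0_eq.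
  have hN : n 0 1 ^+ 2 + n 0 2 ^+ 2 + n 0 3 ^+ 2 = n 0 0 ^+ 2.
    by move: nn; rewrite /mink !expr2 => /subr0_eq.
  move: S; rewrite hM hN -exprMn /mink subr_ge0.
  set c := _ + _ => hc; rewrite leNgt; apply/negP => hlt.
  have : (m 0 0 * n 0 0) ^+ 2 < c ^+ 2.
    by rewrite ltr_sqr ?nnegrE // ?mulr_ge0 // (le_trans _ (ltW hlt)) // mulr_ge0.
  by rewrite ltNge hc.
move=> [h0 h]; have [n1 [n2 [h1 h2 e12 pos]]] := null_sum sqrtF (q - p).
have [p1 p2] := pos h0 h.
have [s1 hs1] : exists g, ⟦sent (ev p) g (ev (p + n1))⟧.
  by apply: sent_ex; have -> : p + n1 - p = n1 by vring.
have [s2 hs2] : exists g, ⟦sent (ev (p + n1)) g (ev q)⟧.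
  apply: sent_ex; have -> : q - (p + n1) = n2 by rewrite -[q](subrK p) e12; vring.
  by [].
exists (ev (p + n1)); split; first exact: Ev_ev.
by exists s1, s2.
Qed.

Variables o w : V.
Hypothesis fw : fut w.
Local Notation a := (part o w).

Let W := fut_gt0 fw.

(** Every point is o + x w + s for a unique number x and a unique s orthogonal to
    w.  These are the time and the place that the particle part o w, with zero
    event o and unit event o + w, assigns to the point.  The particles at rest
    with respect to it are the sets of points with a fixed place. *)
Definition clock_event x : Sig M := ev (o + x *: w).
Definition spacetime_pt x s : V := o + x *: w + s.
Definition place s : Par M := part (o + s) w.
Definition orthogonal s := '[s, w] = 0.

Local Notation tm := clock_event.
Local Notation pt := spacetime_pt.
Local Notation pl := place.
Local Notation orth := orthogonal.

Lemma tm0 : tm 0 = ev o. Proof. by rewrite /tm scale0r addr0. Qed.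
Lemma tm1 : tm 1 = ev (o + w). Proof. by rewrite /tm scale1r. Qed.
Lemma tmE x : o + x *: w = pt x 0. Proof. by rewrite /pt addr0. Qed.
Lemma pl0 : pl 0 = a. Proof. by rewrite /pl addr0. Qed.

Lemma orth0 : orth 0. Proof. exact: mink0l. Qed.
Lemma orthD s t : orth s -> orth t -> orth (s + t).
Proof. by rewrite /orth => hs ht; rewrite minkDl hs ht addr0. Qed.
Lemma orthZ k s : orth s -> orth (k *: s).
Proof. by rewrite /orth => hs; rewrite minkZl hs mulr0. Qed.
Lemma orthN s : orth s -> orth (- s).
Proof. by rewrite -scaleN1r; exact: orthZ. Qed.
Lemma orthB s t : orth s -> orth t -> orth (s - t).
Proof. by move=> hs ht; apply/orthD/orthN. Qed.
Hint Resolve orth0 orthD orthZ orthN orthB : core.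

Lemma orthC s : orth s -> '[w, s] = 0.
Proof. by rewrite minkC. Qed.

Lemma comb_inj x y s t : orth s -> orth t -> x *: w + s = y *: w + t ->
  x = y /\ s = t.
Proof.
move=> hs ht h; have exy : x = y.
  have := congr1 (fun u : V => '[u, w]) h; rewrite !minkE hs ht !addr0.
  by apply: mulIf; rewrite gt_eqF.
by split=> //; move: h; rewrite exy => /addrI.
Qed.

Lemma pt_inj x y s t : orth s -> orth t -> pt x s = pt y t -> x = y /\ s = t.
Proof. by move=> hs ht; rewrite /pt -!addrA => /addrI; exact: comb_inj. Qed.

Lemma tm_inj : injective tm.
Proof. by move=> x y /ev_inj; rewrite !tmE => /(pt_inj orth0 orth0)[]. Qed.

Lemma ptP p : exists x s, orth s /\ p = pt x s.
Proof.
have [x [s [hs hd]]] := decompose (p - o) W; exists x, s; split => //.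
by rewrite /pt -addrA -hd addrC subrK.
Qed.

Lemma on_plP s p : on (pl s) p <-> exists x, p = pt x s.
Proof.
split=> [/on_part-/(_ fw)[x ->]|[x ->]]; first by exists x; rewrite /pt; vring.
by apply/on_part => //; exists x; rewrite /pt; vring.
Qed.

Lemma T_plP s p : ⟦T (pl s) (ev p)⟧ <-> exists x, p = pt x s.
Proof. exact: on_plP. Qed.

Lemma on_pt x s : on (pl s) (pt x s).
Proof. by apply/on_plP; exists x. Qed.

Lemma on_tm x : on a (o + x *: w).
Proof. exact: on_shift. Qed.

Lemma pl_inj s t : orth s -> orth t -> pl s = pl t -> s = t.
Proof.
move=> hs ht h; have := on_pt 0 s; rewrite h => /on_plP[x].
by move/(pt_inj hs ht) => [].
Qed.

Lemma placeP q b : ⟦motionless b (part q w)⟧ <-> exists s, orth s /\ b = pl s.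
Proof.
split=> [/(motionlessP _ _ fw)[r ->]|[s [_ ->]]]; last first.
  by apply/motionlessP => //; exists (o + s).
have [x [s [hs ->]]] := ptP r; exists s; split => //.
by apply/esym/part_shift => //; exact: on_pt.
Qed.

Lemma motionless_pl s q : ⟦motionless (pl s) (part q w)⟧.
Proof. by apply/motionlessP => //; exists (o + s). Qed.

Lemma TimeP e : ⟦Time a e⟧ <-> exists x, e = tm x.
Proof.
split=> [[/EvP[p ->] h]|[x ->]].
  by have /on_part-/(_ fw)[x ->] : on a p := h; exists x.
by split; [exact: Ev_ev | exact: on_tm].
Qed.

Lemma Time_tm x : ⟦Time a (tm x)⟧.
Proof. by apply/TimeP; exists x. Qed.

Lemma mink_comb x y s t : orth s -> orth t ->
  '[x *: w + s, y *: w + t] = x * y * '[w, w] + '[s, t].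
Proof.
move=> hs ht; rewrite !minkE (orthC ht) hs; ring.
Qed.

(** The light cone in the rest frame: in the time y - x light covers the distance
    (y - x) |w|. *)
Lemma linkP x y s t : orth s -> orth t ->
  nullfut (pt y t - pt x s) <->
  x <= y /\ (y - x) ^+ 2 * '[w, w] = - '[t - s, t - s].
Proof.
move=> hs ht; have -> : pt y t - pt x s = (y - x) *: w + (t - s).
  by rewrite /pt; vring.
have hts : orth (t - s) by auto.
rewrite /nullfut mink_comb // -expr2; split.
  move=> [h0 h]; split; last by lra.
  have hc : 0 <= '[(y - x) *: w + (t - s), (y - x) *: w + (t - s)].
    by rewrite mink_comb // -expr2 h.
  move: h0; rewrite (causal_future fw hc) minkDl hts minkZl addr0.
  by rewrite pmulr_lge0 // subr_ge0.
move=> [h0 h]; have e0 : (y - x) ^+ 2 * '[w, w] + '[t - s, t - s] = 0 by lra.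
split=> //.
have hc : 0 <= '[(y - x) *: w + (t - s), (y - x) *: w + (t - s)].
  by rewrite mink_comb // -expr2 e0.
rewrite (causal_future fw hc) minkDl hts minkZl addr0.
by rewrite pmulr_lge0 // subr_ge0.
Qed.

Lemma orth_ge0 s : orth s -> 0 <= - '[s, s].
Proof. by move=> hs; rewrite oppr_ge0; apply: (orth_npos W). Qed.

Lemma len_ex s : orth s -> exists2 r, 0 <= r & r ^+ 2 * '[w, w] = - '[s, s].
Proof.
move=> hs; have [r r0 hr] : exists2 r, 0 <= r & r ^+ 2 = - '[s, s] / '[w, w].
  by apply: sqrt_ex; rewrite // divr_ge0 ?orth_ge0 // ltW.
by exists r => //; rewrite hr divfK // gt_eqF.
Qed.

Lemma sphere_ex (c : V) k : 0 <= k ->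
  exists s, [/\ orth s, '[s, c] = 0 & - '[s, s] = k ^+ 2 * '[w, w]].
Proof.
move=> hk; have [|s [hs hc h]] := orth_sq_ex sqrtF c W (_ : 0 <= k ^+ 2 * '[w, w]).
  by rewrite mulr_ge0 ?sqr_ge0 // ltW.
by exists s; rewrite h opprK.
Qed.

Lemma link_ex x y s t : orth s -> orth t -> x <= y ->
  (y - x) ^+ 2 * '[w, w] = - '[t - s, t - s] ->
  exists g, ⟦sent (ev (pt x s)) g (ev (pt y t))⟧.
Proof. by move=> hs ht h1 h2; apply/sent_ex/linkP. Qed.

(** The two signals to p, and the two from it, take the same time because they
    connect p with the same place; so p lies halfway between the events of
    emission and return, as q does.  Conversely, simultaneous events are
    equally far from the place halfway between them. *)
Lemma simP p q : ⟦sim a (ev p) (ev q)⟧ <-> orth (p - q).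
Proof.
split.
  move=> [_ [/placeP[s [hs ->]]]].
  move=> [_ [/EvP[p1 ->] [_ [/EvP[p2 ->] [/T_plP[x1 ->] [/T_plP[x2 ->]]]]]]].
  move=> [s1 [s2 [s3 [s4 [/sent_null + [/sent_null + [/sent_null + /sent_null]]]]]]].
  have [y [t [ht ->]]] := ptP p; have [z [r [hr ->]]] := ptP q.
  move=> /linkP[//|//|l1 e1] /linkP[//|//|l2 e2].
  move=> /linkP[//|//|l3 e3] /linkP[//|//|l4 e4].
  suff -> : y = z by have -> : pt z t - pt z r = t - r; [rewrite /pt; vring | auto].
  have half (v : F) : x1 <= v -> v <= x2 ->
      (v - x1) ^+ 2 * '[w, w] = (x2 - v) ^+ 2 * '[w, w] -> v - x1 = x2 - v.
    move=> h1 h2 /mulIf h; apply: sqr_inj; rewrite ?subr_ge0 //.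
    by apply: h; rewrite gt_eqF.
  have : y - x1 = x2 - y.
    by apply: half => //; rewrite e1 e3 minkBB.
  have : z - x1 = x2 - z.
    by apply: half => //; rewrite e2 e4 minkBB.
  lra.
have [y [t [ht ->]]] := ptP p; have [z [r [hr ->]]] := ptP q.
have -> : pt y t - pt z r = (y - z) *: w + (t - r) by rewrite /pt; vring.
rewrite /orth minkDl (orthB ht hr) addr0 minkZl => /eqP.
rewrite mulf_eq0 (gt_eqF W) orbF subr_eq0 => /eqP <-.
pose m := 2^-1 *: (t + r).
have hm : orth m := orthZ _ (orthD ht hr).
have [k k0 hk] := len_ex (orthB ht hm).
have er : - '[r - m, r - m] = - '[t - m, t - m].
  have -> : r - m = - (t - m) by rewrite /m; vfield.
  by rewrite minkNl minkNr opprK.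
exists (pl m); split; first exact: motionless_pl.
exists (ev (pt (y - k) m)); split; first exact: Ev_ev.
exists (ev (pt (y + k) m)); split; first exact: Ev_ev.
split; first exact: on_pt.
split; first exact: on_pt.
have sw (v : V) : '[m - v, m - v] = '[v - m, v - m] := minkBB m v.
have e1 : y - (y - k) = k by ring.
have e2 : y + k - y = k by ring.
have l1 : y - k <= y by lra.
have l2 : y <= y + k by lra.
have [s1 h1] : exists g, ⟦sent (ev (pt (y - k) m)) g (ev (pt y t))⟧.
  by apply: link_ex => //; rewrite e1.
have [s2 h2] : exists g, ⟦sent (ev (pt (y - k) m)) g (ev (pt y r))⟧.
  by apply: link_ex => //; rewrite e1 er.
have [s3 h3] : exists g, ⟦sent (ev (pt y t)) g (ev (pt (y + k) m))⟧.
  by apply: link_ex => //; rewrite e2 sw.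
have [s4 h4] : exists g, ⟦sent (ev (pt y r)) g (ev (pt (y + k) m))⟧.
  by apply: link_ex => //; rewrite e2 sw er.
by exists s1, s2, s3, s4.
Qed.

Lemma prec_tm x y : ⟦prec (tm x) (tm y)⟧ <-> x <= y.
Proof.
rewrite precP; have -> : o + y *: w - (o + x *: w) = (y - x) *: w by vring.
rewrite !minkE mulrA -expr2 mxE pmulr_lge0 ?subr_ge0; last by case/andP: fw.
by split=> [[]//|h]; split=> //; rewrite mulr_ge0 ?sqr_ge0 // ltW.
Qed.

Lemma later_tm x y : ⟦later (tm x) (tm y)⟧ <-> y < x.
Proof.
split=> [[/prec_tm h n]|h].
  by rewrite lt_neqAle h andbT; apply/eqP => e; apply: n; rewrite e.
split; first exact/prec_tm/ltW.
by move=> /tm_inj e; rewrite e ltxx in h.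
Qed.

(** A signal to another place and back takes twice the distance of that place, so
    the place a' determines the length of both time intervals. *)
Lemma Edt_forward_tm x1 x2 x3 x4 : x1 <= x3 ->
  ⟦Edt_forward a (tm x1) (tm x2) (tm x3) (tm x4)⟧ <-> x3 - x1 = x4 - x2.
Proof.
move=> h13; rewrite /tm !tmE; split.
  move=> [_ [/placeP[s [hs ->]]]].
  move=> [_ [/EvP[p1 ->] [_ [/EvP[p2 ->] [/T_plP[y ->] [/T_plP[z ->]]]]]]].
  move=> [s1 [s2 [s3 [s4 [/sent_null + [/sent_null + [/sent_null + /sent_null]]]]]]].
  move=> /linkP[//|//|l1 e1] /linkP[//|//|l2 e2].
  move=> /linkP[//|//|l3 e3] /linkP[//|//|l4 e4].
  have [r r0 hr] := len_ex hs.
  have half (u v : F) : u <= v -> (v - u) ^+ 2 * '[w, w] = - '[s, s] -> v - u = r.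
    move=> h1; rewrite -hr => /mulIf h2; apply: sqr_inj; rewrite ?subr_ge0 //.
    by apply: h2; rewrite gt_eqF.
  rewrite !subr0 in e1 e3; rewrite !sub0r !minkE opprK in e2 e4.
  have := half _ _ l1 e1; have := half _ _ l2 e2.
  have := half _ _ l3 e3; have := half _ _ l4 e4; lra.
move=> h; pose k := (x3 - x1) / 2.
have k0 : 0 <= k by rewrite /k; lra.
have [s [hs _ hk]] := sphere_ex w k0.
exists (pl s); split; first exact: motionless_pl.
exists (ev (pt (x1 + k) s)); split; first exact: Ev_ev.
exists (ev (pt (x2 + k) s)); split; first exact: Ev_ev.
split; first exact: on_pt.
split; first exact: on_pt.
have ek (x : F) : x + k - x = k by ring.
have e3 : x3 - (x1 + k) = k by rewrite /k; field.
have e4 : x4 - (x2 + k) = k by rewrite /k h; lra.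
have [s1 h1] : exists g, ⟦sent (ev (pt x1 0)) g (ev (pt (x1 + k) s))⟧.
  by apply: link_ex => //; rewrite ?subr0 ?ek //; lra.
have [s2 h2] : exists g, ⟦sent (ev (pt x2 0)) g (ev (pt (x2 + k) s))⟧.
  by apply: link_ex => //; rewrite ?subr0 ?ek //; lra.
have [s3 h3] : exists g, ⟦sent (ev (pt (x1 + k) s)) g (ev (pt x3 0))⟧.
  by apply: link_ex => //; rewrite ?sub0r ?minkE ?opprK ?e3 //; lra.
have [s4 h4] : exists g, ⟦sent (ev (pt (x2 + k) s)) g (ev (pt x4 0))⟧.
  by apply: link_ex => //; rewrite ?sub0r ?minkE ?opprK ?e4 //; lra.
by exists s1, s2, s3, s4.
Qed.

Lemma Edt_tm x1 x2 x3 x4 :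
  ⟦Edt a (tm x1) (tm x2) (tm x3) (tm x4)⟧ <-> x3 - x1 = x4 - x2.
Proof.
split.
  case=> -[/prec_tm h]; first by move/(Edt_forward_tm _ _ h).
  by move/(Edt_forward_tm _ _ h); lra.
move=> h; have [h1|h1] := leP x1 x3.
  by left; split; [exact/prec_tm | exact/(Edt_forward_tm _ _ h1)].
by right; split; [exact/prec_tm/ltW | apply/(Edt_forward_tm _ _ (ltW h1)); lra].
Qed.

Lemma add_tm x y z : ⟦Defs.add (tm x) (tm y) (tm z) a (ev o)⟧ <-> x = y + z.
Proof.
rewrite -tm0; split=> [[_ [_ [_ /Edt_tm]]]|h]; first by lra.
by do 3![split; first exact: Time_tm]; apply/Edt_tm; lra.
Qed.

Lemma opp_tm x y : ⟦Defs.opp (tm x) (tm y) a (ev o)⟧ <-> x = - y.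
Proof. by rewrite /Defs.opp -[X in Defs.add X]tm0 add_tm; split; lra. Qed.

Lemma add_args e1 e2 e3 : ⟦Defs.add e1 e2 e3 a (ev o)⟧ ->
  exists x y, [/\ e1 = tm (x + y), e2 = tm x & e3 = tm y].
Proof.
move=> h; have [/TimeP[z e1E] [/TimeP[x e2E] [/TimeP[y e3E] _]]] := h.
exists x, y; split=> //; move: h; rewrite e1E e2E e3E => /add_tm ->.
by [].
Qed.

End RestFrame.

(** * Linear dependence of two vectors *)

Section Dependence.
Variables (F : fieldType) (n : nat).
Implicit Types (u v e : 'rV[F]_n) (k x y : F).

Definition dep u v := u = 0 \/ exists k, v = k *: u.

Lemma dep_lin x y u v : x *: u + y *: v = 0 -> (x != 0) || (y != 0) -> dep u v.
Proof.
have [->|y0] := eqVneq y 0.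
  rewrite scale0r addr0 orbF => /eqP; rewrite scaler_eq0 => /orP[->//|/eqP -> _].
  by left.
move=> h _; right; exists (- (y^-1 * x)).
rewrite scaleNr -scalerA -[LHS]scale1r -(mulVf y0) -scalerA -scalerN.
by congr (_ *: _); apply/eqP; rewrite -addr_eq0 addrC h.
Qed.

Lemma ndep_lin x y u v : ~ dep u v -> x *: u + y *: v = 0 -> x = 0 /\ y = 0.
Proof.
move=> nd h; have [x0|x0] := eqVneq x 0; have [y0|y0] := eqVneq y 0 => //;
  by case: nd; apply: dep_lin h _; rewrite ?x0 ?y0 // orbT.
Qed.

Lemma depP u v : dep u v ->
  exists x y, ((x != 0) || (y != 0)) /\ x *: u + y *: v = 0.
Proof.
case=> [->|[k ->]]; first by exists 1, 0; rewrite oner_eq0 scaler0 scale0r addr0.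
by exists (- k), 1; rewrite oner_eq0 orbT scaleNr scale1r addNr.
Qed.

Lemma dep_sym u v : dep u v -> dep v u.
Proof.
move=> /depP[x [y [h e]]]; apply: (@dep_lin y x); first by rewrite addrC.
by rewrite orbC.
Qed.

Lemma dep0 u : dep u 0. Proof. by right; exists 0; rewrite scale0r. Qed.

Lemma depB u v v' : dep u v -> dep u v' -> dep u (v - v').
Proof.
move=> [u0|[k ->]]; first by left.
case=> [u0|[k' ->]]; first by left.
by right; exists (k - k'); rewrite scalerBl.
Qed.

Lemma scale_eq k u v : k != 0 -> k *: u = v -> u = k^-1 *: v.
Proof. by move=> k0 <-; rewrite scalerA mulVf // scale1r. Qed.

End Dependence.

(** * Space in the rest frame of a particle *)

Section RestSpace.
Variable F : realFieldType.
Hypothesis sqrtF : euclidean F.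
Local Notation V := 'rV[F]_4.
Local Notation M := (stdModel F).
Local Notation "⟦ phi ⟧" := (holds (@sig_interp M) phi).
Local Notation "'[ u , v ]" := (mink u v).
Implicit Types (p q r d v s t : V) (b c : Par M) (e g : Sig M) (k x y z : F).
Variables o w : V.
Hypothesis fw : fut w.
Local Notation a := (part o w).
Local Notation tm := (clock_event o w).
Local Notation pt := (spacetime_pt o w).
Local Notation pl := (place o w).
Local Notation orth := (orthogonal w).
Let W := fut_gt0 fw.
Hint Resolve orth0 orthD orthZ orthN orthB : core.

(** If the sum of two future-directed light-like vectors is light-like, then they
    are proportional, and so are their spatial parts. *)
Lemma between_pl s1 s2 s3 : orth s1 -> orth s2 -> orth s3 ->
  ⟦between (pl s1) (pl s2) (pl s3)⟧ <->
  exists k, [/\ 0 <= k, k <= 1 & s2 = s1 + k *: (s3 - s1)].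
Proof.
move=> o1 o2 o3; split.
  move=> [_ [/EvP[p1 ->] [_ [/EvP[p2 ->] [_ [/EvP[p3 ->]]]]]]].
  move=> [/(T_plP _ fw)[x ->] [/(T_plP _ fw)[y ->] [/(T_plP _ fw)[z ->]]]].
  move=> [g1 [g2 [g3 [/sent_null + [/sent_null + /sent_null]]]]].
  move=> /(linkP _ fw)[//|//|l1 e1] /(linkP _ fw)[//|//|l2 e2].
  move=> /(linkP _ fw)[//|//|l3 e3].
  pose u := y - x; pose v := z - y; pose S := s2 - s1; pose S' := s3 - s2.
  have eS : s3 - s1 = S + S' by rewrite /S /S'; vring.
  have ev' : z - x = u + v by rewrite /u /v; ring.
  have u0 : 0 <= u by rewrite /u subr_ge0.
  have v0 : 0 <= v by rewrite /v subr_ge0.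
  have oS : orth S by exact: orthB.
  have oS' : orth S' by exact: orthB.
  rewrite -/u -/S in e1; rewrite -/v -/S' in e2; rewrite eS ev' in e3.
  have eq0 : v *: S - u *: S' = 0.
    apply: (orth_eq0 W); first by apply: orthB; exact: orthZ.
    move: e1 e2 e3; clearbody S S' u v; rewrite !minkE (minkC S' S) => e1 e2 e3.
    have e4 : '[S, S'] = - (u * v * '[w, w]) by lra.
    have e5 : '[S, S] = - (u ^+ 2 * '[w, w]) by lra.
    have e6 : '[S', S'] = - (v ^+ 2 * '[w, w]) by lra.
    rewrite e4 e5 e6; ring.
  have [uv0|uv0] := eqVneq (u + v) 0.
    have uz : u = 0 by lra.
    exists 0; split=> //; rewrite scale0r addr0.
    have : S = 0 by apply: (orth_eq0 W) => //; rewrite uz in e1; lra.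
    by move/subr0_eq.
  have uvp : 0 < u + v by rewrite lt_neqAle eq_sym uv0 addr_ge0.
  exists (u / (u + v)); split.
  - by rewrite divr_ge0 // ltW.
  - by rewrite ler_pdivrMr // mul1r lerDl.
  rewrite eS; apply/eqP; rewrite -subr_eq0.
  have -> : s2 - (s1 + (u / (u + v)) *: (S + S')) =
      (u + v)^-1 *: (v *: S - u *: S').
    by rewrite -[s2](subrK s1) -/S; clearbody S S' u v; vfield.
  by rewrite eq0 scaler0.
move=> [k [k0 k1 e]]; have [r r0 hr] := len_ex sqrtF fw (orthB o3 o1).
exists (ev (pt 0 s1)); split; first exact: Ev_ev.
exists (ev (pt (k * r) s2)); split; first exact: Ev_ev.
exists (ev (pt r s3)); split; first exact: Ev_ev.
do 3![split; first exact: on_pt].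
have [g1 h1] : exists g, ⟦sent (ev (pt 0 s1)) g (ev (pt (k * r) s2))⟧.
  apply: link_ex => //; first by rewrite mulr_ge0.
  have -> : s2 - s1 = k *: (s3 - s1) by rewrite e; vring.
  by rewrite minkZl minkZr subr0 exprMn -mulrA hr; ring.
have [g2 h2] : exists g, ⟦sent (ev (pt (k * r) s2)) g (ev (pt r s3))⟧.
  apply: link_ex => //; first by rewrite ler_piMl.
  have -> : s3 - s2 = (1 - k) *: (s3 - s1) by rewrite e; vring.
  have -> : r - k * r = (1 - k) * r by ring.
  by rewrite minkZl minkZr exprMn -mulrA hr; ring.
have [g3 h3] : exists g, ⟦sent (ev (pt 0 s1)) g (ev (pt r s3))⟧.
  by apply: link_ex => //; rewrite subr0.
by exists g1, g2, g3.
Qed.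

(** Of three collinear points one is weakly between the other two; the position
    of s3 on the line through s1 and s2 tells which one. *)
Lemma Col_pl s1 s2 s3 : orth s1 -> orth s2 -> orth s3 ->
  ⟦Col (pl s1) (pl s2) (pl s3)⟧ <-> dep (s2 - s1) (s3 - s1).
Proof.
move=> o1 o2 o3; split.
  have nz (k : F) : (1 - k != 0) || (k != 0).
    by have [->|] := eqVneq k 0; rewrite ?subr0 ?oner_eq0 ?orbT.
  case=> [|[|[|[|[|]]]]] /between_pl-[] // k [_ _ e].
  - by apply: (@dep_lin _ _ 1 (- k)); rewrite ?oner_eq0 // e; vring.
  - by apply: (@dep_lin _ _ (- k) 1); rewrite ?oner_eq0 ?orbT // e; vring.
  - by apply: (@dep_lin _ _ (1 - k) k); rewrite ?nz // e; vring.
  - apply: (@dep_lin _ _ (1 - k) (- 1)); last by rewrite oppr_eq0 oner_eq0 orbT.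
    by rewrite e; vring.
  - by apply: (@dep_lin _ _ k (1 - k)); rewrite 1?orbC ?nz // e; vring.
  - by apply: (@dep_lin _ _ (- 1) (1 - k)); rewrite ?oppr_eq0 ?oner_eq0 // e; vring.
case=> [/subr0_eq e|[k e]].
  by left; apply/between_pl => //; exists 0; rewrite lexx ler01 e; split=> //; vring.
have e3 : s3 = s1 + k *: (s2 - s1) by rewrite -e; vring.
have [k0|k0] := ltP k 0.
  do 4!right; left; apply/between_pl => //; exists (- k / (1 - k)).
  have k1 : 0 < 1 - k by lra.
  split; [by rewrite divr_ge0 ?ltW // oppr_gt0 | by rewrite ler_pdivrMr //; lra |].
  by rewrite e3; vfield; rewrite gt_eqF.
have [k1|k1] := leP k 1.
  by right; left; apply/between_pl => //; exists k.
left; apply/between_pl => //; exists k^-1.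
split; [by rewrite invr_ge0; lra| by rewrite invf_le1 ?ltW //; lra|].
by rewrite e3; vfield; rewrite gt_eqF // (lt_trans ltr01).
Qed.

Lemma eqpP s t : orth s -> orth t -> ⟦Defs.eqp (pl s) (pl t)⟧ <-> s = t.
Proof. by move=> hs ht; split=> [/(pl_inj fw hs ht)|->]. Qed.

Lemma meetP s1 s2 s3 s4 : orth s1 -> orth s2 -> orth s3 -> orth s4 ->
  ⟦(∃P c, motionless c (pl s1) ∧ Col (pl s1) (pl s2) c ∧ Col (pl s3) (pl s4) c)%FO⟧
  <-> exists t, [/\ orth t, dep (s2 - s1) (t - s1) & dep (s4 - s3) (t - s3)].
Proof.
move=> o1 o2 o3 o4; split.
  move=> [_ [/(placeP o fw)[t [ht ->]] [/Col_pl-/(_ o1 o2 ht)h1]]].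
  by move=> /Col_pl-/(_ o3 o4 ht)h2; exists t.
move=> [t [ht h1 h2]]; exists (pl t); split; first exact: motionless_pl.
by split; apply/Col_pl.
Qed.

(** Let u = s2 - s1, v = s4 - s3 and e = s3 - s1.  If u and v are independent, then
    a common point of two opposite joining lines makes e a combination of u and v,
    and then the lines through s1, s2 and s3, s4 meet, which is excluded.
    Conversely, let v = k u and let the points be not on one line.  The lines s1 s4
    and s2 s3 meet, except for k = -1, when the lines s1 s3 and s2 s4 do. *)
Lemma pa_pl s1 s2 s3 s4 : orth s1 -> orth s2 -> orth s3 -> orth s4 ->
  ⟦pa (pl s1) (pl s2) (pl s3) (pl s4)⟧ <-> dep (s2 - s1) (s4 - s3).
Proof.
move=> o1 o2 o3 o4; set u := s2 - s1; set v := s4 - s3; pose e := s3 - s1.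
have ou : orth u by exact: orthB.
have ov : orth v by exact: orthB.
have oe : orth e by exact: orthB.
have e2 : s2 = s1 + u by rewrite /u; vring.
have e3 : s3 = s1 + e by rewrite /e; vring.
have e4 : s4 = s1 + e + v by rewrite /e /v; vring.
split.
  case=> [/eqpP-h|[/eqpP-h|[[/Col_pl-h1 /Col_pl-h2]|]]].
  - by left; rewrite /u -h // subrr.
  - by rewrite /v h // subrr; exact: dep0.
  - have -> : v = (s4 - s1) - (s3 - s1) by rewrite /v; vring.
    by apply: depB; auto.
  move=> [/meetP nm [_ [/(placeP o fw)[t [ht ->]] h]]].
  apply: contrapT => nd; apply: nm => //; rewrite -/u -/v.
  suff [x [y hxy]] : exists x y, e = x *: u + y *: v.
    exists (s1 + x *: u); split; first by auto.
      by right; exists x; vring.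
    by right; exists (- y); rewrite e3 hxy; vring.
  have solve x y z : x *: e = y *: u + z *: v -> (y != 0) || (z != 0) ->
      exists x y, e = x *: u + y *: v.
    move=> h1 h2; have [x0|x0] := eqVneq x 0.
      rewrite x0 scale0r in h1; have [y0 z0] := ndep_lin nd (esym h1).
      by rewrite y0 z0 eqxx in h2.
    exists (y / x), (z / x); rewrite (scale_eq x0 h1).
    by vring.
  have nz (k l : F) : k = l -> (1 - l != 0) || (k != 0).
    by move->; have [->|] := eqVneq l 0; rewrite ?subr0 ?oner_eq0 ?orbT.
  case: h => [[/Col_pl-h1 /Col_pl-h2]|[/Col_pl-h1 /Col_pl-h2]].
    have {h1} : dep (s4 - s1) (t - s1) by auto.
    case=> [/subr0_eq h|[k hk]].
      exists 0, (-1); move: h; rewrite e4 -addrA -[RHS]addr0 => /addrI/eqP.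
      by rewrite addr_eq0 => /eqP ->; vring.
    have {h2} : dep (s3 - s2) (t - s2) by auto.
    case=> [/subr0_eq h|[l hl]].
      by exists 1, 0; rewrite /e h e2; vring.
    have h : (k - l) *: e = (1 - l) *: u + (- k) *: v.
      apply/eqP; rewrite -subr_eq0; apply/eqP.
      transitivity ((k *: (s4 - s1) - (t - s1)) - (l *: (s3 - s2) - (t - s2))).
        by rewrite e4 e3 e2; vring.
      by rewrite hk hl !subrr.
    have [ekl|nkl] := eqVneq k l.
      by apply: (solve _ _ _ h); rewrite oppr_eq0; exact: nz.
    exists ((1 - l) / (k - l)), (- k / (k - l)).
    rewrite (scale_eq _ h) ?subr_eq0 //.
    by vring.
  have {h1} : dep (s3 - s1) (t - s1) by auto.
  case=> [h|[k hk]].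
    by exists 0, 0; rewrite /e h; vring.
  have {h2} : dep (s4 - s2) (t - s2) by auto.
  case=> [/subr0_eq h|[l hl]].
    exists 1, (-1); move: h; rewrite e4 e2 -addrA => /addrI <-; vring.
  have h : (k - l) *: e = (1 - l) *: u + l *: v.
    apply/eqP; rewrite -subr_eq0; apply/eqP.
    transitivity ((k *: (s3 - s1) - (t - s1)) - (l *: (s4 - s2) - (t - s2))).
      by rewrite e4 e3 e2; vring.
    by rewrite hk hl !subrr.
  have [ekl|nkl] := eqVneq k l.
    by apply: (solve _ _ _ h); exact: nz.
  exists ((1 - l) / (k - l)), (l / (k - l)).
  rewrite (scale_eq _ h) ?subr_eq0 //.
  by vring.
case=> [/subr0_eq h|[k hk]]; first by left; apply/eqpP.
have [u0|u0] := eqVneq u 0; first by left; apply/eqpP => //; rewrite e2 u0 addr0.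
have [k0|k0] := eqVneq k 0.
  by right; left; apply/eqpP => //; rewrite e3 e4 hk k0 scale0r addr0.
have [[/eqP|[l hl]]|ne] := pselect (dep u e); first by rewrite (negbTE u0).
  right; right; left; split; apply/Col_pl => //; rewrite -/u; right.
    by exists l; rewrite e3 hl; vring.
  by exists (l + k); rewrite e4 hk hl; vring.
do 3!right; split.
  move=> /meetP[] // t [ht [/eqP|[x hx]]]; first by rewrite -/u (negbTE u0).
  rewrite -/v hk; case=> [/eqP|[y hy]].
    by rewrite scaler_eq0 (negbTE k0) (negbTE u0).
  case: ne; right; exists (x - y * k).
  transitivity ((t - s1) - (t - s3)); first by rewrite /e; vring.
  by rewrite hx hy; vring.
have [k1|k1] := eqVneq k (-1).
  have oc : orth (s1 + 2^-1 *: e) := orthD o1 (orthZ _ oe).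
  exists (pl (s1 + 2^-1 *: e)); split; first exact: motionless_pl.
  right; split; apply/Col_pl => //; right; exists 2^-1.
    by rewrite e3; vring.
  by rewrite e4 e2 hk k1; vfield.
have k1' : 1 + k != 0 by rewrite addrC -[1]opprK subr_eq0.
have oc : orth (s1 + (1 + k)^-1 *: (e + k *: u)).
  exact: orthD o1 (orthZ _ (orthD oe (orthZ _ ou))).
exists (pl (s1 + (1 + k)^-1 *: (e + k *: u))); split; first exact: motionless_pl.
left; split; apply/Col_pl => //; right; exists (1 + k)^-1.
  by rewrite e4 hk; vring.
by rewrite e3 e2; vfield.
Qed.

Lemma parallelogram_pl s1 s2 s3 s4 : orth s1 -> orth s2 -> orth s3 -> orth s4 ->
  ⟦parallelogram (pl s1) (pl s2) (pl s3) (pl s4)⟧ <->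
  ~ dep (s2 - s1) (s3 - s1) /\ s4 - s3 = s2 - s1.
Proof.
move=> o1 o2 o3 o4; rewrite /parallelogram; split.
  move=> [/Col_pl nd [/pa_pl h1 /pa_pl h2]].
  have {}nd : ~ dep (s2 - s1) (s3 - s1) by auto.
  split=> //.
  have : dep (s2 - s1) (s4 - s3) by auto.
  case=> [h|[x hx]]; first by case: nd; left.
  have : dep (s3 - s1) (s4 - s2) by auto.
  case=> [h|[y hy]]; first by case: nd; rewrite h; exact: dep0.
  have [|hx1 _] := @ndep_lin _ _ (x - 1) (1 - y) _ _ nd.
    transitivity (x *: (s2 - s1) - y *: (s3 - s1) - (s2 - s1) + (s3 - s1)).
      by vring.
    by rewrite -hx -hy; vring.
  by rewrite hx (subr0_eq hx1) scale1r.
move=> [nd h]; split; first by move/Col_pl => hd; apply: nd; auto.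
split; apply/pa_pl => //; first by right; exists 1; rewrite scale1r.
right; exists 1; rewrite scale1r; apply/eqP; rewrite -subr_eq0; apply/eqP.
transitivity ((s4 - s3) - (s2 - s1)); first by vring.
by rewrite h subrr.
Qed.

(** A vector orthogonal to s is independent of it, as the form is definite. *)
Lemma offline_ex s : s != 0 -> orth s -> exists2 t, orth t & ~ dep s t.
Proof.
move=> s0 hs; have [t [ht hst hN]] := sphere_ex sqrtF fw s ler01.
exists t => //; case=> [/eqP|[k hk]]; first by rewrite (negbTE s0).
have /eqP : k * '[s, s] = 0 by rewrite -minkZl -hk.
rewrite mulf_eq0 (lt_eqF (orth_neg W hs s0)) orbF => /eqP k0.
move: hN; rewrite hk k0 scale0r mink0l oppr0 expr1n mul1r => h0.
by have := W; rewrite -h0 ltxx.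
Qed.

(** A nondegenerate parallelogram determines its fourth vertex.  When s3 is on the
    line through s1 and s2, a vector t off that line gives the intermediate pair
    s3 + t, s3 + t + (s2 - s1). *)
Lemma translated_pl s1 s2 s3 s4 : orth s1 -> orth s2 -> orth s3 -> orth s4 ->
  ⟦translated (pl s1) (pl s2) (pl s3) (pl s4)⟧ <-> s4 - s3 = s2 - s1.
Proof.
move=> o1 o2 o3 o4; split.
  case=> [[/eqpP h1 /eqpP h2]|[/parallelogram_pl h|]].
  - by rewrite h1 // h2 // !subrr.
  - by have [] : ~ dep (s2 - s1) (s3 - s1) /\ s4 - s3 = s2 - s1 by auto.
  move=> [_ [_ [_ [_ [/(placeP o fw)[t1 [h1 ->]] [/(placeP o fw)[t2 [h2 ->]]]]]]]].
  move=> [/parallelogram_pl h3 /parallelogram_pl h4].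
  by have [//|//|//|//|_ <-] := h3; have [//|//|//|//|_ <-] := h4.
move=> h; have [e12|n12] := eqVneq s1 s2.
  left; split; apply/eqpP => //; apply/esym/subr0_eq; rewrite h e12; exact: subrr.
have [d|nd] := pselect (dep (s2 - s1) (s3 - s1)); last first.
  by right; left; apply/parallelogram_pl.
right; right; split; first by move/eqpP => e; rewrite e ?eqxx // in n12.
split; first exact/Col_pl.
have u0 : s2 - s1 != 0 by rewrite subr_eq0 eq_sym.
have [t ht nt] := offline_ex u0 (orthB o2 o1).
have e1 : s3 + t + (s2 - s1) - (s3 + t) = s2 - s1 by vring.
exists (pl (s3 + t)), (pl (s3 + t + (s2 - s1))).
split; first exact: motionless_pl.
split; first exact: motionless_pl.
split; apply/parallelogram_pl; auto; rewrite e1; split=> //.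
  move=> hd; apply: nt; have -> : t = (s3 + t - s1) - (s3 - s1) by vring.
  exact: depB.
have -> : s3 - (s3 + t) = 0 - t by vring.
move=> hd; apply: nt; have -> : t = 0 - (0 - t) by vring.
by apply: depB => //; exact: dep0.
Qed.

Lemma translated_origin s1 s2 t : orth s1 -> orth s2 -> orth t ->
  ⟦translated (pl s1) (pl s2) a (pl t)⟧ <-> t = s2 - s1.
Proof. by move=> o1 o2 ot; rewrite -[a]pl0 translated_pl // subr0. Qed.

Lemma dist0_pl s e : orth s ->
  ⟦dist0 a (ev o) (pl s) e⟧ <->
  exists x, [/\ e = tm x, 0 <= x & x ^+ 2 * '[w, w] = - '[s, s]].
Proof.
move=> hs; have ep : o = pt 0 0 by rewrite /spacetime_pt scale0r !addr0.
split.
  move=> [/(TimeP _ fw)[x ->] [_ [/EvP[p ->] [/(simP sqrtF _ fw)h0]]]].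
  move=> [/(T_plP _ fw)[y hy] [g /sent_null]]; move: h0; rewrite hy.
  have -> : pt y s - o = y *: w + s by rewrite /spacetime_pt; vring.
  rewrite /orthogonal minkDl hs addr0 minkZl => /eqP.
  rewrite mulf_eq0 (gt_eqF W) orbF => /eqP ->.
  rewrite tmE => /(linkP _ fw)[] //.
  rewrite subr0 sub0r minkNl minkNr opprK => h1 h2.
  by exists x.
move=> [x [-> x0 hx]]; split; first exact: Time_tm.
exists (ev (pt 0 s)); split; first exact: Ev_ev.
split.
  apply/simP => //; have -> : pt 0 s - o = s by rewrite /spacetime_pt; vring.
  by [].
split; first exact: on_pt.
rewrite /clock_event tmE; apply: link_ex => //.
by rewrite subr0 sub0r minkNl minkNr opprK.
Qed.

Lemma dist_pl s1 s2 e : orth s1 -> orth s2 ->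
  ⟦dist a (ev o) (pl s1) (pl s2) e⟧ <->
  exists x, [/\ e = tm x, 0 <= x & x ^+ 2 * '[w, w] = - '[s2 - s1, s2 - s1]].
Proof.
move=> o1 o2; split.
  move=> [_ [/(placeP o fw)[t [ht ->]] [/translated_origin -/(_ o1 o2 ht) -> h]]].
  by move: h => /dist0_pl; apply; exact: orthB.
move=> h; exists (pl (s2 - s1)); split; first exact: motionless_pl.
by split; [apply/translated_origin | apply/dist0_pl] => //; exact: orthB.
Qed.

Lemma same_distP s1 s2 t1 t2 : orth s1 -> orth s2 -> orth t1 -> orth t2 ->
  ⟦(∃S e, dist a (ev o) (pl s1) (pl s2) e
          ∧ dist a (ev o) (pl t1) (pl t2) e)%FO⟧ <->
  '[s2 - s1, s2 - s1] = '[t2 - t1, t2 - t1].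
Proof.
move=> o1 o2 o3 o4; split.
  move=> [e [/dist_pl h1 /dist_pl h2]].
  have [//|//|x [ex _ hx]] := h1; have [//|//|y []] := h2.
  rewrite ex => /(tm_inj fw) <- _ hy; clear h1 h2 ex; lra.
move=> h; have [x x0 hx] := len_ex sqrtF fw (orthB o2 o1).
by exists (tm x); split; apply/dist_pl => //; exists x; rewrite -?h.
Qed.

(** The location b' is at the same distance from the origin as s and on the same
    line, so it is - s; equal distance of s and - s from t is orthogonality of s
    and t. *)
Lemma Ort_pl s t : orth s -> orth t ->
  ⟦Ort (ev o) a (pl s) (pl t)⟧ <-> [/\ s != 0, t != 0 & '[s, t] = 0].
Proof.
move=> hs ht; have h0 := orth0 w; rewrite -{1}pl0; split.
  move=> [/eqpP n1 [/eqpP n2]].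
  have {}n1 : s != 0 by apply/eqP => e; apply: n1.
  have {}n2 : t != 0 by apply/eqP => e; apply: n2.
  move=> [_ [/(placeP o fw)[r [hr ->]] [/eqpP n3 [/Col_pl h4]]]].
  rewrite pl0 => -[]; rewrite -{2 4}pl0.
  move=> /same_distP -/(_ h0 hr h0 hs) h5 /same_distP -/(_ ht hr ht hs) h6.
  have {}h4 : dep (0 - r) (s - r) by auto.
  have {}n3 : r <> s by auto.
  split=> //; rewrite !subr0 in h5.
  have h7 : '[r, t] = '[s, t] by move: h6; rewrite !minkE !(minkC t); lra.
  have [r0|r0] := eqVneq r 0.
    have : '[s, s] < 0 by exact: orth_neg W hs n1.
    by rewrite -h5 r0 mink0l ltxx.
  have hrr : '[r, r] < 0 by exact: orth_neg W hr r0.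
  have [k hk] : exists k, s = k *: r.
    case: h4 => [/eqP|[k hk]]; first by rewrite sub0r oppr_eq0 (negbTE r0).
    by exists (1 - k); rewrite -[s](subrK r) hk; vring.
  have : (k ^+ 2 - 1) * '[r, r] = 0.
    by move: h5; rewrite hk minkZl minkZr; lra.
  move/eqP; rewrite mulf_eq0 (lt_eqF hrr) orbF subr_eq0 -[1](expr1n _ 2) eqf_sqr.
  case/orP=> /eqP k1; first by case: n3; rewrite hk k1 scale1r.
  by move: h7; rewrite hk k1 minkZl; lra.
move=> [s0 t0 hst].
split; first by move/eqpP=> e; rewrite -e ?eqxx // in s0.
split; first by move/eqpP=> e; rewrite -e ?eqxx // in t0.
exists (pl (- s)); split; first exact: motionless_pl.
split.
  move/eqpP => e; have {}e : - s = s by auto.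
  have /eqP : (2 : F) *: s = 0 by rewrite scaler_nat mulr2n -{1}e addNr.
  by rewrite scaler_eq0 pnatr_eq0 (negbTE s0).
split; first by apply/Col_pl; auto; right; exists 2; vring.
have hns : orth (- s) by exact: orthN.
rewrite pl0; split.
  by rewrite -{2 4}pl0; apply/same_distP; rewrite // !subr0 minkNl minkNr opprK.
by apply/same_distP; rewrite // !minkE (minkC t s) hst; ring.
Qed.

(** The distance is the absolute value of x.  The origin separates x E from the
    positive half of the axis exactly when x <= 0, which restores the sign. *)
Lemma coordinate_axis E k x s t g : orth E -> 0 < k -> - '[E, E] = '[w, w] ->
  orth s -> orth t -> s - t = x *: E ->
  ⟦coordinate a (ev o) (pl (k *: E)) (pl s) (pl t) g⟧ <-> g = tm x.
Proof.
move=> hE k0 NE hs ht est; have h0 := orth0 w.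
have oE (y : F) : orth (y *: E) by exact: orthZ.
have bet : ⟦between (pl (x *: E)) a (pl (k *: E))⟧ <-> x <= 0.
  rewrite -pl0; split.
    move=> /between_pl -/(_ (oE x) h0 (oE k))[m [m0 m1 h]].
    have : (x + m * (k - x)) * '[E, E] = 0.
      by rewrite -minkZl scalerDl -scalerA scalerBl -h mink0l.
    move=> /eqP; rewrite mulf_eq0; case/orP=> /eqP; last first.
      by move=> h'; have := W; rewrite -NE h' oppr0 ltxx.
    move=> h1; rewrite leNgt; apply/negP => x0.
    have : 0 <= x * (1 - m) by rewrite mulr_ge0 //; lra.
    have : 0 <= m * k by rewrite mulr_ge0 // ltW.
    have [m0'|m0'] := eqVneq m 0; first by move: h1; rewrite m0'; lra.
    have : 0 < m * k by rewrite mulr_gt0 // lt_neqAle eq_sym m0'.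
    lra.
  move=> x0; apply/between_pl => //; exists (- x / (k - x)).
  have kx : 0 < k - x by lra.
  split; [by rewrite divr_ge0 ?oppr_ge0 // ltW|by rewrite ler_pdivrMr //; lra|].
  by vfield; rewrite gt_eqF.
have dst e : ⟦dist a (ev o) (pl s) (pl t) e⟧ <-> e = tm `|x|.
  rewrite dist_pl //; have -> : t - s = (- x) *: E.
    by rewrite -opprB est scaleNr.
  have -> : - '[- x *: E, - x *: E] = `|x| ^+ 2 * '[w, w].
    by rewrite minkZl minkZr real_normK ?num_real // -NE; ring.
  split=> [[y [-> y0 hy]]|->].
    congr (clock_event _ _ _); apply: sqr_inj => //; apply: mulIf hy.
    by rewrite gt_eqF.
  by exists `|x|.
split.
  move=> [e [/dst -> [_ [/(placeP o fw)[r [hr ->]] [/translated_origin]]]]].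
  move=> /(_ ht hs hr); rewrite est => ->.
  case=> [[/bet nb ->]|[/bet b]].
    by rewrite ger0_norm //; apply: ltW; rewrite ltNge; apply/negP.
  move=> /(add_args sqrtF fw)[y [z []]]; rewrite -(tm0 o w).
  move=> /(tm_inj fw) yz -> /(tm_inj fw) ez.
  congr (clock_event _ _ _); move: ez yz; rewrite ler0_norm //; lra.
move=> ->; exists (tm `|x|); split; first exact/dst.
exists (pl (x *: E)); split; first exact: motionless_pl.
split; first by apply/translated_origin.
have [x0|x0] := leP x 0; [right|left].
  split; first exact/bet.
  by apply/opp_tm => //; rewrite ler0_norm // opprK.
split; first by move/bet; rewrite leNgt x0.
by rewrite ger0_norm // ltW.
Qed.

End RestSpace.

(** * Multiplication and coordinates in the rest frame of a particle *)

Section Coordinates.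
Variable F : realFieldType.
Hypothesis sqrtF : euclidean F.
Local Notation V := 'rV[F]_4.
Local Notation M := (stdModel F).
Local Notation "⟦ phi ⟧" := (holds (@sig_interp M) phi).
Local Notation "'[ u , v ]" := (mink u v).
Implicit Types (p q r d v s t : V) (b c : Par M) (e g : Sig M) (k x y z : F).
Variables o w : V.
Hypothesis fw : fut w.
Local Notation a := (part o w).
Local Notation tm := (clock_event o w).
Local Notation pt := (spacetime_pt o w).
Local Notation pl := (place o w).
Local Notation orth := (orthogonal w).
Let W := fut_gt0 fw.
Hint Resolve orth0 orthD orthZ orthN orthB : core.

(** With o as origin, u' = s1 and t1 = y w span a triangle, as do t2' = s2 and
    t = x w; their third sides are parallel because p and q are, so the second
    triangle is m times the first.  The light-signals say |s1| = |w| and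
    |s2| = z |w|, hence m = z or m = - z, and x > 0 excludes the latter. *)
Lemma mul_core_tm x y z :
  ⟦mul_core (tm x) (tm y) (tm z) a (ev o) (ev (o + w))⟧ <->
  [/\ 1 < y, 0 < z & x = y * z].
Proof.
have pt0 r : orth r -> forall v, on (pl r) v -> orth (o - v) -> v = pt 0 r.
  move=> hr v /(on_plP _ fw)[u ->].
  have -> : o - pt u r = (- u) *: w - r by rewrite /spacetime_pt; vring.
  rewrite /orthogonal minkDl minkNl hr minkZl subr0 mulNr => /eqP.
  by rewrite oppr_eq0 mulf_eq0 (gt_eqF W) orbF => /eqP ->.
rewrite -(tm0 o w) -(tm1 o w); split.
  move=> [/(later_tm sqrtF _ fw)y1 [/(later_tm sqrtF _ fw)z0]].
  move=> [/(later_tm sqrtF _ fw)x0].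
  move=> [_ [_ [/(placeP o fw)[s1 [h1 ->]] [/(placeP o fw)[s2 [h2 ->]]]]]].
  move=> [_ [/EvP[p1 ->] [_ [/EvP[p2 ->] [g1 [g2 [p [q [_]]]]]]]]].
  rewrite tm0 => -[/(simP sqrtF _ fw)i1 [/(simP sqrtF _ fw)i2 [n1 [n2 [l1 [l2]]]]]].
  move=> [a1 [a2 [a3 [a4 pq]]]].
  have e1 : p1 = pt 0 s1 := pt0 _ h1 _ n1 i1.
  have e2 : p2 = pt 0 s2 := pt0 _ h2 _ n2 i2.
  have [q0 [d [fd eq]]] := partP q.
  rewrite eq in pq; move: pq => /(motionlessP _ _ fd)[p0 ep].
  have [k hk] : exists k, (o + y *: w) - p1 = k *: d.
    by apply: (@on_dir _ p0) => //; rewrite -ep.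
  have [l hl] : exists l, (o + x *: w) - p2 = l *: d.
    by apply: (@on_dir _ q0) => //; rewrite -eq.
  move: l1 l2 => /sent_null + /sent_null; rewrite e1 e2 !tmE.
  move=> /(linkP _ fw)[//|//|_ N1] /(linkP _ fw)[//|//|_ N2].
  move: N1 N2; rewrite !subr0 !sub0r expr1n mul1r !minkNl !minkNr !opprK => N1 N2.
  rewrite e1 /spacetime_pt in hk; rewrite e2 /spacetime_pt in hl.
  have {}hk : y *: w + (- s1) = k *: d by rewrite -hk; vring.
  have {}hl : x *: w + (- s2) = l *: d by rewrite -hl; vring.
  have k0 : k != 0.
    apply/eqP => k0; move: hk; rewrite k0 scale0r -[0](addr0 0) -{1}(scale0r w).
    move=> /(comb_inj fw)[]; auto => y0 _.
    by move: y1; rewrite y0 ltNge ler01.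
  pose m := l / k.
  have hm : x *: w + (- s2) = (m * y) *: w + (- (m *: s1)).
    rewrite hl -scalerA -scalerN -scalerDr hk scalerA /m divfK //.
  have [||ex es] := comb_inj fw _ _ hm; [by auto|by apply/orthN/orthZ|].
  have {}es : s2 = m *: s1 by apply: oppr_inj.
  have m0 : 0 < m by move: x0; rewrite ex pmulr_lgt0 // (lt_trans ltr01).
  have -> : x = y * z; last by [].
  rewrite ex mulrC; congr (_ * _); apply: sqr_inj; rewrite ?(ltW m0) ?(ltW z0) //.
  apply: (@mulIf _ '[w, w]); first by rewrite gt_eqF.
  by rewrite N2 es minkZl minkZr {1}N1; ring.
move=> [y1 z0 ->]; have y0 : 0 < y by rewrite (lt_trans ltr01).
split; first exact/later_tm.
split; first exact/later_tm.
split; first by apply/later_tm => //; exact: mulr_gt0.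
have [s [hs _ Ns]] := sphere_ex sqrtF fw w ler01.
rewrite expr1n mul1r in Ns.
have hzs : orth (z *: s) := orthZ _ hs.
have fd : fut (y *: w + (- s)).
  apply: fut_comb => //; first exact: (orthN hs).
  rewrite minkNl minkNr opprK Ns ltr_pMl // exprn_egt1 //.
exists (pl s), (pl (z *: s)).
split; first exact: motionless_pl.
split; first exact: motionless_pl.
exists (ev (pt 0 s)); split; first exact: Ev_ev.
exists (ev (pt 0 (z *: s))); split; first exact: Ev_ev.
have [g1 h1] : exists g, ⟦sent (ev (pt 0 s)) g (tm 1)⟧.
  rewrite /clock_event tmE; apply: link_ex => //.
  by rewrite subr0 sub0r minkNl minkNr opprK Ns expr1n mul1r.
have [g2 h2] : exists g, ⟦sent (ev (pt 0 (z *: s))) g (tm z)⟧.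
  rewrite /clock_event tmE; apply: link_ex => //; first exact: ltW.
  by rewrite subr0 sub0r minkNl minkNr opprK minkZl minkZr -Ns; ring.
exists g1, g2, (part (pt 0 s) (y *: w + (- s))).
exists (part (pt 0 (z *: s)) (y *: w + (- s))).
split; first by rewrite -[a]pl0; apply/Col_pl => //; right; exists z; rewrite !subr0.
have so r : orth r -> ⟦sim a (tm 0) (ev (pt 0 r))⟧.
  move=> hr; rewrite tm0; apply/simP => //.
  have -> : o - pt 0 r = - r by rewrite /spacetime_pt; vring.
  exact: orthN.
split; first exact: so.
split; first exact: so.
split; first exact: on_pt.
split; first exact: on_pt.
split; first exact: h1.
split; first exact: h2.
split; first exact: on_base.
split; first by apply/on_part => //; exists 1; rewrite /spacetime_pt; vring.
split; first exact: on_base.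
split; first by apply/on_part => //; exists z; rewrite /spacetime_pt; vring.
by apply/motionlessP => //; exists (pt 0 s).
Qed.

Lemma later_zero x : ⟦later (tm x) (ev o)⟧ <-> 0 < x.
Proof. by rewrite -(tm0 o w); exact: later_tm. Qed.

Lemma unit_later x : ⟦later (ev (o + w)) (tm x)⟧ <-> x < 1.
Proof. by rewrite -(tm1 o w); exact: later_tm. Qed.

Lemma mul_core_unit y z :
  ⟦mul_core (ev (o + w)) (tm y) (tm z) a (ev o) (ev (o + w))⟧ <->
  [/\ 1 < y, 0 < z & 1 = y * z].
Proof. by rewrite -{1}(tm1 o w); exact: mul_core_tm. Qed.

(** For y < 1 the product x is found from z = y^-1 * x. *)
Lemma mul_pos_tm x y z :
  ⟦mul_pos (tm x) (tm y) (tm z) a (ev o) (ev (o + w))⟧ <->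
  [/\ 0 < y, 0 < z & x = y * z].
Proof.
split.
  case=> [/mul_core_tm[y1 z0 ->]|[|]].
  - by split => //; exact: lt_trans y1.
  - rewrite -(tm1 o w) => -[/(tm_inj fw) -> [/later_zero z0 /(tm_inj fw) ->]].
    by rewrite ltr01 mul1r.
  move=> [/later_zero y0 [_ [/later_zero z0 [i [/(TimeP _ fw)[k ->]]]]]].
  move=> [/mul_core_unit[k1 _ hk] /mul_core_tm[_ _ hz]].
  by split=> //; rewrite hz mulrA (mulrC y) -hk mul1r.
move=> [y0 z0 ->]; have [y1|y1|y1] := ltgtP 1 y.
- by left; apply/mul_core_tm.
- right; right; split; first exact/later_zero.
  split; first exact/unit_later.
  split; first exact/later_zero.
  exists (tm y^-1); split; first exact: Time_tm.
  split; [apply/mul_core_unit|apply/mul_core_tm]; split; rewrite ?invf_gt1 ?mulr_gt0 //.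
    by rewrite mulVf // gt_eqF.
  by rewrite mulrA mulVf ?mul1r // gt_eqF.
right; left; rewrite -y1 mul1r -(tm0 o w) -(tm1 o w).
by split=> //; split=> //; exact/later_tm.
Qed.

Lemma mul_tm x y z :
  ⟦Defs.mul (tm x) (tm y) (tm z) a (ev o) (ev (o + w))⟧ <-> x = y * z.
Proof.
split.
  move=> [_ [_ [_]]].
  case=> [|[|[|[|]]]].
  - rewrite -(tm0 o w) => -[[]/(tm_inj fw) -> /(tm_inj fw) ->];
    by rewrite ?mul0r ?mulr0.
  - by move=> [_ [_ /mul_pos_tm[]]].
  - move=> [_ [_ [n [n1 [/(add_args sqrtF fw)[x1 [x2 []]]]]]]].
    rewrite -{1}(tm0 o w) => /(tm_inj fw)e1 -> /(tm_inj fw)e2.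
    move=> [/(add_args sqrtF fw)[y1 [y2 []]]].
    rewrite -{1}(tm0 o w) => /(tm_inj fw)e3 -> /(tm_inj fw)e4.
    move=> /mul_pos_tm[_ _ h]; rewrite e2 e4.
    have -> : x2 = - x1 by lra.
    have -> : y2 = - y1 by lra.
    by rewrite h mulNr.
  - move=> [_ [_ [n [n1 [/(add_args sqrtF fw)[x1 [x2 []]]]]]]].
    rewrite -{1}(tm0 o w) => /(tm_inj fw)e1 -> /(tm_inj fw)e2.
    move=> [/(add_args sqrtF fw)[y1 [y2 []]]].
    rewrite -{1}(tm0 o w) => /(tm_inj fw)e3 -> /(tm_inj fw)e4.
    move=> /mul_pos_tm[_ _ h]; rewrite e2 e4.
    have -> : x2 = - x1 by lra.
    have -> : y2 = - y1 by lra.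
    by rewrite h mulrN.
  move=> [_ [_ [n [n1 [/(add_args sqrtF fw)[x1 [x2 []]]]]]]].
  rewrite -{1}(tm0 o w) => /(tm_inj fw)e1 -> /(tm_inj fw)e2.
  move=> [/(add_args sqrtF fw)[y1 [y2 []]]].
  rewrite -{1}(tm0 o w) => /(tm_inj fw)e3 -> /(tm_inj fw)e4.
  move=> /mul_pos_tm[_ _ h]; rewrite e2 e4 h.
  have -> : x2 = - x1 by lra.
  have -> : y2 = - y1 by lra.
  by rewrite mulrNN.
move=> h; do 3![split; first exact: Time_tm].
have lt (u v : F) : v < u -> ⟦later (tm u) (tm v)⟧ by move=> ?; apply/later_tm.
have opp (u v : F) : u = - v -> ⟦Defs.opp (tm u) (tm v) a (tm 0)⟧.
  by move=> e; rewrite tm0; apply/opp_tm.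
have mp (u v r : F) : [/\ 0 < v, 0 < r & u = v * r] ->
    ⟦mul_pos (tm u) (tm v) (tm r) a (tm 0) (ev (o + w))⟧.
  by rewrite tm0 => hu; apply/mul_pos_tm.
rewrite -(tm0 o w).
have [y0|y0|y0] := ltgtP y 0; last by left; rewrite h y0 mul0r; split; [left|].
  have [z0|z0|z0] := ltgtP z 0; last by left; rewrite h z0 mulr0; split; [right|].
    do 4!right; split; first exact: lt.
    split; first exact: lt.
    exists (tm (- y)), (tm (- z)); split; first exact: opp.
    split; first exact: opp.
    by apply: mp; rewrite !oppr_gt0 mulrNN.
  do 2!right; left; split; first exact: lt.
  split; first exact: lt.
  exists (tm (- x)), (tm (- y)); split; first exact: opp.
  split; first exact: opp.
  by apply: mp; rewrite !oppr_gt0 mulNr h.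
have [z0|z0|z0] := ltgtP z 0; last by left; rewrite h z0 mulr0; split; [right|].
  do 3!right; left; split; first exact: lt.
  split; first exact: lt.
  exists (tm (- x)), (tm (- z)); split; first exact: opp.
  split; first exact: opp.
  by apply: mp; rewrite !oppr_gt0 mulrN h.
right; left; split; first exact: lt.
split; first exact: lt.
exact: mp.
Qed.

Lemma pa_axis s1 s2 t : orth s1 -> orth s2 -> orth t ->
  ⟦pa (pl s1) (pl s2) a (pl t)⟧ <-> dep (s2 - s1) t.
Proof. by move=> h1 h2 ht; rewrite -[a]pl0 pa_pl // subr0. Qed.

Lemma Col_axis s t : orth s -> orth t ->
  ⟦Col a (pl s) (pl t)⟧ <-> dep s t.
Proof. by move=> hs ht; rewrite -[a]pl0 Col_pl // !subr0. Qed.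

Lemma dep_line (u E : V) k : k *: E != 0 -> dep u (k *: E) -> exists m, u = m *: E.
Proof.
move=> n0 /dep_sym[/eqP|[m ->]]; first by rewrite (negbTE n0).
by exists (m * k); rewrite scalerA.
Qed.

Section Axes.
Variables (E1 E2 E3 : V) (k1 k2 k3 : F).
Hypotheses (h1 : orth E1) (h2 : orth E2) (h3 : orth E3).
Hypotheses (N1 : - '[E1, E1] = '[w, w]) (N2 : - '[E2, E2] = '[w, w])
  (N3 : - '[E3, E3] = '[w, w]).
Hypotheses (k10 : 0 < k1) (k20 : 0 < k2) (k30 : 0 < k3).
Hypothesis E12 : '[E1, E2] = 0.

Lemma axis_neq0 (E : V) k : - '[E, E] = '[w, w] -> 0 < k -> k *: E != 0.
Proof.
move=> N k0; rewrite scaler_eq0 (gt_eqF k0) /=; apply/eqP => e.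
by have := W; rewrite -N e mink0l oppr0 ltxx.
Qed.

(** The location p_z is the projection of b to the plane of the first two axes.
    Here E1, E2, E3 have the length of w and carry the particles a_y, a_x and a_z,
    in this order: gx is the distance of p_z from p_x, which is on the axis of
    a_x, so it is measured along the axis of a_y. *)
Lemma corP p e gx gy gz :
  ⟦cor (ev p) e gx gy gz a (ev o) (pl (k2 *: E2)) (pl (k1 *: E1)) (pl (k3 *: E3))⟧
  <-> exists t x y z : F, [/\ e = tm t, gx = tm x, gy = tm y, gz = tm z &
    p = o + t *: w + (x *: E1 + y *: E2 + z *: E3)].
Proof.
have h0 := orth0 w.
have o1 : orth (k1 *: E1) by exact: orthZ.
have o2 : orth (k2 *: E2) by exact: orthZ.
have o3 : orth (k3 *: E3) by exact: orthZ.
have n1 := axis_neq0 N1 k10; have n2 := axis_neq0 N2 k20; have n3 := axis_neq0 N3 k30.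
split.
  move=> [/(TimeP _ fw)[t ->] [/(simP sqrtF _ fw)it]].
  move=> [_ [_ [_ [_ [/(placeP o fw)[s [hs ->]] [/(placeP o fw)[r1 [hr1 ->]]
    [/(placeP o fw)[r2 [hr2 ->]] [/(placeP o fw)[r3 [hr3 ->]]]]]]]]]].
  move=> [/(T_plP _ fw)[t' ep]].
  move=> [/pa_axis-/(_ hs hr3 o3)d1 [/pa_axis-/(_ hr3 hr1 o1)d2]].
  move=> [/pa_axis-/(_ hr3 hr2 o2)d3 [/Col_axis-/(_ hr1 o2)d4]].
  move=> [/Col_axis-/(_ hr2 o1)d5].
  have [m3 e3] := dep_line n3 d1; have [m1 e1] := dep_line n1 d2.
  have [m2 e2] := dep_line n2 d3; have [l2 f2] := dep_line n2 d4.
  have [l1 f1] := dep_line n1 d5.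
  have c1 : r3 - r1 = (- m1) *: E1 by rewrite -opprB e1 scaleNr.
  have c2 : r3 - r2 = (- m2) *: E2 by rewrite -opprB e2 scaleNr.
  have c3 : s - r3 = (- m3) *: E3 by rewrite -opprB e3 scaleNr.
  move=> [/(coordinate_axis sqrtF o fw _ h1 k10 N1 hr3 hr1 c1) -> ].
  move=> [/(coordinate_axis sqrtF o fw _ h2 k20 N2 hr3 hr2 c2) -> ].
  move=> /(coordinate_axis sqrtF o fw _ h3 k30 N3 hs hr3 c3) ->.
  exists t, (- m1), (- m2), (- m3); split=> //.
  have ett : t' = t.
    move: it; rewrite ep /spacetime_pt.
    have -> : o + t' *: w + s - (o + t *: w) = (t' - t) *: w + s by vring.
    rewrite /orthogonal minkDl hs addr0 minkZl => /eqP.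
    by rewrite mulf_eq0 (gt_eqF W) orbF => /eqP/subr0_eq.
  (* Both p_x and p_y lead to p_z; compare the coordinates along E2. *)
  have e4 : (l2 + m2) *: E2 = (l1 + m1) *: E1.
    apply/eqP; rewrite -subr_eq0; apply/eqP.
    transitivity ((l2 *: E2 - r1) - (l1 *: E1 - r2) + (r1 - r3 - (r2 - r3))
      - (m1 *: E1 - m2 *: E2)); first by vring.
    by rewrite e1 e2 -f1 -f2; vring.
  have l2E : l2 = - m2.
    have := congr1 (fun u : V => '[u, E2]) e4; rewrite /= !minkZl E12 mulr0 => /eqP.
    rewrite mulf_eq0 addr_eq0 => /orP[/eqP //|/eqP h].
    by have := W; rewrite -N2 h oppr0 ltxx.
  rewrite ep ett /spacetime_pt; congr (_ + _).
  transitivity ((s - r3) - (r1 - r3) + r1); first by vring.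
  by rewrite c3 e1 f2 l2E; vring.
move=> [t [x [y [z [-> -> -> -> ->]]]]].
split; first exact: Time_tm.
pose r1 := y *: E2; pose r2 := x *: E1; pose r3 := x *: E1 + y *: E2.
pose s := x *: E1 + y *: E2 + z *: E3.
have hr1 : orth r1 := orthZ _ h2.
have hr2 : orth r2 := orthZ _ h1.
have hr3 : orth r3 := orthD hr2 hr1.
have hs : orth s := orthD hr3 (orthZ _ h3).
split.
  apply/simP => //.
  by have -> : o + t *: w + s - (o + t *: w) = s by vring.
exists (pl s), (pl r1), (pl r2), (pl r3).
do 4![split; first exact: motionless_pl].
split; first exact: (on_pt _ fw).
have c1 : r3 - r1 = x *: E1 by rewrite /r3 /r1; vring.
have c2 : r3 - r2 = y *: E2 by rewrite /r3 /r2; vring.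
have c3 : s - r3 = z *: E3 by rewrite /s /r3; vring.
have dl (u E : V) m k : k *: E != 0 -> u = m *: E -> dep u (k *: E).
  rewrite scaler_eq0 negb_or => /andP[k0 _] ->; apply/dep_sym; right.
  by exists (m / k); rewrite scalerA divfK.
split.
  by apply/pa_axis => //; apply: (dl _ _ (- z)); rewrite // -opprB c3 scaleNr.
split.
  by apply/pa_axis => //; apply: (dl _ _ (- x)); rewrite // -opprB c1 scaleNr.
split.
  by apply/pa_axis => //; apply: (dl _ _ (- y)); rewrite // -opprB c2 scaleNr.
split; first by apply/Col_axis => //; apply: (dl _ _ y).
split; first by apply/Col_axis => //; apply: (dl _ _ x).
split; first exact/(coordinate_axis sqrtF o fw _ h1 k10 N1 hr3 hr1 c1).
split; first exact/(coordinate_axis sqrtF o fw _ h2 k20 N2 hr3 hr2 c2).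
exact/(coordinate_axis sqrtF o fw _ h3 k30 N3 hs hr3 c3).
Qed.

End Axes.
End Coordinates.

(** * Relativistic distance *)

Section Interval.
Variable F : realFieldType.
Hypothesis sqrtF : euclidean F.
Local Notation V := 'rV[F]_4.
Local Notation M := (stdModel F).
Local Notation "⟦ phi ⟧" := (holds (@sig_interp M) phi).
Local Notation "'[ u , v ]" := (mink u v).
Implicit Types (o w p q d v n : V) (b c : Par M) (e g : Sig M) (k x y z : F).

Lemma fut_scale k d : fut d -> 0 < k -> fut (k *: d).
Proof.
case/andP=> h1 h2 k0; rewrite /fut minkZl minkZr mxE.
by rewrite !mulr_gt0.
Qed.

Lemma FpP b e g : ⟦Fp b e g⟧ <->
  exists o w, [/\ fut w, b = part o w, e = ev o & g = ev (o + w)].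
Proof.
split.
  move=> [/EvP[p ->] [/EvP[q ->] [npq [/(precP sqrtF)[h0 _] [bp bq]]]]].
  have {}bp : on b p := bp; have {}bq : on b q := bq.
  have [p0 [d [fd eb]]] := partP b; rewrite eb in bp bq.
  have [k hk] := on_dir fd bp bq.
  have [d0 k0] : 0 < d 0 0 /\ 0 <= k.
    have /andP[_ d0] := fd; split=> //.
    by move: h0; rewrite hk mxE pmulr_lge0.
  have kp : 0 < k.
    rewrite lt_neqAle k0 andbT; apply/eqP => k00; apply: npq.
    apply/eqsP; move: hk; rewrite -k00 scale0r => /subr0_eq ->; by [].
  have fk : fut (q - p) by rewrite hk; exact: fut_scale.
  exists p, (q - p); split=> //; last by rewrite addrC subrK.
  rewrite eb; apply: (@par_eq2 _ _ _ p q) => //.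
  - by apply/eqP => e'; apply: npq; apply/eqsP.
  - exact: on_base.
  - by apply/on_part => //; exists 1; vring.
move=> [o [w [fw -> -> ->]]].
split; first exact: Ev_ev.
split; first exact: Ev_ev.
rewrite -(tm0 o w) -(tm1 o w).
split; first by move/(tm_inj fw)/eqP; rewrite eq_sym oner_eq0.
split; first by apply/prec_tm.
by split; apply: on_tm.
Qed.

Lemma Fp_part o w : fut w -> ⟦Fp (part o w) (ev o) (ev (o + w))⟧.
Proof. by move=> fw; apply/FpP; exists o, w. Qed.

(** The equation for the end point has a second solution, the reflected one, but
    its displacement is past-directed unless n = 0. *)
Lemma null_shift n d k : fut d -> nullfut n -> nullfut (n + k *: d) -> k = 0.
Proof.
move=> fd [n0 nn] [m0 mm]; have D := fut_gt0 fd.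
rewrite (causal_future fd) ?nn // in n0.
rewrite (causal_future fd) ?mm // in m0.
move: mm m0; rewrite !minkE nn (minkC d n) => mm m0.
have [//|k0] := eqVneq k 0.
have /eqP : k * (2 * '[n, d] + k * '[d, d]) = 0 by rewrite -mm; ring.
rewrite mulf_eq0 (negbTE k0) /= => /eqP h.
have nd : '[n, d] = 0 by lra.
move/eqP: h; rewrite nd mulr0 add0r mulf_eq0 (negbTE k0) /= => /eqP h.
by rewrite h ltxx in D.
Qed.

Lemma null_dir n : '[n, n] = 0 -> nullfut n \/ nullfut (- n).
Proof.
move=> h; have [n0|n0] := leP 0 (n 0 0); first by left.
by right; split; [rewrite mxE oppr_ge0 ltW|rewrite minkNl minkNr h !oppr0].
Qed.

(** Translation along a signal is parallel translation, by null_shift. *)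
Lemma null_translatedP p1 p2 q1 q2 :
  ⟦null_translated (ev p1) (ev p2) (ev q1) (ev q2)⟧ <->
  [/\ q2 - q1 = p2 - p1, '[q1 - p1, q1 - p1] = 0 & exists2 c, on c p1 & on c p2].
Proof.
split.
  move=> [c [c' [cc [a1 [a2 [a3 [a4 [s [s' h]]]]]]]]].
  have {}a1 : on c p1 := a1; have {}a2 : on c p2 := a2.
  have {}a3 : on c' q1 := a3; have {}a4 : on c' q2 := a4.
  have [p0 [d [fd ec]]] := partP c; rewrite ec in cc a1 a2.
  move: cc => /(motionlessP _ _ fd)[q0 ec']; rewrite ec' in a3 a4.
  have [k hk] := on_dir fd a1 a2; have [l hl] := on_dir fd a3 a4.
  suff [lk h0] : l = k /\ '[q1 - p1, q1 - p1] = 0.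
    by split; [rewrite hl hk lk| |exists c; rewrite ec].
  have e1 : q2 - p2 = (q1 - p1) + (l - k) *: d.
    by rewrite scalerBl -hk -hl; vring.
  have e2 : p2 - q2 = (p1 - q1) + (k - l) *: d.
    by rewrite scalerBl -hk -hl; vring.
  case: h => -[/sent_null h1 /sent_null h2].
    by rewrite e1 in h2; split; [apply/subr0_eq/(null_shift fd h1 h2)|case: h1].
  rewrite e2 in h2; split; last by rewrite minkBB; case: h1.
  by apply/esym/subr0_eq/(null_shift fd h1 h2).
move=> [h hn [c a1 a2]].
have [p0 [d [fd ec]]] := partP c; rewrite ec in a1 a2.
have [k hk] := on_dir fd a1 a2.
exists (part p0 d), (part q1 d).
split; first by apply/motionlessP => //; exists q1.
split; first exact: a1.
split; first exact: a2.
split; first exact: on_base.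
split; first by apply/on_part => //; exists k; rewrite -hk -h; vring.
have e1 : q2 - p2 = q1 - p1.
  apply/eqP; rewrite -subr_eq0; apply/eqP.
  transitivity ((q2 - q1) - (p2 - p1)); first by vring.
  by rewrite h subrr.
case: (null_dir hn) => hd.
  have [s hs] := sent_ex hd; rewrite -e1 in hd; have [s' hs'] := sent_ex hd.
  by exists s, s'; left.
have e2 : p2 - q2 = - (q1 - p1) by rewrite -e1 opprB.
have [s' hs'] : exists g, ⟦sent (ev q2) g (ev p2)⟧ by apply: sent_ex; rewrite e2.
rewrite opprB in hd; have [s hs] := sent_ex hd.
by exists s, s'; right.
Qed.

Section Mu.
Variables o w : V.
Hypothesis fw : fut w.
Local Notation a := (part o w).
Local Notation tm := (clock_event o w).
Let W := fut_gt0 fw.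

(** An event simultaneous with o for both particles is o + s with s orthogonal to
    d and w.  The signals from it to the ends of k d and x w say that both vectors
    have the square - '[s, s].  Conversely, such an s exists because the dimension
    is greater than two. *)
Lemma mu0P d k e : fut d ->
  ⟦mu0 a (ev o) (ev (o + k *: d)) e⟧ <->
  0 <= k /\ exists x, [/\ e = tm x, 0 <= x &
     x ^+ 2 * '[w, w] = k ^+ 2 * '[d, d]].
Proof.
move=> fd; have D := fut_gt0 fd.
have ek : o + k *: d - o = k *: d by vring.
split.
  move=> [/(precP sqrtF)[h0 _] [/(TimeP _ fw)[x ->]]].
  move=> [c [co [cp [_ [/EvP[r ->]]]]]].
  move=> [/(simP sqrtF _ fw)h1 [h2 [s [s' [/sent_null l1 /sent_null l2]]]]].
  have k0 : 0 <= k.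
    by move: h0; rewrite ek mxE pmulr_lge0 //; case/andP: fd.
  split=> //; exists x.
  have {}co : on c o := co; have {}cp : on c (o + k *: d) := cp.
  have [p0 [d' [fd' ec]]] := partP c; rewrite ec in co cp h2.
  move: h2 => /(simP sqrtF _ fd')h2.
  have [l hl] := on_dir fd' co cp; rewrite ek in hl.
  move: l1 l2; set v := r - o in h1 h2 *.
  have -> : o + k *: d - r = k *: d - v by rewrite /v; vring.
  have -> : o + x *: w - r = x *: w - v by rewrite /v; vring.
  clearbody v; move=> [_ l1] [l2 l3].
  have kv : '[k *: d, v] = 0 by rewrite hl minkZl minkC h2 mulr0.
  have xv : '[x *: w, v] = 0 by rewrite minkZl minkC h1 mulr0.
  have e1 : '[k *: d, k *: d] + '[v, v] = 0.
    by rewrite -[RHS]l1 minkDl !minkDr !minkNl !minkNr (minkC v (_ *: _)) kv; ring.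
  have e2 : '[x *: w, x *: w] + '[v, v] = 0.
    by rewrite -[RHS]l3 minkDl !minkDr !minkNl !minkNr (minkC v (_ *: _)) xv; ring.
  split=> //; last by move: e1 e2; rewrite !minkZl !minkZr; lra.
  rewrite (causal_future fw) ?l3 // in l2.
  by move: l2; rewrite minkDl minkNl h1 subr0 minkZl pmulr_lge0.
move=> [k0 [x [-> x0 hx]]].
split.
  by apply/precP; rewrite // ek mxE minkZl minkZr !mulr_ge0 // ltW //; case/andP: fd.
split; first exact: Time_tm.
exists (part o d).
split; first exact: on_base.
split; first by apply/on_part => //; exists k.
have [s [hs hsd Ns]] := sphere_ex sqrtF fw d x0.
exists (ev (o + s)); split; first exact: Ev_ev.
have es : o + s - o = s by vring.
split; first by apply/simP => //; rewrite /orthogonal es.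
split; first by apply/simP => //; rewrite /orthogonal es.
have [g hg] : exists g, ⟦sent (ev (o + s)) g (ev (o + k *: d))⟧.
  apply: sent_ex; have -> : o + k *: d - (o + s) = k *: d - s by vring.
  have e0 : '[k *: d - s, k *: d - s] = 0.
    rewrite !minkE (minkC d s) hsd; move: Ns hx; lra.
  split=> //; rewrite (causal_future fd) ?e0 //.
  by rewrite minkDl minkNl hsd minkZl subr0 mulr_ge0 // ltW.
have [g' hg'] : exists g, ⟦sent (ev (o + s)) g (tm x)⟧.
  apply: sent_ex; have -> : o + x *: w - (o + s) = x *: w - s by vring.
  have e0 : '[x *: w - s, x *: w - s] = 0.
    rewrite !minkE (minkC w s) hs; move: Ns; lra.
  split=> //; rewrite (causal_future fw) ?e0 //.
  by rewrite minkDl minkNl hs minkZl subr0 mulr_ge0 // ltW.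
by exists g, g'.
Qed.

(** By null_sum the translation from p to o needs only two light-like steps. *)
Lemma mu_posP p d k e : fut d ->
  ⟦mu_pos a (ev o) (ev p) (ev (p + k *: d)) e⟧ <->
  0 <= k /\ exists x, [/\ e = tm x, 0 <= x &
     x ^+ 2 * '[w, w] = k ^+ 2 * '[d, d]].
Proof.
move=> fd; have ek : p + k *: d - p = k *: d by vring.
split.
  move=> [_ [_ [/EvP[q ->] [_ [/EvP[r ->] [_ [/EvP[r' ->] h]]]]]]].
  move: h => [/null_translatedP[h1 _ _] [/null_translatedP[h2 _ _]]].
  have -> : q = o + k *: d.
    by rewrite -[q](subrK o) h2 h1 ek addrC.
  by move/(mu0P _ _ fd).
move=> h; have [k0 _] := h.
have D := fut_gt0 fd; have /andP[_ d0] := fd.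
split; first by apply/precP => //; rewrite ek mxE minkZl minkZr !mulr_ge0 // ltW.
have [n1 [n2 [e1 e2 e12 _]]] := null_sum sqrtF (o - p).
have po : p + n1 + n2 = o by rewrite -addrA -e12; vring.
exists (ev (o + k *: d)); split; first exact: Ev_ev.
exists (ev (p + n1)); split; first exact: Ev_ev.
exists (ev (p + n1 + k *: d)); split; first exact: Ev_ev.
split.
  apply/null_translatedP; split; first by vring.
    by have -> : p + n1 - p = n1 by vring.
  by exists (part p d); [exact: on_base|apply/on_part => //; exists k].
split; last exact/mu0P.
apply/null_translatedP; split; first by vring.
  by have -> : o - (p + n1) = n2 by rewrite -po; vring.
by exists (part (p + n1) d); [exact: on_base|apply/on_part => //; exists k].
Qed.

Lemma muP p d k (r r' : F) e : fut d -> 0 < r -> 0 < r' ->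
  r ^+ 2 = '[w, w] -> r' ^+ 2 = '[d, d] ->
  ⟦mu a (ev o) (ev p) (ev (p + k *: d)) e⟧ <-> e = tm (k * r' / r).
Proof.
move=> fd r0 r0' hr hr'; have rn : r != 0 by rewrite gt_eqF.
have sq (l : F) : 0 <= l -> forall x,
    (0 <= x /\ x ^+ 2 * '[w, w] = l ^+ 2 * '[d, d]) <-> x = l * r' / r.
  move=> l0 x; split=> [[x0]|->].
    rewrite -hr -hr' -!exprMn => h.
    have := sqr_inj _ _ h; rewrite !mulr_ge0 ?(ltW r0) ?(ltW r0') // => <- //.
    by rewrite mulfK.
  rewrite divr_ge0 ?mulr_ge0 ?(ltW r0) ?(ltW r0') // -hr -hr'; split => //.
  by field.
have back f : ⟦mu_pos a (ev o) (ev (p + k *: d)) (ev p) f⟧ <->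
  0 <= - k /\ exists x, [/\ f = tm x, 0 <= x & x ^+ 2 * '[w, w] = (- k) ^+ 2 * '[d, d]].
  have {2}-> : p = (p + k *: d) + (- k) *: d by vring.
  exact: mu_posP.
split.
  case=> [/(mu_posP _ _ _ fd)[k0 [x [-> x0 hx]]]|].
    by congr (clock_event _ _ _); apply/(sq _ k0).
  move=> [e' [/back[k0 [x [-> x0 hx]]]]].
  move=> /(add_args sqrtF fw)[y [z []]]; rewrite -(tm0 o w).
  move=> /(tm_inj fw)yz -> /(tm_inj fw)ez; congr (clock_event _ _ _).
  have : x = - k * r' / r by apply/(sq _ k0).
  move: yz ez; rewrite !mulNr; lra.
move=> ->; have [k0|k0] := leP 0 k.
  left; apply/mu_posP => //; split=> //; exists (k * r' / r).
  by have [] := (sq _ k0 (k * r' / r)).2 erefl.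
right; exists (tm (- k * r' / r)).
split; last by apply/opp_tm => //; rewrite !mulNr opprK.
have k0' : 0 <= - k by rewrite oppr_ge0 ltW.
have -> : ev p = ev ((p + k *: d) + (- k) *: d) by congr ev; vring.
apply/mu_posP => //; split=> //; exists (- k * r' / r).
by have [] := (sq _ k0' (- k * r' / r)).2 erefl.
Qed.

End Mu.

Lemma len_pos d : fut d -> exists2 r, 0 < r & r ^+ 2 = '[d, d].
Proof.
move=> /fut_gt0 D; have [r r0 hr] := sqrt_ex sqrtF (ltW D).
exists r => //; rewrite lt_neqAle r0 andbT; apply/eqP => e.
by rewrite -hr -e expr0n ltxx in D.
Qed.

(** Relativistic distance depends on the measuring particle only by the factor
    1/s, where s is the length of its unit, so equality does not depend on it. *)
Lemma EdrP p d k p' d' k' (r r' : F) : fut d -> fut d' -> 0 < r -> 0 < r' ->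
  r ^+ 2 = '[d, d] -> r' ^+ 2 = '[d', d'] ->
  ⟦Edr (ev (p + k *: d)) (ev p) (ev (p' + k' *: d')) (ev p')⟧ <->
  k * r = k' * r'.
Proof.
move=> fd fd' r0 r0' hr hr'.
have sw q v (l : F) : ev q = ev (q + l *: v + (- l) *: v) by congr ev; vring.
split.
  move=> /(_ (part 0 (axis F)) (ev 0) (@Ev_ev F 0) (on_base _ (fut_axis F))).
  move=> [x [m1 m2]].
  have [s s0 hs] := len_pos (fut_axis F).
  move: m1 m2; rewrite (sw p d k) (sw p' d' k').
  move=> /(muP _ (fut_axis F) _ _ _ fd s0 r0 hs hr) ->.
  move=> /(muP _ (fut_axis F) _ _ _ fd' s0 r0' hs hr') /(tm_inj (fut_axis F)).
  have sn : s^-1 != 0 by rewrite invr_eq0 gt_eqF.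
  by move/(mulIf sn); rewrite !mulNr => /oppr_inj.
move=> h c e /EvP[q ->] cq.
have [q0 [w [fw ec]]] := partP c.
have {}ec : c = part q w.
  by rewrite ec; apply: part_shift => //; rewrite -ec; exact: cq.
have [s s0 hs] := len_pos fw.
exists (clock_event q w (- k * r / s)); rewrite ec (sw p d k) (sw p' d' k').
split; first exact/(muP _ fw _ _ _ fd s0 r0 hs hr).
by apply/(muP _ fw _ _ _ fd' s0 r0' hs hr'); rewrite !mulNr h.
Qed.

(** The events x'' and u'' are k |w|/|w'| and |w|/|w'| in the field of the second
    particle; their quotient k does not depend on the units. *)
Lemma phi_isoP o w o' w' e e' : fut w -> fut w' ->
  ⟦phi_iso e e' (part o w) (ev o) (ev (o + w)) (part o' w') (ev o') (ev (o' + w'))⟧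
  <-> exists k, e = clock_event o w k /\ e' = clock_event o' w' k.
Proof.
move=> fw fw'; have [r r0 hr] := len_pos fw; have [r' r0' hr'] := len_pos fw'.
split.
  move=> [_ [_ [/(TimeP _ fw)[k ->] [/(TimeP _ fw')[k' ->]]]]].
  move=> [g [g' [/(TimeP _ fw')[y ->] [/(TimeP _ fw')[z ->]]]]].
  move=> [/(EdrP _ _ _ _ fw fw' r0 r0' hr hr')h1 [h2 /(mul_tm sqrtF _ fw')h3]].
  have {}h2 : 1 * r = z * r'.
    apply/(EdrP o _ o' _ fw fw' r0 r0' hr hr'); rewrite scale1r; exact: h2.
  exists k; split=> //; congr (clock_event _ _ _).
  apply: (@mulIf _ r); first by rewrite gt_eqF.
  by rewrite h1 h3 -[in LHS](mul1r r) h2 mulrA.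
move=> [k [-> ->]]; split; first exact: Fp_part.
split; first exact: Fp_part.
split; first exact: Time_tm.
split; first exact: Time_tm.
have rn : r' != 0 by rewrite gt_eqF.
exists (clock_event o' w' (k * r / r')), (clock_event o' w' (r / r')).
split; first exact: Time_tm.
split; first exact: Time_tm.
split; first by apply/(EdrP _ _ _ _ fw fw' r0 r0' hr hr'); rewrite divfK.
split; last by apply/mul_tm; rewrite // mulrA.
have -> : ev (o + w) = ev (o + 1 *: w) by rewrite scale1r.
by apply/(EdrP _ _ _ _ fw fw' r0 r0' hr hr'); rewrite divfK // mul1r.
Qed.

Lemma lightP p q : ⟦light (ev p) (ev q)⟧ <-> '[q - p, q - p] = 0.
Proof.
split; first by move=> [s [/sent_null[]|/sent_null[]]] //; rewrite minkBB.
move=> h; case: (null_dir h) => hd.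
  by have [s hs] := sent_ex hd; exists s; left.
by rewrite opprB in hd; have [s hs] := sent_ex hd; exists s; right.
Qed.

(** Subtracting a multiple of n to cancel the time component leaves a light-like
    vector without time component, which vanishes. *)
Lemma null_parallel n v : n != 0 -> '[n, n] = 0 -> '[v, v] = 0 -> '[v, n] = 0 ->
  exists k, v = k *: n.
Proof.
move=> n0 nn vv vn.
have t0 : n 0 0 != 0.
  by apply: contraNneq n0 => h; rewrite (null_time0 _ h) // nn.
exists (v 0 0 / n 0 0); apply/subr0_eq/null_time0; last by rewrite !mxE divfK // subrr.
by rewrite !minkE nn vv (minkC n v) vn !(mulr0, oppr0, addr0).
Qed.

Lemma wlP s q n p : pts s = (q, q + n) -> n != 0 ->
  ⟦wl (ev p) s⟧ <-> exists k, p = q + k *: n.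
Proof.
move=> hs n0; have nn : '[n, n] = 0.
  have [_] := signal_nullfut s; rewrite hs /=.
  by have -> : q + n - q = n by vring.
split.
  move=> [_ [/EvP[q1 ->] [_ [/EvP[q2 ->]]]]].
  move=> [[/lightP h1 [/lightP h2 _]] [/BegP b /EndP en]].
  rewrite hs /= in b en; rewrite -b minkBB in h1; rewrite -en minkBB in h2.
  have [k hk] : exists k, p - q = k *: n.
    apply: null_parallel => //.
    have e : p - (q + n) = (p - q) - n by vring.
    by move: h2; rewrite e !minkE; move: h1 nn; rewrite !minkE !(minkC n); lra.
  by exists k; rewrite -hk addrC subrK.
move=> [k ->].
exists (ev q); split; first exact: Ev_ev.
exists (ev (q + n)); split; first exact: Ev_ev.
split; last by split; [apply/BegP|apply/EndP]; rewrite hs.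
split; [|split]; apply/lightP.
- have -> : q - (q + k *: n) = (- k) *: n by vring.
  by rewrite minkZl minkZr nn !mulr0.
- have -> : q + n - (q + k *: n) = (1 - k) *: n by vring.
  by rewrite minkZl minkZr nn !mulr0.
by have -> : q + n - q = n by vring.
Qed.

End Interval.

(** * The model of the axioms over a Euclidean field *)

Section Frames.
Variable F : realFieldType.
Local Notation V := 'rV[F]_4.
Local Notation "'[ u , v ]" := (mink u v).
Local Notation J := (metric_mx F).

Lemma big4 (R : nmodType) (f : 'I_4 -> R) : \sum_i f i = f 0 + f 1 + f 2 + f 3.
Proof.
rewrite !big_ord_recl big_ord0 addr0 !addrA.
by congr (_ + f _ + f _ + f _); apply: val_inj.
Qed.

Definition coords (t x y z : F) : V := \row_i [:: t; x; y; z]`_i.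

Lemma coordsE (c : V) : c = coords (c 0 0) (c 0 1) (c 0 2) (c 0 3).
Proof. by apply: row4P; rewrite !mxE. Qed.

Lemma coords_inj t x y z t' x' y' z' : coords t x y z = coords t' x' y' z' ->
  [/\ t = t', x = x', y = y' & z = z'].
Proof.
by move=> h; split; [have := congr1 (fun v : V => v 0 0) h
  | have := congr1 (fun v : V => v 0 1) h
  | have := congr1 (fun v : V => v 0 2) h
  | have := congr1 (fun v : V => v 0 3) h]; rewrite !mxE.
Qed.

Lemma coords_mul (A : 'M[F]_4) t x y z : coords t x y z *m A =
  t *: row 0 A + x *: row 1 A + y *: row 2 A + z *: row 3 A.
Proof. by rewrite mulmx_sum_row big4 !mxE. Qed.

(** The rows are the unit of time and three axes of the same length as it,
    orthogonal to each other.  That length is arbitrary: an observer may choose any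
    unit event. *)
Definition conformal (A : 'M[F]_4) : bool :=
  (A *m J *m A^T == '[row 0 A, row 0 A] *: J) && fut (row 0 A).

Lemma gram (A : 'M[F]_4) i j : (A *m J *m A^T) i j = '[row i A, row j A].
Proof.
by rewrite -metric_mxP -!row_mul tr_row !mxE; apply: eq_bigr => k _; rewrite !mxE.
Qed.

Record frame := Frame { org : V; base : 'M[F]_4; baseP : conformal base }.

Implicit Types (f : frame) (c d p q n : V).

Definition clock f : V := row 0 (base f).
Definition event_of f c : V := org f + c *m base f.

Lemma frame_inj f g : org f = org g -> base f = base g -> f = g.
Proof.
case: f g => [o A hA] [o' A' hA'] /= eo eA.
by move: hA hA'; rewrite eo eA => hA hA'; rewrite (bool_irrelevance hA hA').
Qed.

Lemma clock_fut f : fut (clock f). Proof. by have /andP[_ h] := baseP f. Qed.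

Lemma baseE f : base f *m J *m (base f)^T = '[clock f, clock f] *: J.
Proof. by have /andP[/eqP h _] := baseP f; exact: h. Qed.

(** Since the factor is positive, coordinates preserve the light cone. *)
Lemma mink_base f c d :
  '[c *m base f, d *m base f] = '[clock f, clock f] * '[c, d].
Proof.
rewrite -[LHS]metric_mxP -['[c, d]]metric_mxP trmx_mul -!mulmxA.
rewrite (mulmxA (base f)) (mulmxA (_ *m J)) baseE.
by rewrite -scalemxAl -scalemxAr [LHS]mxE mulmxA.
Qed.

Lemma base_unit f : base f \in unitmx.
Proof.
have W := fut_gt0 (clock_fut f).
suff /mulmx1_unit[] :
    base f *m (J *m (base f)^T *m ('[clock f, clock f]^-1 *: J)) = 1%:M by [].
rewrite !mulmxA baseE -scalemxAl -scalemxAr scalerA mulfV ?gt_eqF // scale1r.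
exact: metric_mx_sqr.
Qed.

Lemma event_of_surj f p : exists c, p = event_of f c.
Proof.
exists ((p - org f) *m invmx (base f)).
by rewrite /event_of mulmxKV ?base_unit // addrC subrK.
Qed.

Lemma mul_base_inj f c d : c *m base f = d *m base f -> c = d.
Proof.
move=> h; rewrite -[c](mulmxK (base_unit f)) h; exact: (mulmxK (base_unit f)).
Qed.

Lemma event_of_inj f c d : event_of f c = event_of f d -> c = d.
Proof. by move/addrI/mul_base_inj. Qed.

Lemma event_of_line f c d k : event_of f (c + k *: d) = event_of f c + k *: (d *m base f).
Proof. by rewrite /event_of mulmxDl -scalemxAl addrA. Qed.

Lemma frame_ext f g : (forall c, event_of f c = event_of g c) -> f = g.
Proof.
move=> h; have eo : org f = org g.
  by have := h 0; rewrite /event_of !mul0mx !addr0.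
apply: frame_inj => //; apply/row_matrixP => i.
by have := h (delta_mx 0 i); rewrite /event_of eo -!rowE => /addrI.
Qed.

Definition lightray : Type :=
  {L : set V | exists q n, [/\ n != 0, '[n, n] = 0 & L = line q n]}.

Inductive body := Photon of lightray | Observer of frame.

Definition worldline (b : body) : set V :=
  match b with
  | Photon L => sval L
  | Observer f => line (org f) (clock f)
  end.

Definition sr_interp (p : sr_atom body F) : Prop :=
  match p with
  | Obs b => exists f, b = Observer f
  | Ph b => exists L, b = Photon L
  | Plus q x y => q = x + y
  | Times q x y => q = x * y
  | WorldView (Observer f) b t x y z => worldline b (event_of f (coords t x y z))
  | WorldView (Photon _) _ _ _ _ _ => False
  | EqB b b' => b = b'
  | EqQ x y => x = y
  end.

Local Notation holdsM := (holds sr_interp).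

Lemma isZeroP z : holdsM (isZero z) <-> z = 0.
Proof.
split=> [h|-> x]; last by rewrite /= addr0.
by apply: (@addrI _ 0); rewrite addr0 -(h 0).
Qed.

Lemma isOneP z : holdsM (isOne z) <-> z = 1.
Proof.
split=> [h|-> x]; last by rewrite /= mulr1.
by rewrite -[LHS]mul1r -(h 1).
Qed.

Lemma affineP (x q k d : F) : holdsM (affine x q k d) <-> x = q + k * d.
Proof. by split=> [[m [-> ->]]|->] //; exists (k * d). Qed.

Lemma onLineP t x y z qt qx qy qz dt dx dy dz :
  holdsM (onLine t x y z qt qx qy qz dt dx dy dz) <->
  line (coords qt qx qy qz) (coords dt dx dy dz) (coords t x y z).
Proof.
split.
  move=> [k [/affineP -> [/affineP -> [/affineP -> /affineP ->]]]]; exists k => //.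
  by apply: row4P; rewrite !mxE.
move=> [k _ h]; exists k.
have [<- <- <- <-] : [/\ qt + k * dt = t, qx + k * dx = x,
    qy + k * dy = y & qz + k * dz = z].
  by apply: coords_inj; rewrite -h; apply: row4P; rewrite !mxE.
by do !split; apply/affineP.
Qed.

Lemma slope1DirP dt dx dy dz : holdsM (slope1Dir dt dx dy dz) <->
  coords dt dx dy dz != 0 /\ '[coords dt dx dy dz, coords dt dx dy dz] = 0.
Proof.
have zP : (dt = 0 /\ dx = 0 /\ dy = 0 /\ dz = 0) <-> coords dt dx dy dz = 0.
  split=> [[-> [-> [-> ->]]]|]; first by apply: row4P; rewrite !mxE.
  have -> : 0 = coords 0 0 0 0 by apply: row4P; rewrite !mxE.
  by move/coords_inj => [].
have mE : '[coords dt dx dy dz, coords dt dx dy dz] =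
    dt * dt - (dx * dx + dy * dy + dz * dz) by rewrite /mink !mxE.
split.
  move=> [n0 [t2 [x2 [y2 [z2 [s [-> [-> [-> [-> [-> e]]]]]]]]]]]; split.
    by apply/eqP => /zP[h0 [h1 [h2 h3]]]; apply: n0; do !split; apply/isZeroP.
  by rewrite mE e subrr.
rewrite mE => -[n0 /subr0_eq h]; split.
  move=> [/isZeroP h0 [/isZeroP h1 [/isZeroP h2 /isZeroP h3]]].
  by case/eqP: n0; apply/zP.
by exists (dt * dt), (dx * dx), (dy * dy), (dz * dz), (dx * dx + dy * dy).
Qed.

Lemma ray_preimage f c d :
  [set x | line (event_of f c) (d *m base f) (event_of f x)] = line c d.
Proof.
rewrite eqEsubset; split=> x [k _ h]; exists k => //.
  by apply: (@event_of_inj f); rewrite event_of_line.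
by rewrite -event_of_line h.
Qed.

(** A frame is an affine bijection of F^4 whose linear part rescales the
    Minkowski form, so it maps lines of slope 1 to such lines in both directions. *)
Lemma model_AxPh : holdsM (AxPh body F).
Proof.
move=> _ [f ->]; split.
  move=> _ [L ->]; have [q [n [n0 nn eL]]] := svalP L.
  have [c ec] := event_of_surj f q; pose d := n *m invmx (base f).
  have ed : n = d *m base f by rewrite mulmxKV ?base_unit.
  exists (c 0 0), (c 0 1), (c 0 2), (c 0 3), (d 0 0), (d 0 1), (d 0 2), (d 0 3).
  split.
    apply/slope1DirP; rewrite -coordsE; split.
      by apply: contraNneq n0 => d0; rewrite ed d0 mul0mx.
    have /eqP := nn; rewrite ed mink_base mulf_eq0.
    by rewrite (gt_eqF (fut_gt0 (clock_fut f))) => /eqP.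
  move=> t x y z /=; rewrite eL ec ed.
  have h := ray_preimage f c d.
  split=> [h1|/onLineP h1].
    by apply/onLineP; rewrite -!coordsE -h.
  by rewrite -!coordsE -h in h1.
move=> qt qx qy qz dt dx dy dz /slope1DirP[n0 nn].
set c := coords qt qx qy qz; set d := coords dt dx dy dz in n0 nn *.
have hL : exists q n, [/\ n != 0, '[n, n] = 0 &
    line (event_of f c) (d *m base f) = line q n].
  exists (event_of f c), (d *m base f); split=> //; last by rewrite mink_base nn mulr0.
  by apply: contraNneq n0 => h; apply/eqP; apply: (@mul_base_inj f); rewrite h mul0mx.
pose L : lightray := exist (fun L : set V =>
  exists q n, [/\ n != 0, '[n, n] = 0 & L = line q n]) _ hL.
exists (Photon L); split; first by exists L.
move=> t x y z /=; have h := ray_preimage f c d.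
by split=> [h1|/onLineP h1]; [apply/onLineP; rewrite -h | rewrite -h in h1].
Qed.

Lemma model_AxEv : holdsM (AxEv body F).
Proof.
move=> _ _ [f ->] [g ->] t x y z.
have [c hc] := event_of_surj g (event_of f (coords t x y z)).
exists (c 0 0), (c 0 1), (c 0 2), (c 0 3) => b /=.
by rewrite -coordsE -hc.
Qed.

Lemma model_AxSelf : holdsM (AxSelf body F).
Proof.
move=> _ [f ->] t x y z /=.
have tP k : coords k 0 0 0 *m base f = k *: clock f.
  by rewrite coords_mul !scale0r !addr0.
split=> [[k _ /addrI]|[/isZeroP -> [/isZeroP -> /isZeroP ->]]].
  rewrite -tP => /mul_base_inj/coords_inj[_ <- <- <-].
  by split; [|split]; apply/isZeroP.
by exists t => //; rewrite /event_of tP.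
Qed.

Hypothesis sqrtF : euclidean F.

(** Nonnegative elements have square roots, so the order defined by squares is the
    order of F. *)
Lemma leQP x y : holdsM (leQ x y) <-> x <= y.
Proof.
split=> [[r [s [-> ->]]]|h]; first by rewrite lerDl -expr2 sqr_ge0.
have [r _ hr] : exists2 r, 0 <= r & r ^+ 2 = y - x.
  by apply: sqrt_ex; rewrite // subr_ge0.
by exists r, (y - x); split=> /=; rewrite -?hr ?expr2 // -expr2 hr addrC subrK.
Qed.

Lemma model_AxFd : holdsM (AxFd body F).
Proof.
split; first by move=> x y; exists (x + y).
split; first by move=> x y s s' /= -> ->.
split; first by move=> x y; exists (x * y).
split; first by move=> x y s s' /= -> ->.
split; first by move=> x y s /= ->; rewrite addrC.
split; first by move=> x y z xy yz s /= -> -> ->; rewrite addrA.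
split; first by exists 0; apply/isZeroP.
split; first by move=> o x /isZeroP ->; exists (- x); rewrite /= subrr.
split; first by move=> x y p /= ->; rewrite mulrC.
split; first by move=> x y z xy yz p /= -> -> ->; rewrite mulrA.
split; first by exists 1; apply/isOneP.
split.
  move=> e x /isOneP -> nx; exists x^-1; rewrite /= mulfV //.
  by apply/eqP => x0; apply: nx; apply/isZeroP.
split; first by move=> x y z s p xy xz /= -> -> -> ->; rewrite mulrDr.
split.
  by move=> o e /isZeroP -> /isOneP -> /= /eqP; rewrite eq_sym oner_eq0.
split; first by move=> x; apply/leQP.
split; first by move=> x y /leQP xy /leQP yx; apply/eqP; rewrite eq_le xy yx.
split; first by move=> x y z /leQP xy /leQP yz; apply/leQP/(le_trans xy yz).
split.
  by move=> x y; have [h|h] := leP x y; [left|right]; apply/leQP; rewrite // ltW.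
split; first by move=> x y z xz yz /leQP h /= -> ->; apply/leQP; rewrite lerD2r.
split.
  move=> o x y p /isZeroP -> /leQP x0 /leQP y0 /= ->.
  by apply/leQP; rewrite mulr_ge0.
move=> o x /isZeroP -> /leQP x0 _; have [r _ <-] := sqrt_ex sqrtF x0.
by exists r; rewrite /= expr2.
Qed.

End Frames.

(** * The values of tuples and the transfer of sentences *)

Section Interpretation.
Variable F : realFieldType.
Hypothesis sqrtF : euclidean F.
Local Notation V := 'rV[F]_4.
Local Notation M := (stdModel F).
Local Notation "⟦ phi ⟧" := (holds (@sig_interp M) phi).
Local Notation "'[ u , v ]" := (mink u v).
Local Notation tm := (@clock_event F).
Local Notation pl := (@place F).
Local Notation orth := (@orthogonal F).
Local Notation qtup := (qtuple (Par M) (Sig M)).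
Local Notation btup := (btuple (Par M) (Sig M)).
Implicit Types (o w p d v n : V) (e g : Sig M) (k x y z : F) (f : frame F).

(** The number x is the value of q.  This is a relation because o and w can be
    found only when q satisfies its domain formula. *)
Definition qrel (q : qtup) (x : F) : Prop :=
  exists o w, fut w /\ q = QTuple (tm o w x) (part o w) (ev o) (ev (o + w)).

Lemma qrel_dom q x : qrel q x -> ⟦Qdom q⟧.
Proof.
move=> [o [w [fw ->]]]; split; first exact: on_tm.
by split; [exact: Ev_ev | exact: Fp_part].
Qed.

Lemma qrel_ex q : ⟦Qdom q⟧ -> exists x, qrel q x.
Proof.
case: q => e a g u [/= h1 [h2 /(FpP sqrtF)[o [w [fw ea -> ->]]]]].
have /(TimeP o fw)[x ->] : ⟦Time (part o w) e⟧ by rewrite -ea.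
by exists x, o, w; rewrite ea.
Qed.

Lemma qrel_surj x : exists2 q, ⟦Qdom q⟧ & qrel q x.
Proof.
pose a0 := axis F.
have h : qrel (QTuple (tm 0 a0 x) (part 0 a0) (ev 0) (ev (0 + a0))) x.
  by exists 0, a0; split; first exact: fut_axis.
exists (QTuple (tm 0 a0 x) (part 0 a0) (ev 0) (ev (0 + a0))) => //.
exact: qrel_dom h.
Qed.

Lemma tr_eqQP q q' x x' : qrel q x -> qrel q' x' -> ⟦tr_eqQ q q'⟧ <-> x = x'.
Proof.
move=> [o [w [fw ->]]] [o' [w' [fw' ->]]]; rewrite /tr_eqQ; split.
  move=> /(phi_isoP sqrtF _ _ _ _ fw fw')[k [/(tm_inj fw) -> /(tm_inj fw') ->]].
  by [].
by move=> ->; apply/phi_isoP => //; exists x'.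
Qed.

Lemma repP q x o w e : qrel q x -> fut w ->
  ⟦rep q (part o w) (ev o) (ev (o + w)) e⟧ <-> e = tm o w x.
Proof.
move=> [o' [w' [fw' ->]]] fw; rewrite /rep; split.
  by move=> /(phi_isoP sqrtF _ _ _ _ fw fw')[k [-> /(tm_inj fw') ->]].
by move=> ->; apply/phi_isoP => //; exists x.
Qed.

Lemma tr_plusP q q1 q2 x x1 x2 : qrel q x -> qrel q1 x1 -> qrel q2 x2 ->
  ⟦tr_plus q q1 q2⟧ <-> x = x1 + x2.
Proof.
move=> [o [w [fw ->]]] h1 h2; split.
  move=> [e1 [e2 [/(repP _ _ h1 fw) -> [/(repP _ _ h2 fw) ->]]]].
  by move/(add_tm sqrtF _ fw).
move=> ->; exists (tm o w x1), (tm o w x2); split; first by apply/(repP _ _ h1 fw).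
by split; [apply/(repP _ _ h2 fw)|apply/add_tm].
Qed.

Lemma tr_timesP q q1 q2 x x1 x2 : qrel q x -> qrel q1 x1 -> qrel q2 x2 ->
  ⟦tr_times q q1 q2⟧ <-> x = x1 * x2.
Proof.
move=> [o [w [fw ->]]] h1 h2; split.
  move=> [e1 [e2 [/(repP _ _ h1 fw) -> [/(repP _ _ h2 fw) ->]]]].
  by move/(mul_tm sqrtF _ fw).
move=> ->; exists (tm o w x1), (tm o w x2); split; first by apply/(repP _ _ h1 fw).
by split; [apply/(repP _ _ h2 fw)|apply/mul_tm].
Qed.

Local Notation ax f i := (row i (base f)).

(** The tuple b denotes the body beta.  A photon is given by its world-line alone,
    since =_B ignores the segment on it; an observer by its frame, since only the
    directions of the particles on the axes matter, not their distances.  The first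
    axis belongs to b_y, as in corP. *)
Definition brel (b : btup) (beta : body F) : Prop :=
  match beta with
  | Photon L => exists q n,
      [/\ n != 0, pts (b_sigma b) = (q, q + n) & sval L = line q n]
  | Observer f => exists s, ⟦Ev s⟧ /\ exists k1 k2 k3 : F,
      [/\ 0 < k1, 0 < k2, 0 < k3 &
      b = BTuple s (part (org f) (clock f)) (ev (org f)) (ev (org f + clock f))
        (pl (org f) (clock f) (k2 *: ax f 2))
        (pl (org f) (clock f) (k1 *: ax f 1))
        (pl (org f) (clock f) (k3 *: ax f 3))]
  end.

Lemma row_mink f i j :
  '[ax f i, ax f j] = '[clock f, clock f] * metric_mx F i j.
Proof. by rewrite -gram baseE mxE. Qed.

Lemma ax_orth f i : i != 0 -> orth (clock f) (ax f i).
Proof.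
by move=> i0; rewrite /orth row_mink mxE (negbTE i0) mulr0n mulr0.
Qed.

Lemma ax_perp f i j : i != j -> '[ax f i, ax f j] = 0.
Proof. by move=> ij; rewrite row_mink mxE (negbTE ij) mulr0n mulr0. Qed.

Lemma ax_len f i : i != 0 -> - '[ax f i, ax f i] = '[clock f, clock f].
Proof.
by move=> i0; rewrite row_mink mxE eqxx i0 mulr1n expr1 mulrN1 opprK.
Qed.

Lemma photon_nEv b L : brel b (Photon L) -> ~ ⟦Ev (b_sigma b)⟧.
Proof.
move=> [q [n [n0 hs _]]] /Ev_pts; rewrite hs /= => h; case/eqP: n0.
by apply: (@addrI _ q); rewrite addr0.
Qed.

Lemma observer_Ev b f : brel b (Observer f) -> ⟦Ev (b_sigma b)⟧.
Proof. by move=> [s [hs [k1 [k2 [k3 [_ _ _ ->]]]]]]. Qed.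

Lemma motionless_sym (a b : Par M) : ⟦motionless a b⟧ -> ⟦motionless b a⟧.
Proof.
have [q [d [fd ->]]] := partP b.
by move=> /(motionlessP _ _ fd)[r ->]; apply/motionlessP => //; exists q.
Qed.

(** The unit on an axis has the length of the unit of time. *)
Lemma unit_ex w v : fut w -> orth w v -> v != 0 ->
  exists k E, [/\ 0 < k, v = k *: E, orth w E & - '[E, E] = '[w, w]].
Proof.
move=> fw hv v0; have W := fut_gt0 fw.
have [r r0 hr] := len_ex sqrtF fw hv.
have rn : r != 0.
  apply: contraTneq v0 => rz; rewrite negbK; apply/eqP/(orth_eq0 W hv).
  by apply: oppr_inj; rewrite -hr rz expr0n mul0r oppr0.
exists r, (r^-1 *: v); split; first by rewrite lt_neqAle eq_sym rn.
- by rewrite scalerA mulfV // scale1r.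
- exact: orthZ.
rewrite minkZl minkZr -!mulrN -hr; field => //.
Qed.

Lemma brel_ex b : ⟦Bdom b⟧ -> exists beta, brel b beta.
Proof.
case: b => s a g u bx by_ bz [h|[hs hop]].
  have n0 : (pts s).2 - (pts s).1 != 0.
    by rewrite subr_eq0; apply/eqP => h'; apply: h; apply/Ev_pts.
  have [_ nn] := signal_nullfut s.
  pose q := (pts s).1; pose n := (pts s).2 - (pts s).1.
  have hL : exists q' n', [/\ n' != 0, '[n', n'] = 0 & line q n = line q' n'].
    by exists q, n.
  exists (Photon (exist (fun L : set V => exists q n,
     [/\ n != 0, '[n, n] = 0 & L = line q n]) _ hL)), q, n; split=> //=.
  by rewrite /q /n addrC subrK -surjective_pairing.
have {hop} : ⟦Op a g u bx by_ bz⟧ := hop.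
move=> [/(FpP sqrtF)[o [w [fw -> -> ->]]] [/motionless_sym m1 [/motionless_sym m2]]].
move=> [/motionless_sym m3].
move: m1 => /(placeP o fw)[X [hX ->]]; move: m2 => /(placeP o fw)[Y [hY ->]].
move: m3 => /(placeP o fw)[Z [hZ ->]].
move=> [/(Ort_pl sqrtF _ fw hX hY)[X0 Y0 XY] [/(Ort_pl sqrtF _ fw hX hZ)[_ Z0 XZ]]].
move=> /(Ort_pl sqrtF _ fw hY hZ)[_ _ YZ].
have [k2 [E2 [k20 eX o2 N2]]] := unit_ex fw hX X0.
have [k1 [E1 [k10 eY o1 N1]]] := unit_ex fw hY Y0.
have [k3 [E3 [k30 eZ o3 N3]]] := unit_ex fw hZ Z0.
have perp (k l : F) (v v' : V) :
    0 < k -> 0 < l -> '[k *: v, l *: v'] = 0 -> '[v, v'] = 0.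
  move=> k0 l0 /eqP; rewrite minkZl minkZr !mulf_eq0.
  by rewrite (gt_eqF k0) (gt_eqF l0) => /eqP.
have E21 : '[E2, E1] = 0 by apply: (perp k2 k1) => //; rewrite -eX -eY.
have E23 : '[E2, E3] = 0 by apply: (perp k2 k3) => //; rewrite -eX -eZ.
have E13 : '[E1, E3] = 0 by apply: (perp k1 k3) => //; rewrite -eY -eZ.
pose A : 'M[F]_4 := \matrix_(i, j) ([:: w; E1; E2; E3]`_i) 0 j.
have rA i : row i A = [:: w; E1; E2; E3]`_i by apply/rowP => j; rewrite !mxE.
have r0 : row 0 A = w by rewrite rA.
have r1 : row 1 A = E1 by rewrite rA.
have r2 : row 2 A = E2 by rewrite rA.
have r3 : row 3 A = E3 by rewrite rA.
have ord4 (i : 'I_4) : [|| i == 0, i == 1, i == 2 | i == 3].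
  by case: i => -[|[|[|[|]]]].
have hA : conformal A.
  rewrite /conformal r0 fw andbT; apply/eqP/matrixP => i j; rewrite gram mxE.
  have [E12 E32 E31] : [/\ '[E1, E2] = 0, '[E3, E2] = 0 & '[E3, E1] = 0].
    by rewrite minkC E21 minkC E23 minkC E13.
  have M1 : '[E1, E1] = - '[w, w] by rewrite -N1 opprK.
  have M2 : '[E2, E2] = - '[w, w] by rewrite -N2 opprK.
  have M3 : '[E3, E3] = - '[w, w] by rewrite -N3 opprK.
  have [w1 w2 w3] := And3 (orthC o1) (orthC o2) (orthC o3).
  case/or4P: (ord4 i) => /eqP ->; case/or4P: (ord4 j) => /eqP ->;
    rewrite mxE ?r0 ?r1 ?r2 ?r3 ?mulr0n ?mulr1n ?mulr0 ?expr0 ?expr1 ?mulr1 ?mulrN1;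
    by rewrite // ?E12 ?E13 ?E21 ?E23 ?E31 ?E32 ?M1 ?M2 ?M3 ?w1 ?w2 ?w3 ?o1 ?o2 ?o3.
exists (Observer (Frame o hA)), s; split=> //.
exists k1, k2, k3; split=> //.
by rewrite /clock /= r0 r1 r2 r3 -eX -eY -eZ.
Qed.

Lemma brel_dom b beta : brel b beta -> ⟦Bdom b⟧.
Proof.
case: beta => [L|f] h; first by left; apply: photon_nEv h.
right; have hE := observer_Ev h; split=> //.
move: h => [s [_ [k1 [k2 [k3 [k10 k20 k30 ->]]]]]].
have fw := clock_fut f.
split; first exact: Fp_part.
do 3![split; first exact/motionless_sym/motionless_pl].
have o1 := orthZ k1 (ax_orth f (isT : 1 != 0 :> 'I_4)).
have o2 := orthZ k2 (ax_orth f (isT : 2 != 0 :> 'I_4)).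
have o3 := orthZ k3 (ax_orth f (isT : 3 != 0 :> 'I_4)).
have n1 := axis_neq0 fw (ax_len f (isT : 1 != 0 :> 'I_4)) k10.
have n2 := axis_neq0 fw (ax_len f (isT : 2 != 0 :> 'I_4)) k20.
have n3 := axis_neq0 fw (ax_len f (isT : 3 != 0 :> 'I_4)) k30.
split; [|split]; apply/Ort_pl => //; split=> //;
  by rewrite minkZl minkZr ax_perp // !mulr0.
Qed.

Lemma brel_surj beta : exists2 b, ⟦Bdom b⟧ & brel b beta.
Proof.
suff [b hb] : exists b, brel b beta by exists b => //; exact: brel_dom hb.
pose a0 := part 0 (axis F) : Par M.
case: beta => [L|f].
  have [q [n [n0 nn eL]]] := svalP L.
  have [h|h] := null_dir nn.
    have [s hs] : exists s, pts s = (q, q + n).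
      by apply: signal_ex; have -> : q + n - q = n by vring.
    by exists (BTuple s a0 s s a0 a0 a0), q, n.
  have [s hs] : exists s, pts s = (q, q + - n).
    by apply: signal_ex; have -> : q - n - q = - n by vring.
  exists (BTuple s a0 s s a0 a0 a0), q, (- n); split; rewrite ?oppr_eq0 // eL.
  rewrite eqEsubset; split=> _ [k _ <-]; exists (- k) => //;
  by rewrite scalerN scaleNr ?opprK.
exists (BTuple (ev 0) (part (org f) (clock f)) (ev (org f)) (ev (org f + clock f))
        (pl (org f) (clock f) (1 *: ax f 2))
        (pl (org f) (clock f) (1 *: ax f 1))
        (pl (org f) (clock f) (1 *: ax f 3))), (ev 0).
split; first exact: Ev_ev.
by exists 1, 1, 1; rewrite !ltr01.
Qed.

Lemma bcorP b f p et ex ey ez : brel b (Observer f) ->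
  let time := tm (org f) (clock f) in
  ⟦bcor (ev p) et ex ey ez b⟧ <-> exists c : V,
    [/\ et = time (c 0 0), ex = time (c 0 1), ey = time (c 0 2),
        ez = time (c 0 3) & p = event_of f c].
Proof.
move=> [s [_ [k1 [k2 [k3 [k10 k20 k30 ->]]]]]] time.
have fw := clock_fut f.
have i1 : (1 : 'I_4) != 0 by []. have i2 : (2 : 'I_4) != 0 by [].
have i3 : (3 : 'I_4) != 0 by []. have i12 : (1 : 'I_4) != 2 by [].
have atE (c : V) : event_of f c = org f + c 0 0 *: clock f +
    (c 0 1 *: ax f 1 + c 0 2 *: ax f 2 + c 0 3 *: ax f 3).
  by rewrite /event_of {1}[c]coordsE coords_mul !addrA.
have H := corP sqrtF (org f) fw (ax_orth f i1) (ax_orth f i2) (ax_orth f i3)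
  (ax_len f i1) (ax_len f i2) (ax_len f i3) k10 k20 k30 (ax_perp f i12) p et ex ey ez.
split.
  move=> /H[t [x [y [z [-> -> -> -> ->]]]]]; exists (coords t x y z).
  by rewrite atE !mxE.
move=> [c [h0 h1 h2 h3 ec]]; apply/H; exists (c 0 0), (c 0 1), (c 0 2), (c 0 3).
by rewrite ec atE.
Qed.

Lemma on_body b beta p : brel b beta ->
  ((~ ⟦Ev (b_sigma b)⟧ -> ⟦wl (ev p) (b_sigma b)⟧) /\
   (⟦Ev (b_sigma b)⟧ -> ⟦T (b_a b) (ev p)⟧)) <-> worldline beta p.
Proof.
case: beta => [L|f] hb; rewrite /worldline.
  have nE := photon_nEv hb; have [q [n [n0 hs ->]]] := hb.
  split; first by move=> [/(_ nE)/(wlP _ hs n0)[k ->] _]; exists k.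
  by move=> [k _ <-]; split=> // _; apply/(wlP _ hs n0); exists k.
have hE := observer_Ev hb; have [s [_ [k1 [k2 [k3 [_ _ _ eb]]]]]] := hb.
have hT : ⟦T (b_a b) (ev p)⟧ <-> line (org f) (clock f) p.
  have -> : b_a b = part (org f) (clock f) by rewrite eb.
  rewrite TP (on_part _ _ (clock_fut f)).
  by split=> [[k ->]|[k _ <-]]; exists k.
by split=> [[_ /(_ hE)/hT]|/hT h].
Qed.

Lemma tr_WP m b mu beta qt qx qy qz t x y z :
  brel m mu -> brel b beta -> qrel qt t -> qrel qx x -> qrel qy y -> qrel qz z ->
  ⟦tr_W m b qt qx qy qz⟧ <-> sr_interp (WorldView mu beta t x y z).
Proof.
move=> hm hb ht hx hy hz; case: mu hm => [L|f] hm.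
  by split=> // -[_]; apply: photon_nEv hm.
have fw := clock_fut f; have hE := observer_Ev hm.
have em : [/\ b_a m = part (org f) (clock f), b_o m = ev (org f) &
    b_u m = ev (org f + clock f)].
  by have [s [_ [k1 [k2 [k3 [_ _ _ ->]]]]]] := hm.
have [ea eo eu] := em; rewrite /tr_W ea eo eu; split.
  move=> [[_ [/EvP[p ->] [[et [ex [ey [ez]]]]]]]].
  move=> [/(repP _ _ ht fw) -> [/(repP _ _ hx fw) -> [/(repP _ _ hy fw) ->]]].
  move=> [/(repP _ _ hz fw) -> /(bcorP _ _ _ _ _ hm)[c]].
  move=> [/(tm_inj fw) -> /(tm_inj fw) -> /(tm_inj fw) -> /(tm_inj fw) -> ep].
  by move=> /(on_body _ hb) h; rewrite /sr_interp -coordsE -ep.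
move=> h; split; last exact: hE.
exists (ev (event_of f (coords t x y z))); split; first exact: Ev_ev.
split; last exact/(on_body _ hb).
exists (tm (org f) (clock f) t), (tm (org f) (clock f) x), (tm (org f) (clock f) y).
exists (tm (org f) (clock f) z).
split; first by apply/(repP _ _ ht fw).
split; first by apply/(repP _ _ hx fw).
split; first by apply/(repP _ _ hy fw).
split; first by apply/(repP _ _ hz fw).
by apply/(bcorP _ _ _ _ _ hm); exists (coords t x y z); rewrite !mxE.
Qed.

(** Observers with the same coordinates for every event have the same frame,
    because coordinates determine the event. *)
Lemma tr_eqBP b b' beta beta' : brel b beta -> brel b' beta' ->
  ⟦tr_eqB b b'⟧ <-> beta = beta'.
Proof.
move=> hb hb'; case: beta hb => [L|f] hb; case: beta' hb' => [L'|f'] hb'.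
- have [nE nE'] := (photon_nEv hb, photon_nEv hb').
  have wL p : ⟦wl (ev p) (b_sigma b)⟧ <-> sval L p.
    have [q [n [n0 hs ->]]] := hb; rewrite (wlP _ hs n0).
    by split=> [[k ->]|[k _ <-]]; exists k.
  have wL' p : ⟦wl (ev p) (b_sigma b')⟧ <-> sval L' p.
    have [q [n [n0 hs ->]]] := hb'; rewrite (wlP _ hs n0).
    by split=> [[k ->]|[k _ <-]]; exists k.
  split=> [[[_ [_ h]]|[/nE]] //|[eL]]; last first.
    rewrite -eL in wL'; left; split=> //; split=> // _ /EvP[p ->].
    by split=> [/wL h|/wL' h]; [apply/wL'|apply/wL].
  congr Photon; case: L L' wL wL' {hb hb'} => [L hL] [L' hL'] /= wL wL'.
  have eL : L = L'.
    rewrite eqEsubset; split=> p.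
      by move/wL => hp; apply/wL'; exact: (proj1 (h (ev p) (@Ev_ev F p)) hp).
    by move/wL' => hp; apply/wL; exact: (proj2 (h (ev p) (@Ev_ev F p)) hp).
  by move: hL hL'; rewrite eL => hL hL'; rewrite (Prop_irrelevance hL hL').
- have [nE hE'] := (photon_nEv hb, observer_Ev hb').
  by split=> // -[[_ [/(_ hE')]]|[/nE]].
- have [hE nE'] := (observer_Ev hb, photon_nEv hb').
  by split=> // -[[/(_ hE)]|[_ [/nE']]].
have [hE hE'] := (observer_Ev hb, observer_Ev hb').
have fw := clock_fut f; have fw' := clock_fut f'.
have em : [/\ b_a b = part (org f) (clock f), b_o b = ev (org f) &
    b_u b = ev (org f + clock f)].
  by have [s [_ [k1 [k2 [k3 [_ _ _ ->]]]]]] := hb.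
have em' : [/\ b_a b' = part (org f') (clock f'), b_o b' = ev (org f') &
    b_u b' = ev (org f' + clock f')].
  by have [s [_ [k1 [k2 [k3 [_ _ _ ->]]]]]] := hb'.
have sq x x' : ⟦same_quantity b b' (tm (org f) (clock f) x)
    (tm (org f') (clock f') x')⟧ <-> x = x'.
  rewrite /same_quantity; have [-> -> ->] := em; have [-> -> ->] := em'.
  by apply: tr_eqQP; [exists (org f), (clock f)|exists (org f'), (clock f')].
split.
  case=> [[/(_ hE)]//|[_ [_ h]]]; congr Observer; apply: frame_ext => c.
  have [t [x [y [z [t' [x' [y' [z' []]]]]]]]] :=
    h (ev (event_of f c)) (@Ev_ev F (event_of f c)).
  move=> /(bcorP _ _ _ _ _ hb)[c1 [-> -> -> -> /event_of_inj <-]].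
  move=> [/(bcorP _ _ _ _ _ hb')[c2 [-> -> -> -> ->]]].
  move=> [/sq h0 [/sq h1 [/sq h2 /sq h3]]].
  by rewrite [c]coordsE h0 h1 h2 h3 -coordsE.
move=> [eff]; rewrite -eff in hb' sq *.
right; split; first exact: hE.
split; first exact: hE'.
move=> _ /EvP[p ->]; have [c ->] := event_of_surj f p.
exists (tm (org f) (clock f) (c 0 0)), (tm (org f) (clock f) (c 0 1)).
exists (tm (org f) (clock f) (c 0 2)), (tm (org f) (clock f) (c 0 3)).
exists (tm (org f) (clock f) (c 0 0)), (tm (org f) (clock f) (c 0 1)).
exists (tm (org f) (clock f) (c 0 2)), (tm (org f) (clock f) (c 0 3)).
split; first by apply/(bcorP _ _ _ _ _ hb); exists c.
split; first by apply/(bcorP _ _ _ _ _ hb'); exists c.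
by do 3![split; first exact/sq]; exact/sq.
Qed.

Lemma allQP (h : qtup -> sig_fml (Par M) (Sig M)) :
  ⟦allQ h⟧ <-> forall q, ⟦Qdom q⟧ -> ⟦h q⟧.
Proof. by split=> [H [e a o u]|H e a o u]; exact: H. Qed.

Lemma exQP (h : qtup -> sig_fml (Par M) (Sig M)) :
  ⟦exQ h⟧ <-> exists q, ⟦Qdom q⟧ /\ ⟦h q⟧.
Proof.
split=> [[e [a [o [u H]]]]|[[e a o u] H]]; first by exists (QTuple e a o u).
by exists e, a, o, u.
Qed.

Lemma allBP (h : btup -> sig_fml (Par M) (Sig M)) :
  ⟦allB h⟧ <-> forall b, ⟦Bdom b⟧ -> ⟦h b⟧.
Proof. by split=> [H [s a o u x y z]|H s a o u x y z]; exact: H. Qed.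

Lemma exBP (h : btup -> sig_fml (Par M) (Sig M)) :
  ⟦exB h⟧ <-> exists b, ⟦Bdom b⟧ /\ ⟦h b⟧.
Proof.
split=> [[s [a [o [u [x [y [z H]]]]]]]|[[s a o u x y z] H]].
  by exists (BTuple s a o u x y z).
by exists s, a, o, u, x, y, z.
Qed.

Lemma allQ2_rel (h : qtup -> qtup -> sig_fml (Par M) (Sig M)) :
  (forall q q' x, qrel q x -> qrel q' x -> ⟦h q q'⟧) -> ⟦allQ2 h⟧.
Proof.
move=> H; apply/allQP => q /qrel_ex[x hx]; apply/allQP => q' /qrel_ex[x' hx'].
by move/(tr_eqQP hx hx') => e; apply: (H _ _ x) => //; rewrite e.
Qed.

Lemma allB2_rel (h : btup -> btup -> sig_fml (Par M) (Sig M)) :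
  (forall b b' beta, brel b beta -> brel b' beta -> ⟦h b b'⟧) -> ⟦allB2 h⟧.
Proof.
move=> H; apply/allBP => b /brel_ex[x hx]; apply/allBP => b' /brel_ex[x' hx'].
by move/(tr_eqBP hx hx') => e; apply: (H _ _ x) => //; rewrite e.
Qed.

Inductive atom_rel : sr_atom btup qtup -> sr_atom (body F) F -> Prop :=
| relObs b beta of brel b beta : atom_rel (Obs _ b) (Obs _ beta)
| relPh b beta of brel b beta : atom_rel (Ph _ b) (Ph _ beta)
| relPlus q q1 q2 x x1 x2 of qrel q x & qrel q1 x1 & qrel q2 x2 :
    atom_rel (Plus _ q q1 q2) (Plus _ x x1 x2)
| relTimes q q1 q2 x x1 x2 of qrel q x & qrel q1 x1 & qrel q2 x2 :
    atom_rel (Times _ q q1 q2) (Times _ x x1 x2)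
| relW m b mu beta qt qx qy qz t x y z of brel m mu & brel b beta &
    qrel qt t & qrel qx x & qrel qy y & qrel qz z :
    atom_rel (WorldView m b qt qx qy qz) (WorldView mu beta t x y z)
| relEqB b b' beta beta' of brel b beta & brel b' beta' :
    atom_rel (EqB _ b b') (EqB _ beta beta')
| relEqQ q q' x x' of qrel q x & qrel q' x' :
    atom_rel (EqQ _ q q') (EqQ _ x x').

(** A sentence is uniform in the types of its variables, so it can be instantiated
    with tuples as well as with values.  This relation connects the two instances:
    equal shape, with bound variables ranging over tuples and their values. *)
Inductive fml_rel : sr_fml btup qtup -> sr_fml (body F) F -> Prop :=
| relAtom u u' of atom_rel u u' : fml_rel (Atom u) (Atom u')
| relNot h h' of fml_rel h h' : fml_rel (Not h) (Not h')
| relAnd h h' j j' of fml_rel h h' & fml_rel j j' : fml_rel (And h j) (And h' j')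
| relOr h h' j j' of fml_rel h h' & fml_rel j j' : fml_rel (Or h j) (Or h' j')
| relImp h h' j j' of fml_rel h h' & fml_rel j j' : fml_rel (Imp h j) (Imp h' j')
| relAll1 h h' of (forall b beta, brel b beta -> fml_rel (h b) (h' beta)) :
    fml_rel (All1 h) (All1 h')
| relAll2 h h' of (forall q x, qrel q x -> fml_rel (h q) (h' x)) :
    fml_rel (All2 h) (All2 h')
| relEx1 h h' of (forall b beta, brel b beta -> fml_rel (h b) (h' beta)) :
    fml_rel (Ex1 h) (Ex1 h')
| relEx2 h h' of (forall q x, qrel q x -> fml_rel (h q) (h' x)) :
    fml_rel (Ex2 h) (Ex2 h').

Lemma tr_ObsP b beta : brel b beta -> ⟦tr_Obs b⟧ <-> exists f, beta = Observer f.
Proof.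
case: beta => [L|f] hb.
  by split=> [[/(photon_nEv hb)]|[]].
split=> [_|_]; first by exists f.
by have := brel_dom hb; case=> // /(_ (observer_Ev hb)).
Qed.

Lemma tr_PhP b beta : brel b beta -> ⟦tr_Ph b⟧ <-> exists L, beta = Photon L.
Proof.
case: beta => [L|f] hb; split=> [h|h].
- by exists L.
- exact: photon_nEv hb.
- by case: h; exact: observer_Ev hb.
- by case: h.
Qed.

Lemma tr_atomP u u' : atom_rel u u' -> ⟦tr_atom u⟧ <-> sr_interp u'.
Proof.
case=> *; [exact: tr_ObsP|exact: tr_PhP|exact: tr_plusP|exact: tr_timesP|
  exact: tr_WP|exact: tr_eqBP|exact: tr_eqQP].
Qed.

(** A quantifier over tuples amounts to one over values because every tuple has a
    value and every value occurs. *)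
Lemma tr_fmlP h h' : fml_rel h h' -> ⟦tr_fml h⟧ <-> holds (@sr_interp F) h'.
Proof.
elim=> {h h'} [u u'|h h' _ IH|h h' j j' _ IH _ IH'|h h' j j' _ IH _ IH'|
    h h' j j' _ IH _ IH'|h h' _ IH|h h' _ IH|h h' _ IH|h h' _ IH].
- exact: tr_atomP.
- by split=> n /IH.
- by split=> -[/IH ? /IH' ?].
- by split=> -[/IH ?|/IH' ?]; [left|right|left|right].
- by split=> i /IH/i/IH'.
- split=> [/allBP H beta|H].
    by have [b hb rb] := brel_surj beta; apply/(IH _ _ rb)/H.
  by apply/allBP => b /brel_ex[beta rb]; apply/(IH _ _ rb)/H.
- split=> [/allQP H x|H].
    by have [q hq rq] := qrel_surj x; apply/(IH _ _ rq)/H.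
  by apply/allQP => q /qrel_ex[x rq]; apply/(IH _ _ rq)/H.
- split=> [/exBP[b [/brel_ex[beta rb] H]]|[beta H]].
    by exists beta; apply/(IH _ _ rb).
  have [b hb rb] := brel_surj beta.
  by apply/exBP; exists b; split=> //; apply/(IH _ _ rb).
split=> [/exQP[q [/qrel_ex[x rq] H]]|[x H]].
  by exists x; apply/(IH _ _ rq).
have [q hq rq] := qrel_surj x.
by apply/exQP; exists q; split=> //; apply/(IH _ _ rq).
Qed.

End Interpretation.

(** The shape of a sentence determines the derivation. *)
Ltac fml_relate := repeat (intros; first
  [ apply: relAtom; constructor; eassumption | apply: relNot | apply: relAnd
  | apply: relOr | apply: relImp | apply: relAll1 | apply: relAll2
  | apply: relEx1 | apply: relEx2 ]).

Lemma AxPh_rel (F : realFieldType) : @fml_rel F (AxPh _ _) (AxPh _ _).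
Proof. rewrite /AxPh; fml_relate. Qed.
Lemma AxEv_rel (F : realFieldType) : @fml_rel F (AxEv _ _) (AxEv _ _).
Proof. rewrite /AxEv; fml_relate. Qed.
Lemma AxSelf_rel (F : realFieldType) : @fml_rel F (AxSelf _ _) (AxSelf _ _).
Proof. rewrite /AxSelf; fml_relate. Qed.
Lemma AxFd_rel (F : realFieldType) : @fml_rel F (AxFd _ _) (AxFd _ _).
Proof. rewrite /AxFd; fml_relate. Qed.

Theorem theorem6p1 :
  (SigTh_entails eqQ_equivalence /\ SigTh_entails eqB_equivalence) /\
  [/\ SigTh_entails plus_invariant, SigTh_entails times_invariant,
      SigTh_entails Ph_invariant, SigTh_entails Obs_invariant &
      SigTh_entails W_invariant] /\
  (forall psi : sr_sentence, SpecRel0 psi -> SigTh_entails (tr psi)).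
Proof.
split; [split|split; [split|]].
- move=> F sqrtF; split; [|split].
  + apply/allQP => q /(qrel_ex sqrtF)[x hx]; exact/(tr_eqQP sqrtF hx hx).
  + apply/allQP => q /(qrel_ex sqrtF)[x hx]; apply/allQP => q' /(qrel_ex sqrtF)[x' hx'].
    by move/(tr_eqQP sqrtF hx hx')=> h; apply/(tr_eqQP sqrtF hx' hx).
  + apply/allQP => q /(qrel_ex sqrtF)[x hx]; apply/allQP => q' /(qrel_ex sqrtF)[x' hx'].
    apply/allQP => q2 /(qrel_ex sqrtF)[x2 hx2].
    move=> /(tr_eqQP sqrtF hx hx') e /(tr_eqQP sqrtF hx' hx2) e'.
    by apply/(tr_eqQP sqrtF hx hx2); rewrite e.
- move=> F sqrtF; split; [|split].
  + apply/allBP => b /(brel_ex sqrtF)[x hx]; exact/(tr_eqBP sqrtF hx hx).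
  + apply/allBP => b /(brel_ex sqrtF)[x hx]; apply/allBP => b' /(brel_ex sqrtF)[x' hx'].
    by move/(tr_eqBP sqrtF hx hx')=> h; apply/(tr_eqBP sqrtF hx' hx).
  + apply/allBP => b /(brel_ex sqrtF)[x hx]; apply/allBP => b' /(brel_ex sqrtF)[x' hx'].
    apply/allBP => b2 /(brel_ex sqrtF)[x2 hx2].
    move=> /(tr_eqBP sqrtF hx hx') e /(tr_eqBP sqrtF hx' hx2) e'.
    by apply/(tr_eqBP sqrtF hx hx2); rewrite e.
- move=> F sqrtF; apply: (allQ2_rel sqrtF) => q q' x hq hq'.
  apply: (allQ2_rel sqrtF) => q1 q1' x1 hq1 hq1'.
  apply: (allQ2_rel sqrtF) => q2 q2' x2 hq2 hq2'.
  split=> H.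
    exact/(tr_plusP sqrtF hq' hq1' hq2')/(tr_plusP sqrtF hq hq1 hq2).
  exact/(tr_plusP sqrtF hq hq1 hq2)/(tr_plusP sqrtF hq' hq1' hq2').
- move=> F sqrtF; apply: (allQ2_rel sqrtF) => q q' x hq hq'.
  apply: (allQ2_rel sqrtF) => q1 q1' x1 hq1 hq1'.
  apply: (allQ2_rel sqrtF) => q2 q2' x2 hq2 hq2'.
  split=> H.
    exact/(tr_timesP sqrtF hq' hq1' hq2')/(tr_timesP sqrtF hq hq1 hq2).
  exact/(tr_timesP sqrtF hq hq1 hq2)/(tr_timesP sqrtF hq' hq1' hq2').
- move=> F sqrtF; apply: (allB2_rel sqrtF) => b b' beta hb hb'.
  split=> [/(tr_PhP hb)|/(tr_PhP hb')] H;
  by [apply/(tr_PhP hb')|apply/(tr_PhP hb)].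
- move=> F sqrtF; apply: (allB2_rel sqrtF) => b b' beta hb hb'.
  split=> [/(tr_ObsP sqrtF hb)|/(tr_ObsP sqrtF hb')] H;
  by [apply/(tr_ObsP sqrtF hb')|apply/(tr_ObsP sqrtF hb)].
- move=> F sqrtF; apply: (allB2_rel sqrtF) => m m' mu hm hm'.
  apply: (allB2_rel sqrtF) => b b' beta hb hb'.
  apply: (allQ2_rel sqrtF) => qt qt' t ht ht'.
  apply: (allQ2_rel sqrtF) => qx qx' x hx hx'.
  apply: (allQ2_rel sqrtF) => qy qy' y hy hy'.
  apply: (allQ2_rel sqrtF) => qz qz' z hz hz'.
  have P := tr_WP sqrtF hm hb ht hx hy hz.
  have P' := tr_WP sqrtF hm' hb' ht' hx' hy' hz'.
  by split=> [/P H|/P' H]; [apply/P'|apply/P].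
move=> psi ax F sqrtF; case: ax => ->.
- exact/(tr_fmlP sqrtF (AxPh_rel F))/model_AxPh.
- exact/(tr_fmlP sqrtF (AxEv_rel F))/model_AxEv.
- exact/(tr_fmlP sqrtF (AxSelf_rel F))/model_AxSelf.
- exact/(tr_fmlP sqrtF (AxFd_rel F))/model_AxFd.
Qed.
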